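(* Let $\beta>1$, $\beta\notin\mathbb{N}$, let $\Sigma^\beta$ be the (two-sided) $\beta$-shift, and let $\varphi\in C(\Sigma^\beta)$ be a function of bounded total oscillations on $\Sigma^\beta$, i.e. $\|\varphi\|_\delta<\infty$. 1) If $\nu$ is an equilibrium measure for $\varphi$ and if $$\lim_{n\to\infty}\frac{\overline{z}^\beta(n)}{n}=0,$$ then $\nu$ is a weak Gibbs measure for $\psi=\varphi-p(\varphi)$. 2) If $\nu$ is an equilibrium measure for $\varphi$ and if $$\limsup_{n\to\infty}\frac{\overline{z}^\beta(n)}{n}>0,$$ then $\nu$ is not a weak Gibbs measure for $\psi=\varphi-p(\varphi)$.
   Context: **$\beta$-shift.** Let $\beta>1$, $\beta\notin\mathbb{N}$, ${\tt b}:=\lceil\beta\rceil$, ${\tt A}:=\{0,\ldots,{\tt b}-1\}$. The sequence $c^\beta=(c_1,c_2,\ldots)$ is given by $r_0:=1$, $c_{i+1}:=\lceil\beta r_i\rceil-1$, $r_{i+1}:=\beta r_i-c_{i+1}$ for $i\ge 0$; then $1=\sum_{i\ge1}c_i\beta^{-i}$, all $r_i>0$, $c_1={\tt b}-1>0$, and $c^\beta$ does not end with zeros only. With $\preceq$ the lexicographic order and $T$ the left shift, $X^\beta:=\{x\in{\tt A}^{\mathbb{N}}: T^kx\preceq c^\beta\ \forall k\ge0\}$ and $$\Sigma^\beta:=\{x\in{\tt A}^{\mathbb{Z}}:\ (x_k,x_{k+1},\ldots)\in X^\beta\ \ \forall k\in\mathbb{Z}\},$$ with the product topology and the left shift $T$,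 $(Tx)_k=x_{k+1}$. $\mathcal{L}^\beta_m$ is the set of words of length $m$ occurring in elements of $\Sigma^\beta$. **The quantity $\overline{z}^\beta$.** For a prefix $u$ of $c^\beta$: $z^\beta(u):=0$ if $u$ is the empty word, and $z^\beta(u):=p$ if $u=c_1\cdots c_\ell$, $c_{\ell+1}=\cdots=c_{\ell+p}=0$ and $c_{\ell+p+1}>0$ ($p\ge 0$). Set $\overline{z}^\beta(n):=\max\{z^\beta(u): u\text{ prefix of }c^\beta,\ |u|\le n\}$. **Bounded total oscillations.** For $\bar f\in C({\tt A}^{\mathbb{Z}})$ and $i\in\mathbb{Z}$ let $\delta_i(\bar f):=\sup\{|\bar f(x)-\bar f(y)|: x,y\in{\tt A}^{\mathbb{Z}},\ x_k=y_k\ \forall k\ne i\}$ and $\|\bar f\|_\delta:=\sum_{i\in\mathbb{Z}}\delta_i(\bar f)$. For $f\in C(\Sigma^\beta)$ let $\|f\|_\delta:=\inf\{\|\bar f\|_\delta:\bar f\in C({\tt A}^{\mathbb{Z}}),\ \bar f=f\text{ on }\Sigma^\beta\}$. The function $f$ has bounded total oscillations if $\|f\|_\delta<\infty$. **Pressure and equilibrium measures.** For each $n$ choose $E^n\subset\Sigma^\beta$ such that $x\mapsto x_{-n}\cdots x_n$ is a bijection from $E^n$ onto $\mathcal{L}^\beta_{2n+1}$. The pressure of a continuous $\varphi$ is $p(\varphi):=\lim_{n\to\infty}\frac{1}{2n+1}\ln\sum_{x\in E^n}\exp\big(\sum_{j=-n}^n\varphi(T^jx)\big)$, which is independent of the choice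 of the $E^n$. A $T$-invariant Borel probability measure $\nu$ on $\Sigma^\beta$ is an equilibrium measure for $\varphi$ if $p(\varphi)=h_T(\nu)+\int\varphi\,d\nu$ ($h_T$ the metric entropy); equivalently, $p(\varphi+f)\ge p(\varphi)+\int f\,d\nu$ for all continuous $f$. **Weak Gibbs measure.** A $T$-invariant probability measure $\nu$ on $\Sigma^\beta$ is a weak Gibbs measure for a continuous function $\psi$ if for every $\delta>0$ there exists $N_\delta$ such that for all $m\ge N_\delta$, $$\sup_{x\in\Sigma^\beta}\Big|\frac1m\ln\nu([x_0\cdots x_{m-1}])-\frac1m\sum_{\ell=0}^{m-1}\psi(T^\ell x)\Big|\le\delta,$$ where $[x_0\cdots x_{m-1}]=\{y\in\Sigma^\beta:y_0\cdots y_{m-1}=x_0\cdots x_{m-1}\}$ (with $\ln 0=-\infty$). *)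

(* Defs.v *)
From HB Require Import structures.
From mathcomp Require Import all_boot all_order all_algebra.
From mathcomp Require Import all_classical all_reals all_analysis.

Set Implicit Arguments.
Unset Strict Implicit.
Unset Printing Implicit Defensive.

Import Order.TTheory GRing.Theory Num.Theory.
Import numFieldNormedType.Exports.

Local Open Scope classical_set_scope.
Local Open Scope ring_scope.

(* The alphabet {0, ..., N}, discrete and pointed by 0. *)
Definition letter (N : nat) : Type := discrete_topology 'I_N.+1.

HB.instance Definition _ (N : nat) := Finite.copy (letter N) 'I_N.+1.
HB.instance Definition _ (N : nat) :=
  isPointed.Build (letter N) (ord0 : 'I_N.+1).
HB.instance Definition _ (N : nat) :=
  DiscreteTopology.copy (letter N) (discrete_topology 'I_N.+1).

Definition digit (N : nat) (a : letter N) : int :=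
  (nat_of_ord (a : 'I_N.+1))%:Z.

Definition config (N : nat) : Type :=
  prod_topology (fun _ : int => letter N).

HB.instance Definition _ (N : nat) := Topological.on (config N).
HB.instance Definition _ (N : nat) :=
  Pointed.copy (config N) (int -> letter N).

(* The same type with its Borel sigma-algebra. *)
Notation borel_config N := (g_sigma_algebraType (@open (config N))).

(* tshift j is the power T^j of the left shift T, for every integer j. *)
Definition tshift (N : nat) (j : int) (x : config N) : config N :=
  fun k => x (k + j).

(* The word x_k x_(k+1) ... x_(k+m-1). *)
Definition word_at (N : nat) (k : int) (m : nat) (x : config N)
    : m.-tuple (letter N) :=
  [tuple x (k + (nat_of_ord i)%:Z) | i < m].

Definition language (N : nat) (Sg : set (config N)) (m : nat)
    : set (m.-tuple (letter N)) :=
  [set w | exists x, exists k : int, Sg x /\ w = word_at k m x].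
Arguments language {N} Sg m.

Definition cylinder (N : nat) (Sg : set (config N)) (x : config N) (m : nat)
    : set (config N) :=
  [set y | Sg y /\ word_at 0 m y = word_at 0 m x].

Section beta_shift.
Variables (R : realType) (beta : R).

(* Sequences are indexed from 0: cbeta i is the digit c_(i+1). *)
Fixpoint rbeta (n : nat) : R :=
  if n is i.+1 then beta * rbeta i - (Num.ceil (beta * rbeta i) - 1)%:~R
  else 1.

Definition cbeta (i : nat) : int := Num.ceil (beta * rbeta i) - 1.

Definition lex_le (x y : nat -> int) : Prop :=
  (forall i, x i = y i) \/
  exists n, (forall i, (i < n)%N -> x i = y i) /\ x n < y n.

(* The alphabet is {0, ..., ceil beta - 1}. *)
Definition top_digit : nat := (`|Num.ceil beta|%N).-1.

Definition Xbeta : set (nat -> letter top_digit) :=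
  [set x | forall k : nat, lex_le (fun i => digit (x (k + i)%N)) cbeta].

Definition Sigma_beta : set (config top_digit) :=
  [set x | forall k : int, Xbeta (fun i => x (k + i%:Z))].

(* z(u) for u the prefix of length l; for l > 0 exactly one p qualifies,
   because c does not end with zeros only. *)
Definition zbeta (l : nat) : nat :=
  if l == 0%N then 0%N
  else xget 0%N [set p : nat |
    (forall j, (j < p)%N -> cbeta (l + j)%N = 0) /\ 0 < cbeta (l + p)%N].

Definition zbar (n : nat) : nat := (\max_(l < n.+1) zbeta l)%N.

End beta_shift.
Arguments Xbeta {R} beta.
Arguments Sigma_beta {R} beta.

Section oscillations.
Variables (R : realType) (N : nat).

Definition osc (g : config N -> R) (i : int) : \bar R :=
  ereal_sup [set t | exists x, exists y : config N,
    (forall k, k != i -> x k = y k) /\ t = `|g x - g y|%:E].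

Definition total_osc (g : config N -> R) : \bar R :=
  \esum_(i in [set: int]) osc g i.

Definition total_osc_on (Sg : set (config N)) (f : config N -> R) : \bar R :=
  ereal_inf [set total_osc g | g in
    [set g : config N -> R | continuous g /\ forall x, Sg x -> g x = f x]].

End oscillations.

Section pressure.
Variables (R : realType) (N : nat) (Sg : set (config N)).

Definition word_transversal (E : nat -> set (config N)) : Prop :=
  forall n : nat, E n `<=` Sg /\
    set_bij (E n) (language Sg (2 * n + 1)%N)
      (word_at (- n%:Z) (2 * n + 1)%N).

Definition pressure (E : nat -> set (config N)) (phi : config N -> R) : R :=
  limn (fun n : nat =>
    ln (\sum_(x \in E n)
          expR (\sum_(j < 2 * n + 1) phi (tshift (j%:Z - n%:Z) x)))
    / (2 * n + 1)%N%:R).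

End pressure.

(* A finite measurable partition of T is given by its labelling
   xi : T -> 'I_k, with measurable fibres; empty fibres do not affect
   entropies. *)
Section entropy.
Context {R : realType} {d : measure_display} {T : measurableType d}.
Variables (mu : probability T R) (f : T -> T).

Definition join_entropy (k : nat) (xi : T -> 'I_k) (n : nat) : R :=
  - \sum_(w : n.-tuple 'I_k)
      let p := fine (mu [set x | forall i : 'I_n, xi (iter i f x) = tnth w i])
      in p * ln p.

Definition partition_entropy (k : nat) (xi : T -> 'I_k) : R :=
  limn (fun n : nat => join_entropy xi n / n%:R).

Definition metric_entropy : \bar R :=
  ereal_sup [set h | exists k : nat, exists xi : T -> 'I_k,
    (forall a, measurable (xi @^-1` [set a])) /\
    h = (partition_entropy xi)%:E].

End entropy.

Section measures.
Variables (R : realType) (N : nat) (Sg : set (config N)).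

(* An invariant Borel probability on the closed shift-invariant set Sg is
   encoded as a Borel probability on the full shift that gives Sg mass 1. *)
Definition invariant_on (nu : probability (borel_config N) R) : Prop :=
  nu Sg = 1%E /\
  forall B : set (borel_config N), measurable B -> nu (tshift 1 @^-1` B) = nu B.

Definition equilibrium_measure (E : nat -> set (config N))
    (phi : config N -> R) (nu : probability (borel_config N) R) : Prop :=
  invariant_on nu /\
  (pressure E phi)%:E =
    (metric_entropy nu (tshift 1) + \int[nu]_(x in Sg) (phi x)%:E)%E.

Definition weak_Gibbs (psi : config N -> R)
    (nu : probability (borel_config N) R) : Prop :=
  invariant_on nu /\
  forall delta : R, 0 < delta -> exists Nd : nat, forall m, (Nd <= m)%N ->
    (ereal_sup [set `|(m%:R^-1)%:E * lne (nu (cylinder Sg x m))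
                      - (m%:R^-1 * \sum_(l < m) psi (tshift l%:Z x))%:E|
               | x in Sg] <= delta%:E)%E.

End measures.

(* Main.v *)
Require Import Defs.
From mathcomp Require Import all_boot all_order all_algebra.
From mathcomp Require Import all_classical all_reals all_analysis.
From mathcomp Require Import measurable_realfun.
From mathcomp Require Import zify ring lra.

Set Implicit Arguments.
Unset Strict Implicit.
Unset Printing Implicit Defensive.

Import Order.TTheory GRing.Theory Num.Theory.
Import numFieldNormedType.Exports.

Local Open Scope classical_set_scope.
Local Open Scope ring_scope.


(** Write S w for the sum of phi along the orbit segment that reads the word w,
    the configuration being filled up with zeros, and Z n for the sum of
    exp (S w) over the admissible words of length n. Then ln (Z n) / n tends to
    the pressure p ([Zw_growth], [pressureE]). All error terms are of the form
    C + n e, with e as small as desired and C depending on e only.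

    Bounded total oscillations mean that changing k letters of a configuration
    changes its energy by at most k D, wherever these letters are
    ([birk_diff_le]), and that the cost of changing a whole block is the
    difference of the energies of the two blocks up to C + n e, whatever the
    surroundings ([Sw_swap]). Two facts follow.

    First, S w <= n (p - kappa) + C for every admissible w of length n, with
    some kappa > 0 ([energy_gap]). Sparse changes, each at a cost of at most D,
    create exponentially many words out of w: nonzero letters may always be
    lowered, and where w has few of them it is close to a word of zeros, in
    which isolated nonzero letters may be inserted.

    Second, in the finite-volume measure with weights exp (S w), a block a at a
    given place may be exchanged for a block b, the ratio of the masses being
    exp (S b - S a) up to C + n e ([block_exchange]). The difficulty is that the
    past may force the letters of the block: this happens when the past ends
    with a prefix u of the expansion of one. But u is maximal among the words of
    its length, so the past with u removed allows any word in place of u. All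
    words u' are thus admitted, at the price of losing the information u; since
    u is determined by its length l, the price is the sum over l of
    exp (S u) / Z l, which converges by the first fact. To the right of b
    there must be no constraint either, which is the case when b is free, that
    is, when all its suffixes are strictly below the expansion.

    The exchange may be iterated over consecutive blocks ([sum_block_prod_le]).
    On the other hand, an equilibrium measure nu satisfies h + int phi = p, and
    Gibbs' inequality says that H + sum P g <= ln (sum exp g) for the law P of
    the words of length n under nu and every weight g. Taking for g the energy
    plus a function of the successive blocks, and dividing by the number of
    blocks, gives [block_variational]. A weight that favours one block w yields
    nu w <= exp (S w - n p + C + n e) ([wmass_upper]), and a weight that
    penalizes it yields the opposite inequality when w is free ([wmass_lower]).
    The entropy of nu is compared with the entropy of words by the
    Kolmogorov-Sinai argument ([entropy_rate]).

    In part 1, any admissible w of length n becomes free once it is followed by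
    zbar n + 1 zeros ([free_cat_zeros]), which costs O(zbar n) = o(n); so the
    lower bound holds for all admissible words, and nu is weak Gibbs. In part 2,
    a prefix u of the expansion of length l that is followed by z zeros has the
    same cylinder as u 0^z, whereas the sum of phi - p drops by about
    z (p - phi 0), and p > phi 0 by the first fact; if z is not o(l), this
    contradicts the weak Gibbs property. *)

(** * Words and the lexicographic constraint *)

Section words.
Variables (N : nat) (c : nat -> nat).
Notation A := 'I_N.+1.
Implicit Types (w s u f y l r v : seq A) (a : A) (i j k m n : nat).

(** [wle w i] and [wlt w i] compare [w] with the segment of the same length of
    the expansion [c] that starts at index [i]; in [wlt] the difference shows
    within [w], so that it survives any continuation. *)
Fixpoint wle w i : bool :=
  if w is a :: w' then (a < c i)%N || (nat_of_ord a == c i) && wle w' i.+1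
  else true.

Fixpoint wlt w i : bool :=
  if w is a :: w' then (a < c i)%N || (nat_of_ord a == c i) && wlt w' i.+1
  else false.

Fixpoint good w : bool := if w is a :: w' then wle w 0 && good w' else true.

(** The constraints born in [y] are all settled strictly within [y ++ u], hence
    no later letter can violate them. *)
Fixpoint sfree y u : bool :=
  if y is a :: y' then wlt (y ++ u) 0 && sfree y' u else true.

Definition free w := sfree w [::].

Lemma free_cons a w : free (a :: w) = wlt (a :: w) 0 && free w.
Proof. by rewrite /free /= cats0. Qed.

Definition cword i n : seq A := [seq inord (c k) | k <- iota i n].

Lemma wltW w i : wlt w i -> wle w i.
Proof.
elim: w i => //= a w IH i /orP[->//|/andP[-> /IH ->]]; exact: orbT.
Qed.

Lemma wlt_cat w v i : wlt w i -> wlt (w ++ v) i.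
Proof.
elim: w i => //= a w IH i /orP[->//|/andP[-> /IH ->]]; exact: orbT.
Qed.

Lemma wle_catl w v i : wle (w ++ v) i -> wle w i.
Proof.
elim: w i => //= a w IH i /orP[->//|/andP[-> /IH ->]]; exact: orbT.
Qed.

Lemma wlt_cat_eq w v i : wle w i -> wlt v (i + size w) -> wlt (w ++ v) i.
Proof.
elim: w i => [|a w IH] i /=; first by rewrite addn0.
move=> /orP[->//|/andP[-> h]]; rewrite addnS -addSn => h2.
by rewrite IH // orbT.
Qed.

Lemma size_cword i n : size (cword i n) = n.
Proof. by rewrite size_map size_iota. Qed.

Lemma cword_cat i n m : cword i (n + m) = cword i n ++ cword (i + n) m.
Proof. by rewrite /cword iotaD map_cat. Qed.

Lemma good_cat w v : good (w ++ v) -> good w /\ good v.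
Proof.
elim: w => //= a w IH /andP[h /IH[-> ->]].
by have /= -> := @wle_catl (a :: w) v 0 h.
Qed.

Lemma sfree_free y f : sfree y f -> free f -> free (y ++ f).
Proof.
elim: y => //= a y IH /andP[h1 h2] h3; rewrite /free /= cats0 in h1 *.
by rewrite h1; exact: IH.
Qed.

(** This is what free words are for: they impose nothing on what follows. *)
Lemma free_good_cat w v : free w -> good v -> good (w ++ v).
Proof.
elim: w => //= a w IH /andP[h1 h2] h3; rewrite cats0 in h1.
have /= -> := wltW (@wlt_cat (a :: w) v 0 h1).
exact: IH.
Qed.

Lemma free_good w : free w -> good w.
Proof. by move=> h; rewrite -(cats0 w); exact: free_good_cat. Qed.

Lemma free_cat w v : free w -> free v -> free (w ++ v).
Proof.
elim: w => //= a w IH; rewrite /free /= !cats0 => /andP[h1 h2] h3.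
have /= -> := @wlt_cat (a :: w) v 0 h1.
exact: IH.
Qed.

Notation zeros n := (nseq n (ord0 : A)).

Definition nonzeros w := count (fun a => a != ord0) w.

Definition below v w := all2 (fun a b : A => (a <= b)%N) v w.

Lemma below_refl w : below w w.
Proof. by elim: w => //= a w ->; rewrite leqnn. Qed.

Lemma below_wle v w i : below v w -> wle w i -> wle v i.
Proof.
elim: v w i => [|a v IH] [|b w] i //= /andP[h1 h2].
move=> /orP[h|/andP[/eqP h3 h4]]; first by rewrite (leq_ltn_trans h1 h).
by rewrite (IH _ _ h2 h4) -h3 andbT orbC -leq_eqVlt.
Qed.

Lemma below_good v w : below v w -> good w -> good v.
Proof.
elim: v w => [|a v IH] [|b w] //= /andP[h1 h2] /andP[h3 h4].
rewrite (IH _ h2 h4) andbT.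
by apply: (@below_wle (a :: v) (b :: w) 0 _ h3); rewrite /= h1.
Qed.

Lemma below_cat v v' w w' :
  below v w -> below v' w' -> below (v ++ v') (w ++ w').
Proof.
elim: v w => [|a v IH] [|b w] //= /andP[-> h] h'; exact: IH.
Qed.

Hypothesis c0_gt0 : (0 < c 0)%N.

Lemma good_zeros n : good (zeros n).
Proof. by elim: n => //= n ->; rewrite c0_gt0. Qed.

Lemma free_zeros n : free (zeros n).
Proof. by elim: n => //= n h; rewrite /free /= c0_gt0. Qed.

Lemma good_cat_zeros w n : good w -> good (w ++ zeros n).
Proof.
elim: w => [|a w IH] /=; first by move=> _; exact: good_zeros.
move=> /andP[h1 /IH ->]; rewrite andbT.
suff : wle (w ++ zeros n) 1 || ~~ wle w 1.
  by case/orP: h1 => [->//|/andP[-> ->]] /orP[->|//]; rewrite orbT.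
elim: w (1%N) {IH h1} => [|b w IH] i /=.
  by rewrite orbF; elim: n i => //= n IH i; rewrite IH andbT orbC -leq_eqVlt.
case: (b < c i)%N => //=; case: (_ == _) => //=; exact: IH.
Qed.

(** A lowered letter makes strict every comparison that starts at or before it,
    and the comparisons that start later meet a zero, which is below [c 0]. *)
Lemma good_dec_free y a a' n : good (y ++ a :: zeros n) -> (a' < a)%N ->
  free (y ++ a' :: zeros n).
Proof.
move=> + ha; elim: y => [|b y IH] /=.
  move=> /andP[h _]; rewrite /free /= -/(free _) free_zeros andbT cats0.
  by case/orP: h => [h|/andP[/eqP <- _]]; rewrite ?(ltn_trans ha h) ?ha.
move=> /andP[h /IH h']; rewrite /free /= -/(free _) h' andbT cats0.
case/orP: h => [->//|/andP[-> h]]; rewrite orbC; apply/orP; left => /=.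
elim: y (1%N) h {IH h'} => [|b' y IH] i /=.
  by case/orP=> [h|/andP[/eqP <- _]]; rewrite ?(ltn_trans ha h) ?ha.
by case/orP=> [->//|/andP[-> /IH ->]]; rewrite orbT.
Qed.

Hypothesis cN : forall i, (c i <= N)%N.

Lemma wlt_cword_sub f i j n : size f = n -> wle f i -> wlt (cword i n) j ->
  wlt f j.
Proof.
elim: n f i j => [|n IH] [|a f] i j //= [sf].
rewrite inordK ?ltnS ?cN //.
move=> /orP[h1|/andP[/eqP h1 h2]] /orP[h3|/andP[/eqP h3 h4]].
- by rewrite (ltn_trans h1 h3).
- by rewrite -h3 h1.
- by rewrite h1 h3.
- by rewrite h1 h3 eqxx (IH _ _ _ sf h2 h4) orbT.
Qed.

(** A prefix of the expansion is maximal among the admissible words of its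
    length, so the comparisons that are strict for [y ++ u] with [u] such a
    prefix remain strict when [u] is replaced by any [f]. *)
Lemma swap_free y f : sfree y (cword 0 (size f)) -> free f -> free (y ++ f).
Proof.
move=> h hf; apply: sfree_free => //; elim: y h => //= a y IH /andP[h /IH ->].
have hg : wle f 0.
  by move: (free_good hf); case: (f) => //= ? ? /andP[].
rewrite andbT; move: h.
suff H : forall s i, wlt (s ++ cword 0 (size f)) i -> wlt (s ++ f) i.
  by move=> h; exact: (H (a :: y) 0%N).
elim=> [|b s IHs] i /=; first exact: wlt_cword_sub.
by move=> /orP[->//|/andP[-> /IHs ->]]; rewrite orbT.
Qed.

Lemma wle_eq_or_wlt w i : wle w i -> w = cword i (size w) \/ wlt w i.
Proof.
elim: w i => [|a w IH] i /=; first by left.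
move=> /orP[->|/andP[/eqP h /IH[h2|->]]]; [by right| left|].
  by rewrite /cword /= -h inord_val {1}h2 /cword.
by right; rewrite h eqxx orbT.
Qed.

End words.

(** * Sums over the words of a given length *)

Section word_sums.
Variables (R : realType) (N : nat).
Notation A := 'I_N.+1.
Implicit Types (F G : seq A -> R) (n m : nat).

Fixpoint sumw n F : R :=
  if n is n'.+1 then \sum_(a : A) sumw n' (fun w => F (a :: w)) else F [::].

Lemma sumw_cat n m F :
  sumw (n + m) F = sumw n (fun u => sumw m (fun v => F (u ++ v))).
Proof.
elim: n F => //= n IH F; apply: eq_bigr => a _; exact: IH.
Qed.

Lemma eq_sumw n F G : (forall w, size w = n -> F w = G w) ->
  sumw n F = sumw n G.
Proof.
elim: n F G => [|n IH] F G h /=; first exact: h.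
by apply: eq_bigr => a _; apply: IH => w sw; apply: h; rewrite /= sw.
Qed.

Lemma ler_sumw n F G : (forall w, size w = n -> F w <= G w) ->
  sumw n F <= sumw n G.
Proof.
elim: n F G => [|n IH] F G h /=; first exact: h.
by apply: ler_sum => a _; apply: IH => w sw; apply: h; rewrite /= sw.
Qed.

Lemma sumw_ge0 n F : (forall w, size w = n -> 0 <= F w) -> 0 <= sumw n F.
Proof.
elim: n F => [|n IH] F h /=; first exact: h.
by apply: sumr_ge0 => a _; apply: IH => w sw; apply: h; rewrite /= sw.
Qed.

Lemma sumwMl n a F : a * sumw n F = sumw n (fun w => a * F w).
Proof.
elim: n F => //= n IH F; rewrite mulr_sumr; apply: eq_bigr => b _; exact: IH.
Qed.

Lemma sumwMr n a F : sumw n F * a = sumw n (fun w => F w * a).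
Proof. by rewrite mulrC sumwMl; apply: eq_sumw => w _; rewrite mulrC. Qed.

Lemma sumwD n F G : sumw n F + sumw n G = sumw n (fun w => F w + G w).
Proof.
elim: n F G => //= n IH F G; rewrite -big_split; apply: eq_bigr => b _; exact: IH.
Qed.

Lemma sumw_sum n (I : Type) (r : seq I) (P : pred I) (F : I -> seq A -> R) :
  \sum_(i <- r | P i) sumw n (F i) = sumw n (fun w => \sum_(i <- r | P i) F i w).
Proof.
elim: n F => //= n IH F; rewrite exchange_big /=.
by apply: eq_bigr => a _; rewrite IH.
Qed.

Lemma exchange_sumw n m (F : seq A -> seq A -> R) :
  sumw n (fun u => sumw m (F u)) = sumw m (fun v => sumw n (F^~ v)).
Proof.
elim: n F => //= n IH F; rewrite -sumw_sum; apply: eq_bigr => a _; exact: IH.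
Qed.

Lemma sumw_mul n m F G :
  sumw n F * sumw m G = sumw n (fun u => sumw m (fun v => F u * G v)).
Proof. by rewrite sumwMr; apply: eq_sumw => u _; rewrite sumwMl. Qed.

Lemma sumw_ge_term n F w : size w = n ->
  (forall v, size v = n -> 0 <= F v) -> F w <= sumw n F.
Proof.
elim: n F w => [|n IH] F [|a w] //= [sw] h.
have := IH (fun w => F (a :: w)) w sw (fun v sv => h (a :: v) (congr1 S sv)).
move=> /le_trans; apply; rewrite (bigD1 a) //= lerDl.
apply: sumr_ge0 => b _; apply: sumw_ge0 => v sv; apply: h; by rewrite /= sv.
Qed.

Lemma sumw0 n F : (forall w, size w = n -> F w = 0) -> sumw n F = 0.
Proof.
elim: n F => [|n IH] F h /=; first exact: h.
by rewrite big1 // => a _; apply: IH => w sw; apply: h; rewrite /= sw.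
Qed.

Lemma sumw_pick n F w0 : size w0 = n ->
  sumw n (fun w => (w == w0)%:R * F w) = F w0.
Proof.
elim: n F w0 => [|n IH] F [|a w0] //= => [_|[sw]]; first by rewrite mul1r.
rewrite (bigD1 a) //= [X in _ + X]big1 ?addr0 => [|b ba].
  by rewrite -(IH (fun w => F (a :: w)) w0 sw); apply: eq_sumw => w _; rewrite eqseq_cons eqxx.
by apply: sumw0 => w _; rewrite eqseq_cons (negbTE ba) mul0r.
Qed.

Lemma sumw_tuple n F : sumw n F = \sum_(t : n.-tuple A) F t.
Proof.
elim: n F => [|n IH] F /=.
  by rewrite (big_pred1 [tuple]) // => t; rewrite [t]tuple0; apply/esym/eqP.
under eq_bigr do rewrite IH.
rewrite pair_big /= (reindex (fun p : A * n.-tuple A => [tuple of p.1 :: p.2])) //=.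
exists (fun t : n.+1.-tuple A => (thead t, [tuple of behead t])) => [[a t] _|t _] /=.
  by congr (_, _); apply: val_inj.
by rewrite [RHS]tuple_eta.
Qed.

End word_sums.

(** * Words of configurations and Birkhoff sums *)

Section configurations.
Variable N : nat.
Notation A := 'I_N.+1.
Implicit Types (x y : config N) (w u v : seq A) (i j : int) (n m k : nat).

Definition wordc i n x : seq A := [seq (x (i + k%:Z) : A) | k <- iota 0 n].

Definition emb w : config N :=
  fun i => if i is Posz n then nth ord0 w n else ord0.

Lemma size_wordc i n x : size (wordc i n x) = n.
Proof. by rewrite size_map size_iota. Qed.

Lemma nth_wordc i n x k : (k < n)%N -> nth ord0 (wordc i n x) k = x (i + k%:Z).
Proof. by move=> kn; rewrite (nth_map 0%N) ?size_iota // nth_iota. Qed.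

Lemma eq_wordc i n x y : (forall k, (k < n)%N -> x (i + k%:Z) = y (i + k%:Z)) <->
  wordc i n x = wordc i n y.
Proof.
split=> [h|h k kn]; last by rewrite -!(@nth_wordc _ n) // h.
by apply/eq_in_map => k; rewrite mem_iota => /andP[_ kn]; exact: h.
Qed.

Lemma wordc_cat i n m x :
  wordc i (n + m) x = wordc i n x ++ wordc (i + n%:Z) m x.
Proof.
rewrite /wordc iotaD map_cat; congr (_ ++ _).
rewrite add0n -[n in iota n m]addn0 iotaDl -map_comp; apply: eq_map => k /=.
by rewrite PoszD addrA.
Qed.

Lemma wordc_tshift i j n x : wordc i n (tshift j x) = wordc (i + j) n x.
Proof. by apply: eq_map => k; rewrite /tshift; congr x; ring. Qed.

Lemma wordc_emb w : wordc 0 (size w) (emb w) = w.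
Proof.
apply: (@eq_from_nth _ ord0); rewrite size_wordc // => k kn.
by rewrite nth_wordc // add0r.
Qed.

Lemma emb_cat_mid u w v k : (k < size w)%N ->
  emb (u ++ w ++ v) ((size u)%:Z + k%:Z) = nth ord0 w k.
Proof.
move=> kw; rewrite -PoszD /= nth_cat ltnNge leq_addr /= addKn nth_cat kw //.
Qed.

End configurations.

Definition birk (R : realType) N (phi : config N -> R) n x : R :=
  \sum_(j < n) phi (tshift j%:Z x).

Definition Sw (R : realType) N (phi : config N -> R) (w : seq 'I_N.+1) : R :=
  birk phi (size w) (emb w).

(** The data extracted from an extension of finite total oscillation: [d i]
    dominates the oscillation at coordinate [i]; [d_tail] is the summability of
    [d], and [phi_loc] is the continuity of [phi] read on windows. *)
Record bounded_osc (R : realType) N (phi : config N -> R) (d : int -> R) (D : R)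
    : Prop := BoundedOsc {
  d_ge0 : forall i, 0 <= d i;
  phi_osc : forall (i : int) (x y : config N),
    (forall k : int, k != i -> x k = y k) -> `|phi x - phi y| <= d i;
  d_sum : forall s : seq int, uniq s -> \sum_(i <- s) d i <= D;
  d_tail : forall eps : R, 0 < eps -> exists M : nat,
    forall s : seq int, uniq s -> (forall i, i \in s -> (M < `|i|)%N) ->
    \sum_(i <- s) d i <= eps;
  phi_loc : forall (x : config N) (eps : R), 0 < eps -> exists M : nat,
    forall y : config N, (forall i : int, (`|i| <= M)%N -> x i = y i) ->
    `|phi x - phi y| <= eps }.

Section energy.
Variables (R : realType) (N : nat).
Notation A := 'I_N.+1.
Variables (phi : config N -> R) (d : int -> R) (D : R).
Hypothesis H : bounded_osc phi d D.
Implicit Types (x y : config N) (w u v a b : seq A) (i j : int) (n m k : nat).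
Notation birk := (birk phi).
Notation Sw := (Sw phi).

Lemma D_ge0 : 0 <= D.
Proof. by have := d_sum H (isT : uniq [::]); rewrite big_nil. Qed.

Lemma phi_finite (s : seq int) x y : (forall k : int, k \notin s -> x k = y k) ->
  `|phi x - phi y| <= \sum_(i <- s) d i.
Proof.
elim: s x y => [|i s IH] x y h.
  rewrite big_nil (_ : x = y) ?subrr ?normr0 //.
  by apply/funext => k; exact: h.
rewrite big_cons.
pose z : config N := fun k : int => if k == i then y k else x k.
rewrite (le_trans (ler_distD (phi z) _ _)) // lerD //.
  by apply: (phi_osc H) => k ki; rewrite /z (negbTE ki).
apply: IH => k ks; rewrite /z; case: eqVneq => // ki; apply: h.
by rewrite inE negb_or ki.
Qed.

Definition box M : seq int := [seq (k%:Z - M%:Z) | k <- iota 0 (2 * M + 1)].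

Lemma box_uniq M : uniq (box M).
Proof. by rewrite map_inj_uniq ?iota_uniq // => a b /addIr [->]. Qed.

Lemma mem_box M (i : int) : (i \in box M) = (`|i| <= M)%N.
Proof.
apply/mapP/idP => [[k]|h]; first by rewrite mem_iota => /andP[_ h] ->; lia.
exists (absz (i + M%:Z)); first by rewrite mem_iota; lia.
lia.
Qed.

(** Changing the coordinates one at a time only treats finitely many of them.
    For two arbitrary configurations one changes those of a large window, and
    continuity takes care of the others. *)
Lemma phi_dist_le (e : R) x y :
  (forall s : seq int, uniq s -> (forall i, i \in s -> x i <> y i) ->
    \sum_(i <- s) d i <= e) ->
  `|phi x - phi y| <= e.
Proof.
move=> h; apply/ler_addgt0Pr => eps eps0.
have [M hM] := phi_loc H y eps0.
pose z : config N := fun k : int => if (`|k| <= M)%N then y k else x k.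
rewrite (le_trans (ler_distD (phi z) _ _)) // lerD //; last first.
  by rewrite distrC; apply: hM => i hi; rewrite /z hi.
pose s := [seq i <- box M | x i != y i].
apply: (@le_trans _ _ (\sum_(i <- s) d i)).
  apply: phi_finite => k; rewrite mem_filter mem_box /z negb_and negbK.
  by case: ifP => // _; rewrite orbF => /eqP.
apply: h; first by rewrite filter_uniq // box_uniq.
by move=> i; rewrite mem_filter => /andP[/eqP].
Qed.

Lemma phi_bound x y : `|phi x - phi y| <= D.
Proof. by apply: phi_dist_le => s us _; exact: (d_sum H). Qed.

Lemma phi_tail (eps : R) : 0 < eps -> exists M : nat, forall x y,
  (forall i : int, (`|i| <= M)%N -> x i = y i) -> `|phi x - phi y| <= eps.
Proof.
move=> /(d_tail H)[M hM]; exists M => x y xy; apply: phi_dist_le => s us hs.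
apply: hM => // i /hs; rewrite ltnNge => hi; apply/negP => /xy; exact: hi.
Qed.

Lemma sum_ltn_le n M : (\sum_(0 <= k < n) (k < M : nat) <= M)%N.
Proof.
elim: n => [|n IH]; first by rewrite big_geq.
rewrite big_nat_recr //=; case: (ltnP n M) => hnM; last by rewrite addn0.
rewrite addn1 (leq_ltn_trans _ hnM) //.
apply: (@leq_trans (\sum_(0 <= k < n) 1)%N).
  by apply: leq_sum => i _; case: (_ < _)%N.
by rewrite sum_nat_const_nat subn0 muln1.
Qed.

(** The source of all the errors C + n e: on a window of [n] sites only the
    sites near the two ends, whose number is bounded, feel the outside by more
    than [e]. *)
Lemma sum_boundary n M (e : R) (F : nat -> R) : 0 <= e ->
  (forall k, (k < n)%N -> F k <= D) ->
  (forall k, (M <= k)%N -> (k + M < n)%N -> F k <= e) ->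
  \sum_(k < n) F k <= (2 * M)%:R * D + n%:R * e.
Proof.
move=> e0 h1 h2.
pose b k := ((k < M) || (n <= k + M))%N.
apply: (@le_trans _ _ (\sum_(k < n) ((b k)%:R * D + e))).
  apply: ler_sum => k _; rewrite /b; case: ltnP => hk /=.
    by rewrite mul1r (le_trans (h1 k _)) // lerDl.
  case: leqP => hk2 /=; last by rewrite mul0r add0r; exact: h2.
  by rewrite mul1r (le_trans (h1 k _)) // lerDl.
rewrite big_split /= sumr_const card_ord -[e *+ n]mulr_natl lerD2r.
rewrite -mulr_suml ler_wpM2r ?D_ge0 // -natr_sum ler_nat.
rewrite (eq_bigr (fun k : 'I_n => (b k : nat))) //.
rewrite -(big_mkord xpredT (fun k => (b k : nat))).
apply: (@leq_trans (\sum_(0 <= k < n) ((k < M)%N + (n <= k + M)%N)%N)).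
  by apply: leq_sum => k _; rewrite /b; case: (k < M)%N; case: (n <= k + M)%N.
rewrite big_split /= mul2n -addnn leq_add ?sum_ltn_le //.
rewrite big_nat_rev /= add0n (leq_trans _ (sum_ltn_le n M)) //.
rewrite [leqLHS]big_nat_cond [leqRHS]big_nat_cond; apply: leq_sum => k.
rewrite andbT => /andP[_ hk]; by case: (ltnP k M); case: (leqP n) => //=; lia.
Qed.

Lemma birk_cat n m x : birk (n + m) x = birk n x + birk m (tshift n%:Z x).
Proof.
rewrite /birk big_split_ord /=; congr (_ + _); apply: eq_bigr => k _.
congr phi; apply/funext => i; rewrite /tshift; congr x; rewrite PoszD; ring.
Qed.

(** The energy of a word does not depend, up to such an error, on the
    configuration in which it is read. *)
Lemma birk_local (e : R) : 0 < e -> exists2 C : R, 0 <= C & forall n x y,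
  wordc 0 n x = wordc 0 n y -> birk n x - birk n y <= C + n%:R * e.
Proof.
move=> e0; have [M hM] := phi_tail e0.
exists ((2 * M)%:R * D); first by rewrite mulr_ge0 // D_ge0.
move=> n x y /eq_wordc h; rewrite /birk -sumrB.
apply: (@sum_boundary n M e (fun k => phi (tshift k%:Z x) - phi (tshift k%:Z y))).
- exact: ltW.
- by move=> k _; rewrite (le_trans (ler_norm _)) // phi_bound.
- move=> k Mk kMn; rewrite (le_trans (ler_norm _)) // hM // => i hi.
  rewrite /tshift; have := h (absz (i + k%:Z)).
  rewrite (_ : 0 + _ = i + k%:Z); last by lia.
  by apply; lia.
Qed.

(** Coordinate [i] is seen from site [t] at distance [i - t]; exchanging the two
    sums leaves, for each coordinate, a sum of translates of [d], which the
    total oscillation bounds. *)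
Lemma sum_times_le (ts : seq nat) (s : seq int) x y :
  (forall k : int, k \notin s -> x k = y k) ->
  \sum_(t <- ts) (phi (tshift t%:Z x) - phi (tshift t%:Z y)) <=
  \sum_(i <- s) \sum_(t <- ts) d (i - t%:Z).
Proof.
move=> h; rewrite exchange_big /=; apply: ler_sum => t _.
rewrite (le_trans (ler_norm _)) //.
rewrite -(big_map (fun i => i - t%:Z) xpredT d); apply: phi_finite => k ks.
apply: h; apply: contra ks => ks; apply/mapP; exists (k + t%:Z) => //; ring.
Qed.

Lemma sum_translates_le (ts : seq nat) (i : int) : uniq ts ->
  \sum_(t <- ts) d (i - t%:Z) <= D.
Proof.
move=> us; rewrite -(big_map (fun t : nat => i - t%:Z) xpredT d); apply: (d_sum H).
by rewrite map_inj_uniq // => t t' /addrI /oppr_inj [].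
Qed.

(** The price of changing finitely many letters is proportional to their number,
    with no dependence on the length of the orbit segment. *)
Lemma birk_diff_le (s : seq int) n x y : uniq s ->
  (forall k : int, k \notin s -> x k = y k) ->
  birk n x - birk n y <= (size s)%:R * D.
Proof.
move=> us h; rewrite /birk -sumrB.
rewrite -(big_mkord xpredT (fun t => phi (tshift t%:Z x) - phi (tshift t%:Z y))).
apply: (le_trans (sum_times_le _ h)).
rewrite mulr_natl; elim: s {us h} => [|i s IH]; first by rewrite big_nil.
rewrite big_cons mulrS lerD //.
by apply: sum_translates_le; exact: iota_uniq.
Qed.

Lemma Sw_cat (e : R) : 0 < e -> exists2 C : R, 0 <= C & forall u v,
  `|Sw (u ++ v) - (Sw u + Sw v)| <= C + (size u + size v)%:R * e.
Proof.
move=> e0; have [C C0 hC] := birk_local e0.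
exists (C + C); first exact: addr_ge0.
move=> u v; rewrite /Sw size_cat birk_cat natrD.
have e1 : wordc 0 (size u) (emb (u ++ v)) = wordc 0 (size u) (emb u).
  by apply/eq_wordc => k ku; rewrite add0r /= nth_cat ku.
have e2 : wordc 0 (size v) (tshift (size u)%:Z (emb (u ++ v))) =
          wordc 0 (size v) (emb v).
  apply/eq_wordc => k kv; rewrite add0r /tshift -PoszD /= nth_cat.
  by rewrite ltnNge leq_addl /= addnK.
have := hC _ _ _ e1; have := hC _ _ _ (esym e1).
have := hC _ _ _ e2; have := hC _ _ _ (esym e2).
by rewrite ler_norml; lra.
Qed.

(** Sites inside the block are handled by [birk_local]. Those outside feel the
    block through the tails of [d], and summing over all of them, however
    numerous, gives at most [D] for a letter near the ends of the block and
    little for the others: this is where bounded total oscillations are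
    stronger than continuity. *)
Lemma Sw_swap (e : R) : 0 < e -> exists2 C : R, 0 <= C & forall u v a b,
  size a = size b ->
  Sw (u ++ a ++ v) + Sw b <= Sw (u ++ b ++ v) + Sw a + (C + (size a)%:R * e).
Proof.
move=> e0; have e3 : 0 < e / 3 by rewrite divr_gt0.
have [C C0 hC] := birk_local e3.
have [M hM] := d_tail H e3.
exists ((2 * M)%:R * D + (C + C)).
  by rewrite !addr_ge0 // mulr_ge0 // D_ge0.
move=> u v a b; move sa : (size a) => m /esym sb.
rewrite /Sw !size_cat sa sb !birk_cat.
set X := emb (u ++ a ++ v); set Y := emb (u ++ b ++ v).
have mid w : wordc 0 (size w) (tshift (size u)%:Z (emb (u ++ w ++ v))) =
             wordc 0 (size w) (emb w).
  apply/eq_wordc => k kw; rewrite add0r /tshift addrC emb_cat_mid //.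
have h1 := hC _ _ _ (mid a); have h2 := hC _ _ _ (esym (mid b)).
rewrite sa -/X in h1; rewrite sb -/Y in h2.
pose ts := iota 0 (size u) ++ iota (size u + m) (size v).
have uts : uniq ts.
  rewrite cat_uniq !iota_uniq andbT /=; apply/hasPn => t; rewrite !mem_iota; lia.
pose s : seq int := [seq (size u + p)%N%:Z | p <- iota 0 m].
have hs (k : int) : k \notin s -> X k = Y k.
  case: k => // k ks; rewrite /X /Y /= !nth_cat sa sb.
  case: ltnP => // uk; case: ltnP => // ukm; case/negP: ks.
  by apply/mapP; exists (k - size u)%N; rewrite ?mem_iota; [lia | congr Posz; lia].
have ht Z : \sum_(t <- ts) phi (tshift t%:Z Z) =
    birk (size u) Z + birk (size v) (tshift m%:Z (tshift (size u)%:Z Z)).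
  rewrite big_cat /=; congr (_ + _).
    by rewrite /birk -(big_mkord xpredT (fun t => phi (tshift t%:Z Z))) /index_iota subn0.
  rewrite -[(size u + m)%N in LHS]addn0 iotaDl big_map.
  rewrite /birk -(big_mkord xpredT (fun t => phi (tshift t%:Z (tshift m%:Z (tshift (size u)%:Z Z))))) /index_iota subn0.
  apply: eq_bigr => t _; congr phi; apply/funext => i.
  by rewrite /tshift; congr Z; rewrite !PoszD; ring.
have key : \sum_(t <- ts) (phi (tshift t%:Z X) - phi (tshift t%:Z Y)) <=
    (2 * M)%:R * D + m%:R * (e / 3).
  apply: (le_trans (sum_times_le _ hs)).
  (* the letters of the block are the summation index of [sum_boundary] *)
  rewrite big_map (_ : iota 0 m = index_iota 0 m); last by rewrite /index_iota subn0.
  rewrite big_mkord.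
  apply: (@sum_boundary m M (e / 3) (fun p => \sum_(t <- ts) d ((size u + p)%N%:Z - t%:Z))).
  - exact: ltW.
  - by move=> p _; exact: sum_translates_le.
  - move=> p hp1 hp2.
    rewrite -(big_map (fun t : nat => (size u + p)%N%:Z - t%:Z) xpredT d); apply: hM.
      by rewrite map_inj_uniq // => t t' /addrI /oppr_inj [].
    move=> i /mapP[t]; rewrite mem_cat !mem_iota => ht' ->; lia.
rewrite sumrB !ht in key.
rewrite (_ : m%:R * e = 3 * (m%:R * (e / 3))); last by field.
lra.
Qed.

End energy.

(** * Subadditivity and pressure *)

(** Fekete's lemma. The limit is the infimum of [u n / n]; once [u m / m] is
    close to it, division of [n] by [m] bounds [u n]. *)
Lemma fekete (R : realType) (u : nat -> R) (K : R) :
  (forall n m, u (n + m)%N <= u n + u m) -> (forall n, - (n%:R * K) <= u n) ->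
  exists p : R, (forall n, n%:R * p <= u n) /\
    forall e : R, 0 < e -> exists2 C : R, 0 <= C &
      forall n, u n <= n%:R * p + (C + n%:R * e).
Proof.
move=> usub ulow; pose V := [set u n.+1 / n.+1%:R | n in [set: nat]].
have V0 : V !=set0 by exists (u 1%N / 1%:R), 0%N.
have Vlb : lbound V (- K).
  by move=> _ [n _ <-]; rewrite ler_pdivlMr ?ltr0n // mulNr mulrC.
have hV : has_inf V by split => //; exists (- K).
exists (inf V); split=> [[|n]|e e0].
- by rewrite mul0r; have := ulow 0%N; rewrite mul0r oppr0.
- by rewrite mulrC -ler_pdivlMr ?ltr0n //; apply: ge_inf; [exists (- K)|exists n].
have [_ [m _ <-]] := inf_adherent e0 hV; set p := inf V; set M := m.+1 => um.
pose B := \sum_(r < M) `|u r|; pose C := B + M%:R * `|p + e|.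
exists C; first by rewrite addr_ge0 ?mulr_ge0 // sumr_ge0.
move=> n; rewrite [in leLHS](divn_eq n M).
have hq q r : u (q * M + r)%N <= q%:R * u M + u r.
  elim: q => [|q IH]; first by rewrite mul0n add0n mul0r add0r.
  rewrite mulSn -addnA (le_trans (usub _ _)) // -natr1; lra.
apply: (le_trans (hq _ _)).
set q := (n %/ M)%N; set r := (n %% M)%N.
have rM : (r < M)%N by rewrite ltn_mod.
have ur : u r <= B.
  rewrite /B (bigD1 (Ordinal rM)) //= (le_trans (ler_norm _)) // lerDl.
  by apply: sumr_ge0.
have hM : u M <= M%:R * (p + e).
  by rewrite mulrC -ler_pdivrMr ?ltr0n // ltW.
have nE : n%:R = q%:R * M%:R + r%:R :> R by rewrite -natrM -natrD -divn_eq.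
have h1 : q%:R * u M <= q%:R * (M%:R * (p + e)) by rewrite ler_wpM2l.
have h2 : - (r%:R * (p + e)) <= M%:R * `|p + e|.
  rewrite -mulrN; apply: (@le_trans _ _ (r%:R * `|p + e|)).
    by rewrite ler_wpM2l // lerNl lerNnormlW.
  by rewrite ler_wpM2r // ler_nat ltnW.
rewrite /C nE; lra.
Qed.

(** Polynomial factors are absorbed in the exponential errors. *)
Lemma expR_ge_natr (R : realType) (e : R) n : 0 < e ->
  n.+1%:R <= (1 + e^-1) * expR (n%:R * e).
Proof.
move=> e0; apply: (@le_trans _ _ ((1 + e^-1) * (1 + n%:R * e))); last first.
  rewrite ler_pM2l ?expR_ge1Dx // addr_gt0 // invr_gt0 //.
have : e^-1 * (n%:R * e) = n%:R by rewrite mulrC mulfK // gt_eqF.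
rewrite -natr1 mulrDl mul1r mulrDr mulr1 => ->.
have : 0 <= n%:R * e by rewrite mulr_ge0 // ltW.
have : 0 <= e^-1 by rewrite invr_ge0 ltW.
lra.
Qed.

(** What is used of the digits of the expansion of one, apart from the
    lexicographic property of its tails. *)
Record expansion N (c : nat -> nat) : Prop := Expansion {
  c0_gt0 : (0 < c 0)%N;
  c_leN : forall i, (c i <= N)%N;
  c_nz : forall i, exists j, (0 < c (i + j))%N }.

Section pressure.
Variables (R : realType) (N : nat).
Notation A := 'I_N.+1.
Variables (c : nat -> nat) (phi : config N -> R) (d : int -> R) (D : R).
Hypothesis Hc : expansion N c.
Hypothesis H : bounded_osc phi d D.
Implicit Types (x : config N) (w u v y f : seq A) (a b : A) (n m k : nat).
Notation birk := (birk phi).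
Notation Sw := (Sw phi).
Notation zeros n := (nseq n (ord0 : A)).
Notation good := (good c).
Notation free := (free c).

Definition Zw n : R := sumw n (fun w => (good w)%:R * expR (Sw w)).

(** The supremum of the energy over all the configurations that read [w], unlike
    [Sw w], is exactly subadditive under concatenation. *)
Definition Shat w : R :=
  sup [set birk (size w) x | x in [set x | wordc 0 (size w) x = w]].

Lemma Shat_has_sup w :
  has_sup [set birk (size w) x | x in [set x | wordc 0 (size w) x = w]].
Proof.
split; first by exists (Sw w), (emb w) => //=; rewrite wordc_emb.
exists (\sum_(j < size w) (phi (emb [::]) + D)) => _ [x _ <-].
by apply: ler_sum => j _; rewrite -lerBlDl (le_trans (ler_norm _)) // (phi_bound H).
Qed.

Lemma birk_le_Shat n x : birk n x <= Shat (wordc 0 n x).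
Proof.
apply: ub_le_sup; first by case: (Shat_has_sup (wordc 0 n x)).
by exists x; rewrite /= size_wordc.
Qed.

Lemma Shat_le w (B : R) : (forall x, wordc 0 (size w) x = w -> birk (size w) x <= B) ->
  Shat w <= B.
Proof.
move=> h; apply: ge_sup; first by case: (Shat_has_sup w).
by move=> _ [x hx <-]; exact: h.
Qed.

Lemma Shat_cat u v : Shat (u ++ v) <= Shat u + Shat v.
Proof.
apply: Shat_le => x; rewrite size_cat wordc_cat => /eqP.
rewrite eqseq_cat ?size_wordc // => /andP[/eqP h1 /eqP h2].
rewrite birk_cat lerD //; first by rewrite -[in leRHS]h1 birk_le_Shat.
by rewrite -[in leRHS]h2 -[0 + _]/(0 + (size u)%:Z) -wordc_tshift birk_le_Shat.
Qed.

Lemma Sw_le_Shat w : Sw w <= Shat w.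
Proof. by have := birk_le_Shat (size w) (emb w); rewrite wordc_emb. Qed.

Lemma Shat_le_Sw (e : R) : 0 < e -> exists2 C : R, 0 <= C & forall w,
  Shat w <= Sw w + (C + (size w)%:R * e).
Proof.
move=> /(birk_local H)[C C0 hC]; exists C => // w; apply: Shat_le => x hx.
by rewrite -lerBlDl; apply: hC; rewrite hx wordc_emb.
Qed.

Lemma emb_zeros n (i : int) : emb (zeros n) i = ord0.
Proof. by case: i => //= k; rewrite nth_nseq if_same. Qed.

Lemma Sw_zeros n : Sw (zeros n) = n%:R * phi (emb [::]).
Proof.
rewrite /Sw size_nseq /birk mulr_natl -[n in RHS]card_ord -sumr_const; apply: eq_bigr => j _.
by congr phi; apply/funext => i; rewrite /tshift emb_zeros (emb_zeros 0).
Qed.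

Lemma Zw_ge w n : size w = n -> good w -> expR (Sw w) <= Zw n.
Proof.
move=> sw gw; have := @sumw_ge_term R N n (fun w => (good w)%:R * expR (Sw w)) w sw.
by rewrite gw mul1r; apply => v _; rewrite mulr_ge0 ?expR_ge0.
Qed.

Lemma Zw_gt0 n : 0 < Zw n.
Proof.
apply: (lt_le_trans (expR_gt0 _)); apply: (@Zw_ge (zeros n)).
  exact: size_nseq.
by apply: good_zeros; exact: (c0_gt0 Hc).
Qed.

Lemma Zw_growth : exists p : R, forall e : R, 0 < e ->
  exists2 C : R, 0 <= C & forall n, `|ln (Zw n) - n%:R * p| <= C + n%:R * e.
Proof.
pose Zh n : R := sumw n (fun w => (good w)%:R * expR (Shat w)).
have ZZh n : Zw n <= Zh n.
  apply: ler_sumw => w _; rewrite ler_wpM2l // ler_expR; exact: Sw_le_Shat.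
have Zh0 n : 0 < Zh n by exact: (lt_le_trans (Zw_gt0 n)).
have [||p [p1 p2]] := @fekete R (fun n => ln (Zh n)) `|phi (emb [::])|.
- move=> n m; rewrite -lnM ?posrE // ler_ln ?posrE ?mulr_gt0 //.
  rewrite /Zh sumw_cat sumw_mul; apply: ler_sumw => u su; apply: ler_sumw => v sv.
  rewrite mulrACA -natrM mulnb -expRD.
  case: (boolP (good (u ++ v))) => [/good_cat[-> ->]|_] /=.
    by rewrite !mul1r ler_expR; exact: Shat_cat.
  by rewrite mul0r mulr_ge0 // expR_ge0.
- move=> n; apply: (@le_trans _ _ (ln (Zw n))); last by rewrite ler_ln ?posrE ?Zw_gt0.
  rewrite -[leLHS]expRK ler_ln ?posrE ?expR_gt0 ?Zw_gt0 //.
  apply: (le_trans _ (@Zw_ge (zeros n) n _ _)); first last.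
  + by apply: good_zeros; exact: (c0_gt0 Hc).
  + exact: size_nseq.
  rewrite ler_expR Sw_zeros -mulrN ler_wpM2l //.
  by rewrite lerNl -normrN ler_norm.
exists p => e e0; have [C1 C10 h1] := p2 _ e0; have [C2 C20 h2] := Shat_le_Sw e0.
exists (C1 + C2); first exact: addr_ge0.
move=> n; have hZ : ln (Zh n) <= ln (Zw n) + (C2 + n%:R * e).
  rewrite -[X in _ + X]expRK -lnM ?posrE ?expR_gt0 ?Zw_gt0 //.
  rewrite ler_ln ?posrE ?mulr_gt0 ?expR_gt0 ?Zw_gt0 //.
  rewrite /Zh /Zw sumwMr; apply: ler_sumw => w sw; rewrite -mulrA -expRD.
  by rewrite ler_wpM2l // ler_expR; have := h2 w; rewrite sw.
have hZ' : ln (Zw n) <= ln (Zh n) by rewrite ler_ln ?posrE ?Zw_gt0.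
have := p1 n; have := h1 n; rewrite ler_norml; lra.
Qed.

(** * The energy of every word stays strictly below the pressure *)

(** Lowering letters preserves admissibility, so every subset of the nonzero
    letters may be set to zero, each at the price [exp (- D)]; the factor is the
    sum of these prices over the subsets. *)
Lemma sum_zeroing_ge y w : good (y ++ w) ->
  expR (Sw (y ++ w)) * (1 + expR (- D)) ^+ nonzeros w <=
  sumw (size w) (fun v => (good (y ++ v))%:R * expR (Sw (y ++ v))).
Proof.
have e1 : 0 <= 1 + expR (- D) by rewrite addr_ge0 ?expR_ge0.
elim: w y => [|a w IH] y gw /=; first by rewrite expr0 mulr1 gw mul1r.
have hs b : sumw (size w) (fun v => (good (y ++ b :: v))%:R * expR (Sw (y ++ b :: v)))
  = sumw (size w) (fun v => (good (rcons y b ++ v))%:R * expR (Sw (rcons y b ++ v))).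
  by apply: eq_sumw => v _; rewrite cat_rcons.
have pos b : 0 <= sumw (size w)
    (fun v => (good (y ++ b :: v))%:R * expR (Sw (y ++ b :: v))).
  by apply: sumw_ge0 => v _; rewrite mulr_ge0 ?expR_ge0.
rewrite (bigD1 a) //=; case: eqVneq => [a0|a0] /=.
  rewrite add0n (@le_trans _ _ (sumw (size w) (fun v =>
    (good (y ++ a :: v))%:R * expR (Sw (y ++ a :: v))))) ?lerDl ?sumr_ge0 //.
  by rewrite hs -cat_rcons; apply: IH; rewrite cat_rcons.
rewrite (bigD1 ord0) 1?eq_sym //= addrA.
rewrite (@le_trans _ _ (sumw (size w) (fun v =>
    (good (y ++ a :: v))%:R * expR (Sw (y ++ a :: v))) + sumw (size w) (fun v =>
    (good (y ++ ord0 :: v))%:R * expR (Sw (y ++ ord0 :: v))))) ?lerDl ?sumr_ge0 //.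
have g0 : good (rcons y ord0 ++ w).
  apply: below_good gw; rewrite cat_rcons; apply: below_cat; first exact: below_refl.
  by rewrite /= below_refl.
rewrite add1n exprS mulrA mulrDr mulr1 mulrDl; apply: lerD.
  by rewrite hs -cat_rcons; apply: IH; rewrite cat_rcons.
rewrite hs; apply: le_trans (IH _ g0); rewrite ler_wpM2r ?exprn_ge0 //.
rewrite -expRD ler_expR lerBlDl -lerBlDr.
rewrite cat_rcons /Sw !size_cat /=.
rewrite -[D]mul1r; apply: (@birk_diff_le _ _ _ _ _ H [:: (size y)%:Z]) => // k.
rewrite inE => ky; case: k ky => // k ky; rewrite /emb !nth_cat.
case: ltnP => // yk; case E : (k - size y)%N => [|k'] //=.
by case/eqP: ky; congr Posz; lia.
Qed.

Lemma wlt_zeros i j : (0 < c (i + j))%N -> wlt c (zeros j.+1) i.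
Proof.
elim: j i => [|j IH] i /=; first by rewrite addn0 => ->.
by case: (posnP (c i)) => // ->; rewrite -addSnnS => /IH /= ->.
Qed.

(** A single 1 followed by enough zeros is strictly below the expansion, which
    does not end with zeros. *)
Lemma exists_spacing : exists q, exists2 b : A, b != ord0 & free (b :: zeros q).
Proof.
have [j hj] := c_nz Hc 1.
have c0 := c0_gt0 Hc; have cN := c_leN Hc.
have N1 : (1 <= N)%N by apply: leq_trans c0 (cN 0%N).
exists j.+1, (inord 1).
  by apply/eqP => /(congr1 val) /=; rewrite inordK.
rewrite free_cons free_zeros // andbT /= inordK //.
case: (ltnP 1 (c 0%N)) => //= c1.
have -> : c 0%N = 1%N by apply/eqP; rewrite eqn_leq c1.
exact: (wlt_zeros hj).
Qed.

Lemma exp_ln1D : 1 + expR (- D) = expR (ln (1 + expR (- D))).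
Proof. by rewrite lnK // posrE addr_gt0 // expR_gt0. Qed.

(** In a run of zeros cut into cells of length [q + 1], the first letter of each
    cell may be replaced by [b] or not: since both cells are free, all these
    choices are compatible. *)
Lemma sum_inserting_ge q b n y : b != ord0 -> free (b :: zeros q) -> free y ->
  expR (Sw (y ++ zeros n)) * (1 + expR (- D)) ^+ (n %/ q.+1) <=
  sumw n (fun v => (good (y ++ v))%:R * expR (Sw (y ++ v))).
Proof.
move=> b0 hb; elim/ltn_ind: n y => n IH y hy.
have pos v : 0 <= (good (y ++ v))%:R * expR (Sw (y ++ v)) :> R.
  by rewrite mulr_ge0 ?expR_ge0.
have gz k : good (zeros k) by by apply: good_zeros; exact: (c0_gt0 Hc).
case: (ltnP n q.+1) => nq.
  rewrite divn_small // expr0 mulr1.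
  have := @sumw_ge_term R N n (fun v => (good (y ++ v))%:R * expR (Sw (y ++ v)))
    (zeros n) (size_nseq _ _) (fun v _ => pos v).
  by rewrite free_good_cat // mul1r.
have nE : n = (q.+1 + (n - q.+1))%N by rewrite subnKC.
move: IH pos gz; set m := (n - q.+1)%N in nE *; rewrite nE => IH pos gz {nq}.
have -> : ((q.+1 + m) %/ q.+1 = (m %/ q.+1).+1)%N.
  by rewrite -{1}[q.+1]mul1n divnMDl // add1n.
rewrite exprS sumw_cat.
have m_lt : (m < q.+1 + m)%N by rewrite addSn ltnS leq_addl.
have hs u : sumw m (fun v => (good (y ++ u ++ v))%:R * expR (Sw (y ++ u ++ v)))
  = sumw m (fun v => (good ((y ++ u) ++ v))%:R * expR (Sw ((y ++ u) ++ v))).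
  by apply: eq_sumw => v _; rewrite catA.
pose F u : R := sumw m (fun v => (good (y ++ u ++ v))%:R * expR (Sw (y ++ u ++ v))).
have F0 u : 0 <= F u by apply: sumw_ge0 => v _; exact: pos.
apply: (@le_trans _ _ (F (zeros q.+1) + F (b :: zeros q))); last first.
  have e0 := @sumw_pick R N q.+1 F (zeros q.+1) (size_nseq _ _).
  have eb := @sumw_pick R N q.+1 F (b :: zeros q) (congr1 S (size_nseq _ _)).
  rewrite -e0 -eb sumwD.
  apply: (@ler_sumw R N q.+1) => w _; rewrite -mulrDl -[leRHS]mul1r.
  rewrite ler_wpM2r // -natrD lern1; case: eqVneq => [->|_] /=; last by case: eqP.
  by rewrite eqseq_cons eq_sym (negbTE b0).
have h1 := IH m m_lt (y ++ zeros q.+1) (free_cat hy (free_zeros _ (c0_gt0 Hc) _)).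
have h2 := IH m m_lt (y ++ b :: zeros q) (free_cat hy hb).
rewrite /F !hs mulrA mulrDr mulr1 mulrDl; apply: lerD.
  by apply: le_trans h1; rewrite -catA -nseqD.
apply: le_trans h2; rewrite ler_wpM2r ?exprn_ge0 ?addr_ge0 ?expR_ge0 //.
rewrite -expRD ler_expR lerBlDl -lerBlDr.
have es : size (y ++ zeros (q.+1 + m)) = size ((y ++ b :: zeros q) ++ zeros m).
  by rewrite !size_cat /= !size_nseq; lia.
rewrite /Sw es.
rewrite -[D]mul1r; apply: (@birk_diff_le _ _ _ _ _ H [:: (size y)%:Z]) => // k.
rewrite inE => ky; case: k ky => // k ky; rewrite /emb -catA /= !nth_cat.
case: ltnP => // yk.
case E : (k - size y)%N => [|k'] /=.
  by case/eqP: ky; congr Posz; lia.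
by rewrite -nseqD.
Qed.

(** Let [k] count the nonzero letters of [w]. Zeroing subsets of them gains a
    factor exponential in [k]; wiping them all out costs at most [k D] and
    leaves room for linearly many insertions. Whatever [k] is, one of the two
    gains is linear in the length. *)
Lemma energy_gap : exists2 kappa : R, 0 < kappa & exists2 C : R, 0 <= C &
  forall w, good w -> Sw w <= ln (Zw (size w)) - (size w)%:R * kappa + C.
Proof.
have [q [b b0 hb]] := exists_spacing.
pose a : R := ln (1 + expR (- D)).
have a0 : 0 < a by rewrite ln_gt0 // ltrDl expR_gt0.
have D0 := D_ge0 H.
have aD : 0 < a + D by rewrite ltr_pwDl.
pose t : R := a ^+ 2 / (a + D).
have t0 : 0 < t by rewrite divr_gt0 // exprn_gt0.
exists (t / q.+1%:R); first by rewrite divr_gt0.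
exists t; first exact: ltW.
move=> w gw; set n := size w; set k := nonzeros w.
have L (x y : R) m : 0 < y -> x * (1 + expR (- D)) ^+ m <= y -> x = expR (ln x) ->
  ln x + m%:R * a <= ln y.
  move=> y0 h xE; rewrite -[leLHS]expRK ler_ln ?posrE ?expR_gt0 // expRD -xE.
  by rewrite (mulrC m%:R) expRM_natr -exp_ln1D.
have h1 : Sw w + k%:R * a <= ln (Zw n).
  have := @sum_zeroing_ge [::] w gw; rewrite /= => /L; rewrite expRK; apply => //.
  exact: Zw_gt0.
have h2 : Sw (zeros n) + (n %/ q.+1)%:R * a <= ln (Zw n).
  have := @sum_inserting_ge q b n [::] b0 hb isT; rewrite /= => /L; rewrite expRK; apply => //.
  exact: Zw_gt0.
have h3 : Sw w - Sw (zeros n) <= k%:R * D.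
  pose s := [seq i%:Z | i <- iota 0 n & nth ord0 w i != ord0].
  have := @birk_diff_le _ _ _ _ _ H s n (emb w) (emb (zeros n)).
  rewrite /Sw size_nseq /s size_map size_filter.
  rewrite (_ : count _ _ = k); last first.
    by rewrite /k /nonzeros -[in RHS](mkseq_nth ord0 w) count_map.
  apply; first by rewrite map_inj_uniq ?filter_uniq ?iota_uniq // => ? ? [].
  case=> // i ki; rewrite /emb nth_nseq if_same; apply/eqP; apply: contraNT ki => wi.
  apply/mapP; exists i => //; rewrite mem_filter wi mem_iota /= add0n.
  by rewrite ltnNge; apply: contra wi => ni; rewrite nth_default.
have nq : n%:R / q.+1%:R <= (n %/ q.+1)%:R + 1 :> R.
  by rewrite ler_pdivrMr // natr1 -natrM ler_nat ltnW // ltn_ceil.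
have k0 : 0 <= k%:R :> R by [].
have m0 : 0 <= (n %/ q.+1)%:R :> R by [].
move: h1 h2 h3 nq k0 m0; set S0 := Sw (zeros n); set z := ln (Zw n); set s := Sw w.
set kk := k%:R; set m := (n %/ q.+1)%:R => h1 h2 h3 nq k0 m0.
have tE : t * (a + D) = a ^+ 2 by rewrite /t divfK // gt_eqF.
(* the combination of [h1] and [h2] with weights [D] and [a] eliminates [k] *)
have h4 : (a + D) * s + a ^+ 2 * m <= (a + D) * z.
  have := ler_wpM2l D0 h1; have := ler_wpM2l (ltW a0) h2.
  have := ler_wpM2l (ltW a0) h3; lra.
have h5 : s + t * m <= z.
  by rewrite -(ler_pM2l aD); apply: le_trans h4; rewrite -tE; lra.
rewrite mulrCA; have := ler_wpM2l (ltW t0) nq.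
move: (n%:R / q.+1%:R) => r; lra.
Qed.

End pressure.

(** * Exchanging blocks *)

Section exchange.
Variables (R : realType) (N : nat).
Notation A := 'I_N.+1.
Variables (c : nat -> nat) (phi : config N -> R) (d : int -> R) (D : R).
Hypothesis Hc : expansion N c.
Hypothesis H : bounded_osc phi d D.
Implicit Types (x : config N) (w u v y f l r : seq A) (n m k j : nat).
Notation birk := (birk phi).
Notation Sw := (Sw phi).
Notation Zw := (Zw c phi).
Notation zeros n := (nseq n (ord0 : A)).
Notation good := (good c).
Notation free := (free c).
Notation sfree := (sfree c).
Notation cpre := (cword N c 0).

Definition Zfree n : R := sumw n (fun w => (free w)%:R * expR (Sw w)).

Lemma Sw_change_letter y (a b : A) v : Sw (y ++ a :: v) <= Sw (y ++ b :: v) + D.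
Proof.
rewrite -lerBlDl /Sw !size_cat /= -[leRHS]mul1r.
apply: (@birk_diff_le _ _ _ _ _ H [:: (size y)%:Z]) => // k.
rewrite inE => ky; case: k ky => // k ky; rewrite /emb !nth_cat.
case: ltnP => // yk; case E : (k - size y)%N => [|k'] //=.
by case/eqP: ky; congr Posz; lia.
Qed.

Lemma sum_pred_le (G : A -> R) : (forall a, 0 <= G a) ->
  \sum_(a : A) (a != ord0)%:R * G (inord a.-1) <= \sum_(a : A) G a.
Proof.
move=> G0; rewrite big_ord_recl eqxx mul0r add0r big_ord_recr /=.
rewrite -[leLHS]addr0; apply: lerD => //; apply: ler_sum => i _.
rewrite mul1r (_ : inord _ = widen_ord (leqnSn N) i) //.
by apply: ord_inj; rewrite inordK // ltnS ltnW ?ltn_ord.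
Qed.

(** Decreasing the last nonzero letter by one makes an admissible word free and
    costs at most [D]. The result does not tell which letter was decreased;
    there are at most [n] possibilities, hence the factor [n]. *)
Lemma sum_nonzero_le n y :
  sumw n (fun w => (good (y ++ w) && (w != zeros n))%:R * expR (Sw (y ++ w))) <=
  expR D * n%:R * sumw n (fun w => (free (y ++ w))%:R * expR (Sw (y ++ w))).
Proof.
elim: n y => [|n IH] y /=; first by rewrite andbF mul0r mulr0 mul0r.
pose B b : R := sumw n (fun w => (free (y ++ b :: w))%:R * expR (Sw (y ++ b :: w))).
have B0 b : 0 <= B b by apply: sumw_ge0 => w _; rewrite mulr_ge0 ?expR_ge0.
rewrite -/(\sum_a B a).
apply: (@le_trans _ _ (\sum_(a : A) (expR D * n%:R * B a +
   expR D * ((a != ord0)%:R * B (inord a.-1))))); last first.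
  rewrite big_split /= -!mulr_sumr -natr1 mulrDr mulr1 mulrDl lerD2l.
  by rewrite ler_wpM2l ?expR_ge0 // sum_pred_le.
apply: ler_sum => a _.
apply: (@le_trans _ _ (
  sumw n (fun w => (good (rcons y a ++ w) && (w != zeros n))%:R *
                   expR (Sw (rcons y a ++ w))) +
  sumw n (fun w => (w == zeros n)%:R * ((a != ord0)%:R * ((good (y ++ a :: w))%:R *
                   expR (Sw (y ++ a :: w))))))).
  rewrite sumwD; apply: ler_sumw => w _; rewrite cat_rcons eqseq_cons.
  case: (good _); rewrite /= ?mul0r ?mulr0 ?addr0 //.
  case: (a == _); case: (w == _); rewrite /= ?mul0r ?mul1r ?add0r ?addr0 ?mulr0 //.
apply: lerD.
  apply: le_trans (IH _) _; rewrite ler_wpM2l ?mulr_ge0 ?expR_ge0 //.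
  by apply: ler_sumw => w _; rewrite cat_rcons.
rewrite sumw_pick ?size_nseq //; case: eqVneq => [_|a0].
  by rewrite !mul0r mulr0.
rewrite !mul1r; case: (boolP (good _)) => [g|_]; last by rewrite mul0r mulr_ge0 ?expR_ge0.
rewrite mul1r; set a' : A := inord a.-1.
have a0' : (0 < a)%N by rewrite lt0n; apply: contra a0 => /eqP h; apply/eqP/val_inj.
have aa : (a' < a)%N.
  by rewrite inordK ?ltn_predL // (leq_ltn_trans (leq_pred a) (ltn_ord a)).
have hf := good_dec_free (c0_gt0 Hc) g aa.
have := @sumw_ge_term R N n (fun w => (free (y ++ a' :: w))%:R *
   expR (Sw (y ++ a' :: w))) (zeros n) (size_nseq _ _) _.
rewrite hf mul1r => h.
apply: (@le_trans _ _ (expR D * expR (Sw (y ++ a' :: zeros n)))).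
  by rewrite -expRD ler_expR addrC Sw_change_letter.
by rewrite ler_wpM2l ?expR_ge0 // h // => v _; rewrite mulr_ge0 ?expR_ge0.
Qed.

Lemma Zw_le_Zfree n : Zw n <= expR D * n.+1%:R * Zfree n.
Proof.
have hz : expR (Sw (zeros n)) <= Zfree n.
  have := @sumw_ge_term R N n (fun w => (free w)%:R * expR (Sw w)) (zeros n)
    (size_nseq _ _) _.
  rewrite free_zeros ?(c0_gt0 Hc) // mul1r; apply => v _.
  by rewrite mulr_ge0 ?expR_ge0.
have hD : 1 <= expR D by rewrite -expR0 ler_expR (D_ge0 H).
apply: (@le_trans _ _ (
  sumw n (fun w => (good w && (w != zeros n))%:R * expR (Sw w)) +
  sumw n (fun w => (w == zeros n)%:R * expR (Sw w)))).
  rewrite sumwD; apply: ler_sumw => w _; rewrite -mulrDl -natrD.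
  by rewrite ler_wpM2r ?expR_ge0 // ler_nat; case: (good _); case: eqP.
rewrite sumw_pick ?size_nseq // -natr1 mulrDr mulr1 mulrDl.
apply: lerD; first exact: (@sum_nonzero_le n [::]).
by rewrite (le_trans hz) // ler_peMl // (le_trans _ hz) // expR_ge0.
Qed.

Lemma Zfree_gt0 n : 0 < Zfree n.
Proof.
have := lt_le_trans (Zw_gt0 phi Hc n) (Zw_le_Zfree n).
by rewrite pmulr_rgt0 // mulr_gt0 ?expR_gt0 // ltr0n.
Qed.

(** Each admissible word is split at its longest suffix [cpre n] that is a
    prefix of the expansion: by maximality, the longer suffixes are strictly
    below the expansion. *)
Lemma sum_past_split j (F : seq A -> R) : (forall l, 0 <= F l) ->
  sumw j (fun l => (good l)%:R * F l) <=
  \sum_(n < j.+1) sumw (j - n) (fun y => (sfree y (cpre n))%:R * F (y ++ cpre n)).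
Proof.
elim: j F => [|j IH] F F0; first by rewrite big_ord1 /= !mul1r.
rewrite big_ord_recr /= subnn /= mul1r.
apply: (@le_trans _ _ (\sum_(a : A) sumw j (fun l => (good l)%:R *
   ((wlt c (a :: l) 0)%:R * F (a :: l))) +
   sumw j.+1 (fun w => (w == cpre j.+1)%:R * F w))).
  rewrite /= -big_split /=; apply: ler_sum => a _.
  rewrite sumwD; apply: ler_sumw => l sl; rewrite mulrA -natrM mulnb -mulrDl -natrD.
  rewrite ler_wpM2r // ler_nat.
  case: (boolP (good l)) => gl; rewrite ?andbF ?andbT ?andTb //.
  have := @wle_eq_or_wlt N c (a :: l) 0; rewrite /= sl.
  by case: (_ || _) => //= -[//|->|->] //; rewrite ?eqxx ?leq_addl ?leq_addr.
rewrite sumw_pick ?size_cword // lerD2r.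
apply: (@le_trans _ _ (\sum_(a : A) \sum_(n < j.+1) sumw (j - n) (fun y =>
   (sfree y (cpre n))%:R * ((wlt c (a :: y ++ cpre n) 0)%:R * F (a :: y ++ cpre n))))).
  apply: ler_sum => a _; apply: (IH (fun l => (wlt c (a :: l) 0)%:R * F (a :: l))).
  by move=> l; rewrite mulr_ge0.
rewrite exchange_big /=; apply: ler_sum => n _.
have nj : (n <= j)%N by rewrite -ltnS.
rewrite (subSn nj) /=; apply: ler_sum => a _; apply: ler_sumw => y _.
by rewrite mulrA -natrM mulnb andbC.
Qed.

Lemma sum_geometric_le (x : R) n : 0 <= x -> x < 1 ->
  \sum_(i < n) x ^+ i <= (1 - x)^-1.
Proof.
move=> x0 x1; rewrite -div1r ler_pdivlMr ?subr_gt0 // mulrC -[1 - x]opprB mulNr.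
by rewrite -subrX1 opprB lerBlDr lerDl exprn_ge0.
Qed.

(** The weights [al] and [G] bear on the block and on what is to the right of
    it only: the past of the block is summed over freely, which is what
    makes it possible to modify it. *)
Definition block_sum j m k (al G : seq A -> R) : R :=
  sumw j (fun l => sumw m (fun a => sumw k (fun r =>
    (good (l ++ a ++ r))%:R * (al a * G r * expR (Sw (l ++ a ++ r)))))).

Lemma block_sum_ge0 j m k al G : (forall a, 0 <= al a) -> (forall r, 0 <= G r) ->
  0 <= block_sum j m k al G.
Proof.
move=> al0 G0; apply: sumw_ge0 => l _; apply: sumw_ge0 => a _.
by apply: sumw_ge0 => r _; rewrite !mulr_ge0 ?expR_ge0.
Qed.

(** Let [u] be the longest suffix of the past that is a prefix of the expansion.
    Replacing it by an arbitrary free word, and the block by a free block, is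
    always allowed. As [u] is known once its length [n] is, the original
    configurations of a given [n] have total weight at most
    [exp (S u) / Zfree n] times that of the new ones, and this ratio is
    summable over [n] because of the energy gap. *)
Lemma block_exchange (e : R) : 0 < e -> exists2 C : R, 0 < C &
  forall j m k (al be G : seq A -> R), (forall a, 0 <= al a) ->
  (forall a, 0 <= be a) -> (forall r, 0 <= G r) ->
  (forall b, be b != 0 -> free b) ->
  block_sum j m k al G * sumw m (fun b => be b * expR (Sw b)) <=
  C * expR (m%:R * e) * sumw m (fun a => al a * expR (Sw a)) *
  block_sum j m k be G.
Proof.
move=> e0; have [kap kap0 [C1 C10 hgap]] := energy_gap Hc H.
(* Three errors [e'] per letter occur: they must stay below [e] per letter of
   the block, and, together with the loss in [Zw_le_Zfree], below half the gap
   per letter of [u]. *)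
pose e' := Num.min (e / 3) (kap / 8).
have e'0 : 0 < e' by rewrite lt_min !divr_gt0.
have e'1 : e' <= e / 3 by rewrite ge_min lexx.
have e'2 : e' <= kap / 8 by rewrite ge_min lexx orbT.
have [C2 C20 hswap] := Sw_swap H e'0; have [C3 C30 hcat] := Sw_cat H e'0.
pose q := expR (- (kap / 2)).
have q0 : 0 <= q by exact: expR_ge0.
have q1 : q < 1 by rewrite expR_lt1 oppr_lt0 divr_gt0.
pose C5 := C2 + C3 + C3.
pose K := expR (C1 + D + C5) * (1 + e'^-1).
have K0 : 0 < K by rewrite mulr_gt0 ?expR_gt0 // addr_gt0 // invr_gt0.
exists (K * (1 - q)^-1); first by rewrite mulr_gt0 // invr_gt0 subr_gt0.
move=> j m k al be G al0 be0 G0 be_free.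
set ZA := sumw m (fun a => al a * _); set ZB := sumw m (fun b => be b * _).
have ZA0 : 0 <= ZA by apply: sumw_ge0 => a _; rewrite mulr_ge0 ?expR_ge0.
have ZB0 : 0 <= ZB by apply: sumw_ge0 => a _; rewrite mulr_ge0 ?expR_ge0.
have RHS0 : 0 <= block_sum j m k be G by exact: block_sum_ge0.
pose T n : R := sumw (j - n) (fun y => (sfree y (cpre n))%:R *
  sumw m (fun a => sumw k (fun r => (good ((y ++ cpre n) ++ a ++ r))%:R *
   (al a * G r * expR (Sw ((y ++ cpre n) ++ a ++ r)))))).
have step1 : block_sum j m k al G <= \sum_(n < j.+1) T n.
  pose F l := sumw m (fun a => sumw k (fun r => (good (l ++ a ++ r))%:R *
   (al a * G r * expR (Sw (l ++ a ++ r))))).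
  have F0 l : 0 <= F l.
    apply: sumw_ge0 => a _; apply: sumw_ge0 => r _.
    by rewrite !mulr_ge0 ?expR_ge0.
  apply: le_trans (@sum_past_split j F F0).
  apply: ler_sumw => l _; case: (boolP (good l)) => gl; first by rewrite mul1r.
  rewrite mul0r -/(F l) /F sumw0 // => a _; apply: sumw0 => r _.
  case: (boolP (good (l ++ _))); last by move=> _; rewrite mul0r.
  by move=> /good_cat[gl' _]; rewrite gl' in gl.
have step2 n : (n <= j)%N -> T n * ZB <=
    K * q ^+ n * (expR (m%:R * e) * ZA * block_sum j m k be G).
  move=> nj; case: (boolP (good (cpre n))) => [gu|ngu]; last first.
    rewrite /T sumw0; first by rewrite mul0r; exact:
      (mulr_ge0 (mulr_ge0 (ltW K0) (exprn_ge0 _ q0))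
                (mulr_ge0 (mulr_ge0 (expR_ge0 _) ZA0) RHS0)).
    move=> y _; rewrite [X in _ * X]sumw0 ?mulr0 // => a _; apply: sumw0 => r _.
    case: (boolP (good (_ ++ _))); last by move=> _; rewrite mul0r.
    by move=> /good_cat[/good_cat[_ gu] _]; rewrite gu in ngu.
  pose Mn := expR (Sw (cpre n) + C5 + (n + m)%:R * (3 * e')).
  have main : T n * (Zfree n * ZB) <= Mn * ZA * block_sum j m k be G.
    pose h y f b r := (good ((y ++ f) ++ b ++ r))%:R *
      (be b * G r * expR (Sw ((y ++ f) ++ b ++ r))).
    have -> : block_sum j m k be G =
      sumw (j - n) (fun y => sumw n (fun f => sumw m (fun b => sumw k (h y f b)))).
      by rewrite /block_sum -{1}(subnK nj) sumw_cat.
    rewrite /T sumwMr sumwMl; apply: ler_sumw => y sy.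
    have hs : sumw n (fun f => sumw m (fun b => sumw k (h y f b))) =
        sumw k (fun r => sumw n (fun f => sumw m (fun b => h y f b r))).
      rewrite [RHS]exchange_sumw; apply: eq_sumw => f _.
      by rewrite [RHS]exchange_sumw.
    set Y := sumw n _ in hs *.
    pose t a r := (good ((y ++ cpre n) ++ a ++ r))%:R *
      (al a * G r * expR (Sw ((y ++ cpre n) ++ a ++ r))).
    have -> : (sfree y (cpre n))%:R * sumw m (fun a => sumw k (t a)) *
        (Zfree n * ZB) = sumw m (fun a => sumw k (fun r =>
        (sfree y (cpre n))%:R * t a r * (Zfree n * ZB))).
      by rewrite sumwMl sumwMr; apply: eq_sumw => a _; rewrite sumwMl sumwMr.
    have -> : Mn * ZA * Y = sumw m (fun a => sumw k (fun r =>
        Mn * (al a * expR (Sw a)) * sumw n (fun f => sumw m (fun b => h y f b r)))).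
      rewrite /ZA sumwMl sumwMr; apply: eq_sumw => a _.
      by rewrite hs sumwMl.
    apply: ler_sumw => a sa; apply: ler_sumw => r _.
    rewrite /Zfree /ZB sumw_mul !sumwMl; apply: ler_sumw => f sf.
    rewrite !sumwMl; apply: ler_sumw => b sb; rewrite /t /h.
    have [b0|b0] := eqVneq (be b) 0; first by rewrite b0 !(mul0r, mulr0).
    have rhs0 : 0 <= Mn * (al a * expR (Sw a)) * ((good ((y ++ f) ++ b ++ r))%:R *
      (be b * G r * expR (Sw ((y ++ f) ++ b ++ r)))).
      by rewrite !mulr_ge0 ?expR_ge0.
    case: (boolP (sfree _ _)) => [hy|_]; last by rewrite !mul0r.
    case: (boolP (good ((y ++ cpre n) ++ _))) => [gx|_]; last by rewrite !(mul0r, mulr0).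
    case: (boolP (free f)) => [hf|_]; last by rewrite !(mul0r, mulr0).
    have hyf : free (y ++ f).
      by apply: (swap_free (c_leN Hc)); rewrite ?sf.
    have gr : good r by have [_ /good_cat[]] := good_cat gx.
    rewrite (free_good_cat hyf) ?(free_good_cat (be_free b b0)) // !mul1r.
    have hE : Sw ((y ++ cpre n) ++ a ++ r) + Sw f + Sw b <=
        Sw (cpre n) + C5 + (n + m)%:R * (3 * e') + Sw a + Sw ((y ++ f) ++ b ++ r).
      have := hswap y r (cpre n ++ a) (f ++ b).
      rewrite !size_cat size_cword sa sb sf => /(_ erefl).
      have := hcat (cpre n) a; have := hcat f b.
      rewrite size_cword sa sb sf !ler_norml -!catA /C5; lra.
    have : expR (Sw ((y ++ cpre n) ++ a ++ r) + Sw f + Sw b) <=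
      expR (Sw (cpre n) + C5 + (n + m)%:R * (3 * e') + Sw a + Sw ((y ++ f) ++ b ++ r)).
      by rewrite ler_expR.
    rewrite [in leLHS]expRD [in leLHS]expRD.
    rewrite [in leRHS]expRD [in leRHS]expRD -/Mn => hE'.
    have := ler_wpM2l (mulr_ge0 (mulr_ge0 (al0 a) (G0 r)) (be0 b)) hE'.
    lra.
  have hu : expR (Sw (cpre n)) <= Zfree n * (expR (C1 + D) * (1 + e'^-1) *
      expR (n%:R * (e' - kap))).
    have := hgap _ gu; rewrite size_cword => h1.
    have h2 : expR (Sw (cpre n)) <= Zw n * expR (C1 - n%:R * kap).
      rewrite -[Zw n]lnK ?posrE ?(Zw_gt0 phi Hc) // -expRD ler_expR; lra.
    have h3 := Zw_le_Zfree n; have h4 := expR_ge_natr n e'0.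
    apply: (le_trans h2).
    apply: (@le_trans _ _ (expR D * ((1 + e'^-1) * expR (n%:R * e')) * Zfree n *
      expR (C1 - n%:R * kap))).
      rewrite ler_wpM2r ?expR_ge0 //; apply: (le_trans h3).
      by rewrite ler_wpM2r ?(ltW (Zfree_gt0 n)) // ler_wpM2l ?expR_ge0.
    rewrite mulrBr [expR (C1 + D)]expRD [expR (C1 - _)]expRD [expR (_ - _)]expRD.
    lra.
  rewrite -(ler_pM2l (Zfree_gt0 n)) mulrCA.
  apply: (le_trans main).
  have hMn : Mn <= Zfree n * (K * q ^+ n * expR (m%:R * e)).
    rewrite /Mn -addrA expRD.
    apply: (le_trans (ler_wpM2r (expR_ge0 _) hu)).
    rewrite -[leLHS]mulrA ler_wpM2l ?(ltW (Zfree_gt0 n)) //.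
    rewrite /K /q -expRM_natl [expR (C1 + D + C5)]expRD.
    have hM : expR (n%:R * (e' - kap)) * expR (C5 + (n + m)%:R * (3 * e')) <=
      expR C5 * (expR (n%:R * - (kap / 2)) * expR (m%:R * e)).
      rewrite -!expRD ler_expR natrD.
      have n0 : 0 <= n%:R :> R by [].
      have m0 : 0 <= m%:R :> R by [].
      have := ler_wpM2l n0 e'2; have := ler_wpM2l m0 e'1; lra.
    have P0 : 0 <= expR (C1 + D) * (1 + e'^-1).
      by rewrite mulr_ge0 ?expR_ge0 // addr_ge0 // invr_ge0 ltW.
    have := ler_wpM2l P0 hM; lra.
  have := ler_wpM2r (mulr_ge0 ZA0 RHS0) hMn; lra.
clearbody K.
apply: (le_trans (ler_wpM2r ZB0 step1)).
rewrite mulr_suml.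
apply: (@le_trans _ _ (\sum_(n < j.+1) K * q ^+ n *
    (expR (m%:R * e) * ZA * block_sum j m k be G))).
  by apply: ler_sum => n _; apply: step2; rewrite -ltnS.
rewrite -mulr_suml -mulr_sumr -!mulrA ler_wpM2l ?(ltW K0) //.
by rewrite ler_wpM2r ?sum_geometric_le // !mulr_ge0 ?expR_ge0.
Qed.

End exchange.

(** * Iterating the exchange over consecutive blocks *)

Section blocks.
Variables (R : realType) (N : nat).
Notation A := 'I_N.+1.
Variables (c : nat -> nat) (phi : config N -> R) (d : int -> R) (D : R).
Hypothesis Hc : expansion N c.
Hypothesis H : bounded_osc phi d D.
Variable p : R.
Hypothesis Hp : forall e : R, 0 < e -> exists2 C : R, 0 <= C &
  forall n, `|ln (Zw c phi n) - n%:R * p| <= C + n%:R * e.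
Implicit Types (w u v y f l r : seq A) (n m k j : nat).
Notation Sw := (Sw phi).
Notation Zw := (Zw c phi).
Notation good := (good c).
Notation free := (free c).
Notation block_sum := (block_sum c phi).
Notation any := (fun _ : seq A => 1 : R).

Lemma block_sum_le j m k (al be G : seq A -> R) :
  (forall l a r, size a = m -> good (l ++ a ++ r) -> al a * G r <= be a * G r) ->
  block_sum j m k al G <= block_sum j m k be G.
Proof.
move=> h; apply: ler_sumw => l _; apply: ler_sumw => a sa; apply: ler_sumw => r _.
case: (boolP (good _)) => [g|_]; last by rewrite !mul0r.
by rewrite !mul1r ler_wpM2r ?expR_ge0 //; exact: h g.
Qed.

Lemma block_sumD j m k (al be G : seq A -> R) (t : R) :
  block_sum j m k (fun a => be a + t * al a) G =
  block_sum j m k be G + t * block_sum j m k al G.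
Proof.
rewrite /block_sum sumwMl sumwD; apply: eq_sumw => l _.
rewrite sumwMl sumwD; apply: eq_sumw => a _.
rewrite sumwMl sumwD; apply: eq_sumw => r _; ring.
Qed.

(** All free words compete with [w] at the place of the block. *)
Lemma block_upper (e : R) : 0 < e -> exists2 C : R, 0 < C &
  forall j m k w (G : seq A -> R), size w = m -> (forall r, 0 <= G r) ->
  block_sum j m k (fun a => (a == w)%:R) G <=
  C * expR (Sw w - m%:R * p + m%:R * e) * block_sum j m k any G.
Proof.
move=> e0; have e1 : 0 < e / 3 by rewrite divr_gt0.
have [C C0 hC] := block_exchange Hc H e1.
have [C' C'0 hC'] := Hp e1.
pose K := C * expR (C' + D) * (1 + (e / 3)^-1).
have K0 : 0 < K by rewrite !mulr_gt0 ?expR_gt0 // addr_gt0 // invr_gt0.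
exists K => // j m k w G sw G0.
have bs0 : 0 <= block_sum j m k any G by exact: block_sum_ge0.
have Zf0 := Zfree_gt0 Hc H m.
have fb (b : seq A) : (free b)%:R != 0 :> R -> free b by case: (free b); rewrite ?eqxx.
have := hC j m k (fun a => (a == w)%:R) (fun b => (free b)%:R) G
  (fun _ => ler0n _ _) (fun _ => ler0n _ _) G0 fb.
rewrite sumw_pick // -/(Zfree c phi m) => hx.
have h1 : block_sum j m k (fun a => (a == w)%:R) G * Zfree c phi m <=
    C * expR (m%:R * (e / 3)) * expR (Sw w) * block_sum j m k any G.
  apply: le_trans hx _.
  rewrite ler_wpM2l ?mulr_ge0 ?expR_ge0 ?(ltW C0) //.
  apply: block_sum_le => l a r _ _; rewrite ler_wpM2r //.
  by case: (free a).
have h2 : expR (m%:R * p - C' - m%:R * (e / 3)) <= Zw m.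
  rewrite -[Zw m]lnK ?posrE ?(Zw_gt0 phi Hc) // ler_expR.
  by have := hC' m; rewrite ler_norml; lra.
have h3 := Zw_le_Zfree Hc H m; have h4 := expR_ge_natr m e1.
rewrite -(ler_pM2r Zf0); apply: (le_trans h1).
have h5 : 1 <= expR (D + C' - m%:R * p + 2 * (m%:R * (e / 3))) *
    (1 + (e / 3)^-1) * Zfree c phi m.
  rewrite -[leLHS](expRxMexpNx_1 (m%:R * p - C' - m%:R * (e / 3))).
  apply: (@le_trans _ _ (Zw m * expR (- (m%:R * p - C' - m%:R * (e / 3))))).
    by rewrite ler_wpM2r ?expR_ge0.
  apply: (@le_trans _ _ (expR D * ((1 + (e / 3)^-1) * expR (m%:R * (e / 3))) * Zfree c phi m *
    expR (- (m%:R * p - C' - m%:R * (e / 3))))).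
    rewrite ler_wpM2r ?expR_ge0 //; apply: (le_trans h3).
    by rewrite ler_wpM2r ?(ltW Zf0) // ler_wpM2l ?expR_ge0.
  rewrite (_ : D + C' - m%:R * p + 2 * (m%:R * (e / 3)) =
    D + m%:R * (e / 3) + (- (m%:R * p - C' - m%:R * (e / 3)))); last by ring.
  rewrite [expR (D + _ + _)]expRD [expR (D + _)]expRD; lra.
have := ler_wpM2l (mulr_ge0 (mulr_ge0 (mulr_ge0 (ltW C0) (expR_ge0 (m%:R * (e / 3))))
  (expR_ge0 (Sw w))) bs0) h5; rewrite mulr1 => /le_trans; apply.
rewrite /K; move: bs0 => _; move: (block_sum j m k any G) => B.
rewrite (_ : Sw w - m%:R * p + m%:R * e = Sw w + (m%:R * (e / 3)) +
  (- (m%:R * p) + 2 * (m%:R * (e / 3)))); last by field.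
rewrite (_ : D + C' - m%:R * p + 2 * (m%:R * (e / 3)) = (C' + D) + (- (m%:R * p) + 2 * (m%:R * (e / 3)))); last by ring.
rewrite [expR (C' + D + _)]expRD [expR (Sw w + _ + _)]expRD [expR (Sw w + _)]expRD.
lra.
Qed.

(** Conversely the free word [w] can be put in place of any block. *)
Lemma block_lower (e : R) : 0 < e -> exists2 C : R, 0 < C &
  forall j m k w (G : seq A -> R), size w = m -> free w -> (forall r, 0 <= G r) ->
  block_sum j m k any G <=
  C * expR (m%:R * p - Sw w + m%:R * e) * block_sum j m k (fun a => (a == w)%:R) G.
Proof.
move=> e0; have e1 : 0 < e / 2 by rewrite divr_gt0.
have [C C0 hC] := block_exchange Hc H e1.
have [C' C'0 hC'] := Hp e1.
exists (C * expR C'); first by rewrite mulr_gt0 ?expR_gt0.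
move=> j m k w G sw fw G0.
have h1 : block_sum j m k any G <= block_sum j m k (fun a => (good a)%:R) G.
  apply: block_sum_le => l a r _ g; rewrite ler_wpM2r //.
  by have [_ /good_cat[-> _]] := good_cat g.
have bs0 : 0 <= block_sum j m k (fun a => (a == w)%:R) G by exact: block_sum_ge0.
have fb (b : seq A) : (b == w)%:R != 0 :> R -> free b.
  by case: (eqVneq b w) => [->|_] //; rewrite eqxx.
have h2 := hC j m k (fun a => (good a)%:R) (fun b => (b == w)%:R) G
  (fun _ => ler0n _ _) (fun _ => ler0n _ _) G0 fb.
rewrite sumw_pick // -/(Zw m) in h2.
have {}h2 : block_sum j m k (fun a => (good a)%:R) G * expR (Sw w) <=
    C * expR (m%:R * (e / 2)) * Zw m * block_sum j m k (fun a => (a == w)%:R) G.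
  exact: h2.
have h3 : Zw m <= expR (m%:R * p + C' + m%:R * (e / 2)).
  rewrite -[Zw m]lnK ?posrE ?(Zw_gt0 phi Hc) // ler_expR.
  by have := hC' m; rewrite ler_norml; lra.
apply: (le_trans h1); rewrite -(ler_pM2r (expR_gt0 (Sw w))).
apply: (le_trans h2).
have := ler_wpM2l (mulr_ge0 (mulr_ge0 (ltW C0) (expR_ge0 (m%:R * (e / 2)))) bs0) h3.
rewrite (_ : m%:R * p - Sw w + m%:R * e = (m%:R * p + m%:R * (e / 2)) + m%:R * (e / 2) - Sw w); last by field.
rewrite (_ : m%:R * p + C' + m%:R * (e / 2) = (m%:R * p + m%:R * (e / 2)) + C'); last by ring.
rewrite !expRD !expRN; set W := expR (Sw w).
have W0 : W != 0 by rewrite gt_eqF ?expR_gt0.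
set X := block_sum _ _ _ _ _.
set x1 := expR (m%:R * (e / 2)); set x2 := expR (m%:R * p).
rewrite (_ : C * expR C' * (x2 * x1 * x1 / W) * X * W = C * x1 * X * (x2 * x1 * expR C')); first by lra.
by field.
Qed.

Fixpoint block_prod (th : seq A -> R) m k r : R :=
  if k is k'.+1 then th (take m r) * block_prod th m k' (drop m r) else 1.

Lemma block_prod_ge0 th m k r : (forall a, 0 <= th a) -> 0 <= block_prod th m k r.
Proof.
by move=> th0; elim: k r => [|k IH] r //=; rewrite mulr_ge0.
Qed.

(** The blocks are treated from left to right: when the [i]-th one is treated,
    the weights of the previous ones have already been removed, so that nothing
    is asked of its past. *)
Lemma sum_block_prod_le (th : seq A -> R) (lam : R) m k :
  (forall a, 0 <= th a) -> 0 <= lam ->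
  (forall j k (G : seq A -> R), (forall r, 0 <= G r) ->
    block_sum j m k th G <= lam * block_sum j m k any G) ->
  sumw (k * m) (fun w => (good w)%:R * (block_prod th m k w * expR (Sw w))) <=
  lam ^+ k * Zw (k * m).
Proof.
move=> th0 lam0 h.
pose X i k := sumw (i * m) (fun l => sumw (k * m) (fun r =>
  (good (l ++ r))%:R * (block_prod th m k r * expR (Sw (l ++ r))))).
have X0 : sumw (k * m) (fun w => (good w)%:R * (block_prod th m k w * expR (Sw w))) = X 0%N k.
  by [].
have Xk i : X i 0%N = Zw (i * m).
  by apply: eq_sumw => w _; rewrite /= cats0 mul1r.
have step i k' : X i k'.+1 <= lam * X i.+1 k'.
  have e1 : X i k'.+1 = block_sum (i * m) m (k' * m) th (block_prod th m k').
    rewrite /X mulSn; apply: eq_sumw => l _; rewrite sumw_cat; apply: eq_sumw => a sa.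
    by apply: eq_sumw => r _; rewrite /= take_size_cat // drop_size_cat.
  have e2 : X i.+1 k' = block_sum (i * m) m (k' * m) any (block_prod th m k').
    rewrite /X mulSn addnC sumw_cat; apply: eq_sumw => l _; apply: eq_sumw => a sa.
    by apply: eq_sumw => r _; rewrite catA mul1r.
  by rewrite e1 e2 h // => r; exact: block_prod_ge0.
have main k' i : X i k' <= lam ^+ k' * Zw ((i + k') * m).
  elim: k' i => [|k' IH] i; first by rewrite expr0 mul1r addn0 Xk.
  apply: (le_trans (step _ _)); rewrite exprS -mulrA ler_wpM2l //.
  by rewrite addnS -addSn; exact: IH.
by rewrite X0 (le_trans (main _ _)).
Qed.

End blocks.

(** * Entropy of finite partitions *)

Lemma ln_le_sub1 (R : realType) (x : R) : 0 < x -> ln x <= x - 1.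
Proof.
move=> x0; have := @le_ln1Dx R (x - 1); rewrite (addrC 1) subrK; apply.
by lra.
Qed.

(** Gibbs' inequality: apply [ln x <= x - 1] to the ratios [Q i / P i]. *)
Lemma gibbs_inequality (R : realType) (I : finType) (P Q : I -> R) :
  (forall i, 0 <= P i) -> (forall i, 0 <= Q i) ->
  \sum_i Q i <= \sum_i P i -> (forall i, 0 < P i -> 0 < Q i) ->
  - \sum_i P i * ln (P i) <= - \sum_i P i * ln (Q i).
Proof.
move=> P0 Q0 QP h; rewrite lerN2 -subr_ge0 -sumrB -lerN2 oppr0 -sumrN.
apply: (@le_trans _ _ (\sum_i (Q i - P i))); last by rewrite sumrB subr_le0.
apply: ler_sum => i _; rewrite -mulrBr -mulrN opprB.
have [Pi0|Pi0] := eqVneq (P i) 0; first by rewrite Pi0 mul0r subr0.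
have Pi : 0 < P i by rewrite lt_neqAle eq_sym Pi0 P0.
have Qi := h i Pi; rewrite -ln_div ?posrE //.
have := ler_wpM2l (P0 i) (@ln_le_sub1 _ (Q i / P i) (divr_gt0 Qi Pi)).
by rewrite mulrBr mulr1 mulrCA divff // mulr1.
Qed.

Section finite_valued.
Variables (R : realType) (d : measure_display) (T : measurableType d).
Variable mu : probability T R.

Definition pr (A : set T) : R := fine (mu A).

Definition finite_meas (I : finType) (X : T -> I) :=
  forall i, measurable (X @^-1` [set i]).

Definition shannon (I : finType) (X : T -> I) : R :=
  - \sum_i pr (X @^-1` [set i]) * ln (pr (X @^-1` [set i])).

Lemma pr_ge0 A : 0 <= pr A.
Proof. exact: fine_ge0. Qed.

Lemma pr_setT : pr setT = 1.
Proof. by rewrite /pr probability_setT. Qed.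

Lemma prU A B : measurable A -> measurable B -> A `&` B = set0 ->
  pr (A `|` B) = pr A + pr B.
Proof.
move=> mA mB AB; rewrite /pr measureU // fineD // fin_num_measure //.
Qed.

Lemma le_pr A B : measurable A -> measurable B -> A `<=` B -> pr A <= pr B.
Proof.
move=> mA mB AB; apply: fine_le; rewrite ?fin_num_measure //.
by apply: le_measure; rewrite ?inE.
Qed.

Lemma pr_le1 A : measurable A -> pr A <= 1.
Proof. by move=> mA; rewrite -pr_setT le_pr. Qed.

Lemma pr_setC A : measurable A -> pr (~` A) = 1 - pr A.
Proof.
move=> mA; apply/eqP; rewrite eq_sym subr_eq addrC -prU ?setICr //.
  by rewrite setUv pr_setT.
exact: measurableC.
Qed.

Lemma pr_full_inter S B : measurable S -> measurable B -> pr S = 1 ->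
  pr (S `&` B) = pr B.
Proof.
move=> mS mB S1.
have S0 : pr (B `\` S) = 0.
  apply/eqP; rewrite eq_le pr_ge0 andbT.
  apply: (@le_trans _ _ (pr (~` S))); last by rewrite pr_setC // S1 subrr.
  by apply: le_pr; [exact: measurableD|exact: measurableC|move=> x []].
have e : B = (S `&` B) `|` (B `\` S).
  by apply/seteqP; split=> x /=; [case: (pselect (S x)); tauto|tauto].
rewrite [in RHS]e prU ?S0 ?addr0 //; [exact: measurableI|exact: measurableD|].
by rewrite -subset0 => x /= [[Sx _] [_]].
Qed.

Lemma fiber_cons (I : finType) (X : T -> I) i (s : seq I) :
  [set x | X x \in i :: s] = X @^-1` [set i] `|` [set x | X x \in s].
Proof.
apply/seteqP; split=> x /=; rewrite inE; first by case/orP=> [/eqP|]; [left|right].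
by case=> [->|->]; rewrite ?eqxx ?orbT.
Qed.

Lemma measurable_fiber (I : finType) (X : T -> I) (P : pred I) :
  finite_meas X -> measurable [set x | P (X x)].
Proof.
move=> mX; suff h (s : seq I) : measurable [set x | X x \in s].
  by have := h (enum P); congr (measurable _); apply/funext => x; rewrite /= mem_enum.
elim: s => [|i s IH]; first by rewrite (_ : [set _ | _] = set0) // -subset0 => x.
by rewrite fiber_cons; apply: measurableU.
Qed.

Lemma sum_fiber (I : finType) (X : T -> I) (P : pred I) : finite_meas X ->
  \sum_(i | P i) pr (X @^-1` [set i]) = pr [set x | P (X x)].
Proof.
move=> mX; suff h (s : seq I) : uniq s ->
    \sum_(i <- s) pr (X @^-1` [set i]) = pr [set x | X x \in s].
  have := h (enum P) (enum_uniq _); rewrite big_enum /= => ->; congr pr.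
  by apply/funext => x; rewrite /= mem_enum.
elim: s => [_|i s IH /= /andP[ni us]].
  by rewrite big_nil (_ : [set _ | _] = set0) ?/pr ?measure0 // -subset0 => x.
rewrite big_cons (IH us) fiber_cons prU //.
  exact: (@measurable_fiber I X (mem s)).
by rewrite -subset0 => x /= [-> ]; rewrite (negbTE ni).
Qed.

Lemma sum_fiber1 (I : finType) (X : T -> I) : finite_meas X ->
  \sum_i pr (X @^-1` [set i]) = 1.
Proof.
move=> mX; rewrite (sum_fiber xpredT mX) -pr_setT; congr pr.
by apply/seteqP; split.
Qed.

Lemma sum_fiber_comp (I J : finType) (X : T -> I) (g : I -> J) (F : J -> R) :
  finite_meas X ->
  \sum_i pr (X @^-1` [set i]) * F (g i) =
  \sum_j pr ((g \o X) @^-1` [set j]) * F j.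
Proof.
move=> mX; rewrite (partition_big g xpredT) //=; apply: eq_bigr => j _.
rewrite (eq_bigr (fun i => pr (X @^-1` [set i]) * F j)); last by move=> i /eqP ->.
rewrite -mulr_suml (sum_fiber (fun i => g i == j) mX); congr (pr _ * _).
by apply/seteqP; split=> x /= /eqP.
Qed.

Lemma finite_meas_pair (I J : finType) (X : T -> I) (Y : T -> J) :
  finite_meas X -> finite_meas Y -> finite_meas (fun x => (X x, Y x)).
Proof.
move=> mX mY [i j]; have := measurableI _ _ (mX i) (mY j).
by congr (measurable _); apply/seteqP; split=> x /= [-> ->].
Qed.

Lemma finite_meas_tuple n (I : finType) (X : 'I_n -> T -> I) :
  (forall s, finite_meas (X s)) -> finite_meas (fun x => [tuple X s x | s < n]).
Proof.
move=> mX t.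
have -> : (fun x => [tuple X s x | s < n]) @^-1` [set t] =
    \bigcap_(s in [set: 'I_n]) (X s @^-1` [set tnth t s]).
  apply/seteqP; split=> x /= h; first by move=> s _; rewrite -h tnth_mktuple.
  by apply: eq_from_tnth => s; rewrite tnth_mktuple; exact: h.
by apply: fin_bigcap_measurable => // s _; exact: mX.
Qed.

Lemma shannon_ge0 (I : finType) (X : T -> I) : finite_meas X -> 0 <= shannon X.
Proof.
move=> mX; rewrite /shannon oppr_ge0; apply: sumr_le0 => i _.
by rewrite mulr_ge0_le0 ?pr_ge0 // ln_le0 // pr_le1.
Qed.

(** Coding [Y], and then [X] given [Y] according to the channel [K], costs at
    least the entropy of [X]: this is Gibbs' inequality for the law that [K]
    induces from the law of [Y]. *)
Lemma shannon_channel (I J : finType) (X : T -> I) (Y : T -> J)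
    (K : J -> I -> R) : finite_meas X -> finite_meas Y ->
  (forall j i, 0 < K j i) -> (forall j, \sum_i K j i <= 1) ->
  shannon X <= shannon Y +
    \sum_(z : I * J) pr ((fun x => (X x, Y x)) @^-1` [set z]) * (- ln (K z.2 z.1)).
Proof.
move=> mX mY K0 K1; set Z := fun x => (X x, Y x).
have mZ : finite_meas Z by exact: finite_meas_pair.
pose Q i := \sum_j pr (Y @^-1` [set j]) * K j i.
have Q0 i : 0 <= Q i by apply: sumr_ge0 => j _; rewrite mulr_ge0 ?pr_ge0 // ltW.
have leQ i j : pr (Y @^-1` [set j]) * K j i <= Q i.
  rewrite /Q (bigD1 j) //= lerDl; apply: sumr_ge0 => j' _.
  by rewrite mulr_ge0 ?pr_ge0 // ltW.
have ZX z : pr (Z @^-1` [set z]) <= pr (X @^-1` [set z.1]).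
  by apply: le_pr => // x /= <-.
have ZY z : pr (Z @^-1` [set z]) <= pr (Y @^-1` [set z.2]).
  by apply: le_pr => // x /= <-.
have Qpos z : 0 < pr (Z @^-1` [set z]) -> 0 < pr (Y @^-1` [set z.2]) * K z.2 z.1.
  by move=> h; rewrite mulr_gt0 // (lt_le_trans h).
have h1 : shannon X <= - \sum_i pr (X @^-1` [set i]) * ln (Q i).
  apply: gibbs_inequality => //.
  - by move=> i; exact: pr_ge0.
  - rewrite (sum_fiber1 mX) exchange_big /= -(sum_fiber1 mY).
    apply: ler_sum => j _; rewrite -mulr_sumr -[leRHS]mulr1.
    by rewrite ler_wpM2l ?pr_ge0.
  - move=> i Pi; rewrite lt_neqAle eq_sym Q0 andbT; apply/negP => /eqP Qi.
    have : pr (X @^-1` [set i]) = \sum_(z | z.1 == i) pr (Z @^-1` [set z]).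
      rewrite (sum_fiber (fun z => z.1 == i) mZ); congr pr.
      by apply/seteqP; split=> x /= /eqP.
    rewrite big1 => [e|z /eqP zi]; first by rewrite e ltxx in Pi.
    apply/eqP; rewrite eq_le pr_ge0 andbT leNgt; apply/negP => /Qpos.
    by rewrite ltNge (le_trans (leQ _ _)) // zi Qi.
apply: (le_trans h1).
have eX : fst \o Z = X by apply/funext.
have eY : snd \o Z = Y by apply/funext.
rewrite -{1}eX -(sum_fiber_comp (X := Z) fst (fun i => ln (Q i)) mZ).
have -> : shannon Y = - \sum_z pr (Z @^-1` [set z]) * ln (pr (Y @^-1` [set z.2])).
  rewrite (sum_fiber_comp (X := Z) snd (fun j => ln (pr (Y @^-1` [set j]))) mZ).
  by rewrite eY.
rewrite -!sumrN -big_split /=; apply: ler_sum => z _.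
rewrite mulrN -opprD -mulrDr lerN2.
have [->|P0] := eqVneq (pr (Z @^-1` [set z])) 0; first by rewrite !mul0r.
have {}P0 : 0 < pr (Z @^-1` [set z]) by rewrite lt_neqAle eq_sym P0 pr_ge0.
rewrite ler_wpM2l ?pr_ge0 // -lnM ?posrE //; last exact: lt_le_trans P0 (ZY z).
have := Qpos z P0 => h; rewrite ler_ln ?posrE //.
exact: lt_le_trans h (leQ _ _).
Qed.

End finite_valued.

Lemma cvg_of_rate (R : realType) (u : nat -> R) (k : nat -> nat) (L : R) :
  (forall n, (n <= k n)%N) ->
  (forall e : R, 0 < e -> exists2 C : R, 0 <= C &
     forall n, `|u n - (k n)%:R * L| <= C + (k n)%:R * e) ->
  (u n / (k n)%:R) @[n --> \oo] --> L.
Proof.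
move=> nk h; apply/cvgrPdist_le => /= e e0.
have [C C0 hC] := h _ (divr_gt0 e0 (ltr0Sn R 1)).
near=> n.
have n0 : (0 < n)%N by near: n; exists 1%N.
have k0 : 0 < (k n)%:R :> R by rewrite ltr0n (leq_trans n0).
have kC : C <= (k n)%:R * (e / 2).
  rewrite -ler_pdivrMr ?divr_gt0 //.
  apply: (@le_trans _ _ n%:R); last by rewrite ler_nat.
  near: n; exists (Num.trunc (C / (e / 2))).+1 => // m /= hm.
  apply: ltW; apply: (lt_le_trans (truncnS_gt _)); by rewrite ler_nat.
rewrite distrC -(ler_pM2r k0) -[X in _ * X](gtr0_norm k0) -normrM mulrBl.
rewrite divfK ?gt_eqF // [L * _]mulrC.
by apply: (le_trans (hC n)); lra.
Unshelve. all: by end_near. Qed.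

(** * The entropy of a stationary process *)

Section dynamics.
Variables (R : realType) (d : measure_display) (T : measurableType d).
Variables (mu : probability T R) (f : T -> T).
Hypothesis mf : measurable_fun setT f.
Hypothesis f_inv : forall B, measurable B -> mu (f @^-1` B) = mu B.

Definition itinerary k (xi : T -> 'I_k) n (x : T) : n.-tuple 'I_k :=
  [tuple xi (iter s f x) | s < n].

Lemma measurable_iter n (B : set T) : measurable B -> measurable (iter n f @^-1` B).
Proof.
move=> mB; elim: n => //= n IH; rewrite (_ : _ @^-1` B = f @^-1` (iter n f @^-1` B)).
  by rewrite -[X in measurable X]setTI; exact: mf.
by apply/seteqP; split=> x; rewrite /= -iterS iterSr.
Qed.

Lemma pr_iter n (B : set T) : measurable B -> pr mu (iter n f @^-1` B) = pr mu B.
Proof.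
move=> mB; elim: n => //= n <-.
rewrite (_ : _ @^-1` B = f @^-1` (iter n f @^-1` B)).
  by rewrite /pr f_inv //; exact: measurable_iter.
by apply/seteqP; split=> x; rewrite /= -iterS iterSr.
Qed.

Section itineraries.
Variables (k : nat) (xi : T -> 'I_k).
Hypothesis mxi : finite_meas xi.

Lemma finite_meas_iter s : finite_meas (fun x => xi (iter s f x)).
Proof. by move=> a; exact: (measurable_iter s (mxi a)). Qed.

Lemma finite_meas_itinerary n : finite_meas (itinerary xi n).
Proof. by apply: finite_meas_tuple => s; exact: finite_meas_iter. Qed.

Lemma join_entropyE n : join_entropy mu f xi n = shannon mu (itinerary xi n).
Proof.
rewrite /join_entropy /shannon; congr (- _); apply: eq_bigr => w _ /=.
have -> : [set x | forall i : 'I_n, xi (iter i f x) = tnth w i] =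
          itinerary xi n @^-1` [set w]; last by [].
apply/seteqP; split=> x /= h; last by move=> i; rewrite -h tnth_mktuple.
by apply: eq_from_tnth => i; rewrite tnth_mktuple.
Qed.

(** Gibbs' inequality for the product of the laws of the two parts, which by
    stationarity are laws of itineraries too. *)
Lemma shannon_itinerary_add n m :
  shannon mu (itinerary xi (n + m)) <=
  shannon mu (itinerary xi n) + shannon mu (itinerary xi m).
Proof.
pose w1 (w : (n + m).-tuple 'I_k) := [tuple tnth w (lshift m i) | i < n].
pose w2 (w : (n + m).-tuple 'I_k) := [tuple tnth w (rshift n i) | i < m].
pose X l := itinerary xi l; pose P l w := pr mu (X l @^-1` [set w]).
have mX l : finite_meas (X l) by exact: finite_meas_itinerary.
have e1 : w1 \o X (n + m)%N = X n.
  by apply/funext => x; apply: eq_from_tnth => i; rewrite !tnth_mktuple.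
have e2 : w2 \o X (n + m)%N = X m \o iter n f.
  apply/funext => x; apply: eq_from_tnth => i; rewrite !tnth_mktuple /=.
  by rewrite addnC iterD.
have P2 w : pr mu ((X m \o iter n f) @^-1` [set w]) = P m w.
  by rewrite comp_preimage pr_iter //; exact: mX.
have le1 w : P (n + m)%N w <= P n (w1 w).
  by apply: le_pr => [||x /= <-]; [exact: mX|exact: mX|rewrite -e1].
have le2 w : P (n + m)%N w <= P m (w2 w).
  rewrite -P2; apply: le_pr => [||x /= <-]; [exact: mX| |exact: (congr1 (fun F => F x) (esym e2))].
  by rewrite comp_preimage; apply: measurable_iter; exact: mX.
have P0 l w : 0 <= P l w by exact: pr_ge0.
have bij : bijective (fun w => (w1 w, w2 w)).
  exists (fun z : n.-tuple 'I_k * m.-tuple 'I_k =>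
    [tuple match fintype.split i with inl a => tnth z.1 a | inr b => tnth z.2 b end | i < n + m]).
    move=> w; apply: eq_from_tnth => i; rewrite tnth_mktuple.
    case: fintype.splitP => a ia; rewrite tnth_mktuple; congr tnth; exact: val_inj.
  move=> [u v]; congr (_, _); apply: eq_from_tnth => i; rewrite !tnth_mktuple.
    by case: fintype.splitP => a /= ia; [congr tnth; exact: val_inj|
       have := ltn_ord i; rewrite ia ltnNge leq_addr].
  case: fintype.splitP => a /= ia; first by have := ltn_ord a; rewrite -ia ltnNge leq_addr.
  by congr tnth; apply: val_inj; move/addnI: ia.
rewrite {1}/shannon.
apply: (@le_trans _ _ (- \sum_w P (n + m)%N w * ln (P n (w1 w) * P m (w2 w)))).
  apply: gibbs_inequality => [w|w||w Pw]; [exact: P0|by rewrite mulr_ge0 ?P0| |].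
  - rewrite (sum_fiber1 mu (mX (n + m)%N)).
    have -> : \sum_w P n (w1 w) * P m (w2 w) =
        \sum_(z : n.-tuple 'I_k * m.-tuple 'I_k) P n z.1 * P m z.2.
      by rewrite (reindex _ (onW_bij _ bij)).
    rewrite -(pair_big xpredT xpredT (fun u v => P n u * P m v)) /=.
    under eq_bigr do rewrite -mulr_sumr (sum_fiber1 mu (mX m)) mulr1.
    by rewrite (sum_fiber1 mu (mX n)).
  - exact: mulr_gt0 (lt_le_trans Pw (le1 w)) (lt_le_trans Pw (le2 w)).
have -> : shannon mu (X n) = - \sum_w P (n + m)%N w * ln (P n (w1 w)).
  by rewrite (sum_fiber_comp mu w1 (fun v => ln (P n v)) (mX _)) e1.
have -> : shannon mu (X m) = - \sum_w P (n + m)%N w * ln (P m (w2 w)).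
  rewrite (sum_fiber_comp mu w2 (fun v => ln (P m v)) (mX _)) e2.
  by congr (- _); apply: eq_bigr => w _; rewrite P2.
rewrite -opprD -big_split /= lerN2; apply: ler_sum => w _.
have [->|Pw] := eqVneq (P (n + m)%N w) 0; first by rewrite !mul0r addr0.
have {}Pw : 0 < P (n + m)%N w by rewrite lt_neqAle eq_sym Pw P0.
rewrite lnM ?posrE ?mulrDr //; [exact: lt_le_trans Pw (le1 w)|exact: lt_le_trans Pw (le2 w)].
Qed.

Lemma partition_entropy_le n :
  n%:R * partition_entropy mu f xi <= shannon mu (itinerary xi n).
Proof.
have [||L [h1 h2]] := @fekete R (fun n => shannon mu (itinerary xi n)) 0.
- by move=> i j; exact: shannon_itinerary_add.
- by move=> i; rewrite mulr0 oppr0 shannon_ge0 //; exact: finite_meas_itinerary.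
suff -> : partition_entropy mu f xi = L by exact: h1.
rewrite /partition_entropy; under eq_fun do rewrite join_entropyE.
apply/cvg_lim => //; apply: (@cvg_of_rate R _ id) => // e e0.
have [C C0 hC] := h2 e e0; exists C => // i.
by have := h1 i; have := hC i; rewrite ler_norml; lra.
Qed.

End itineraries.
End dynamics.

(** * Configurations: topology and measurability *)

Section topology.
Variable N : nat.
Notation A := 'I_N.+1.
Implicit Types (x y : config N) (M n : nat) (i : int).

Definition agree M x y := forall i : int, (`|i| <= M)%N -> x i = y i.

Lemma agree_sym M x y : agree M x y -> agree M y x.
Proof. by move=> h i iM; rewrite h. Qed.

Lemma agree_le M M' x y : (M <= M')%N -> agree M' x y -> agree M x y.
Proof. by move=> MM h i iM; apply: h; exact: leq_trans MM. Qed.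

Lemma nbhs_coord x i : nbhs x [set y : config N | x i = y i].
Proof.
have := @proj_continuous int (fun _ => letter N) i x.
move=> /(_ [set a | x i = a]); apply.
by rewrite nbhs_principalE.
Qed.

Lemma nbhs_agree M x : nbhs x [set y : config N | agree M x y].
Proof.
suff h (s : seq int) : nbhs x [set y : config N | forall i, i \in s -> x i = y i].
  apply: filterS (h (box M)) => y hy i iM; apply: hy; by rewrite mem_box.
elim: s => [|i s IH]; first by apply: filterS filterT => y _ i.
apply: filterS (filterI (nbhs_coord x i) IH) => y [h1 h2] j.
by rewrite inE => /orP[/eqP ->|/h2].
Qed.

(** The windows form a neighbourhood basis: the filter that they generate at
    [x] converges to [x] coordinate by coordinate. *)
Lemma nbhs_config x (U : set (config N)) : nbhs x U ->
  exists M, forall y : config N, agree M x y -> U y.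
Proof.
pose F : set_system (config N) := [set V | exists M, forall y, agree M x y -> V y].
have FF : Filter F.
  split; first by exists 0%N.
  - move=> V W [M1 h1] [M2 h2]; exists (maxn M1 M2) => y hy; split.
      by apply: h1; apply: agree_le hy; exact: leq_maxl.
    by apply: h2; apply: agree_le hy; exact: leq_maxr.
  - by move=> V W VW [M h]; exists M => y /h /VW.
move=> Ux; suff : F --> x by apply.
apply/cvg_sup => i; apply/cvg_image.
  apply/seteqP; split => // a _; exists (fun j => if j == i then a else x j) => //=.
move=> V /nbhs_singleton Vx; exists [set y : config N | V (y i)].
  by exists (absz i) => y hy /=; rewrite -hy.
apply/seteqP; split=> [_ [y Vy <-] //|a Va].
by exists (fun j => if j == i then a else x j) => /=; rewrite eqxx.
Qed.

Lemma open_agree M (B : set (config N)) :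
  (forall x y, agree M x y -> B x -> B y) -> open B.
Proof.
move=> hB; rewrite openE => x Bx; apply: filterS (nbhs_agree M x) => y xy.
exact: hB Bx.
Qed.

End topology.

Section borel.
Variables (R : realType) (N : nat).
Notation A := 'I_N.+1.
Notation T := (borel_config N).
Implicit Types (x y : config N) (M n : nat) (i : int).

Lemma open_borel (B : set (config N)) : open B -> measurable (B : set T).
Proof. by move=> oB; apply: sub_sigma_algebra. Qed.

Definition window_set M (B : set (config N)) :=
  forall x y, agree M x y -> B x -> B y.

Lemma measurable_window M (B : set (config N)) :
  window_set M B -> measurable (B : set T).
Proof. by move=> hB; apply: open_borel; exact: open_agree hB. Qed.

Lemma window_set_le M M' B : (M <= M')%N -> window_set M B -> window_set M' B.
Proof. by move=> MM hB x y h; apply: hB; exact: agree_le h. Qed.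

Lemma window_setC M B : window_set M B -> window_set M (~` B).
Proof. by move=> hB x y xy nBx By; apply: nBx; apply: hB By; exact: agree_sym. Qed.

Lemma window_setU M B B' :
  window_set M B -> window_set M B' -> window_set M (B `|` B').
Proof. by move=> h h' x y xy [/(h _ _ xy)|/(h' _ _ xy)]; [left|right]. Qed.

Lemma measurable_tshift j : measurable_fun setT (tshift j : T -> T).
Proof.
apply: (@measurability _ _ T T setT _ (@open (config N))) => // _ [B oB <-].
rewrite setTI; apply: open_borel; rewrite openE => x /= Bx.
have [M hM] : exists M, forall y, agree M (tshift j x) y -> B y.
  by apply: nbhs_config; move: oB; rewrite openE => /(_ _ Bx).
apply: filterS (nbhs_agree (M + absz j) x) => y xy /=; apply: hM => i iM.
by rewrite /tshift; apply: xy; lia.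
Qed.

Lemma measurable_wordc j n (w : seq A) :
  measurable ([set x | wordc j n x = w] : set T).
Proof.
apply: (@measurable_window (absz j + n)) => x y xy /= <-; symmetry.
by apply/eq_wordc => k kn; apply: xy; lia.
Qed.

Lemma measurable_continuous (g : config N -> R) : continuous g ->
  measurable_fun setT (g : T -> R).
Proof.
move=> /continuousP gc.
apply: (measurability _ (measurable_realfun.RGenOpens.measurableE R)).
move=> _ [_ [a [b ->]] <-]; rewrite setTI; apply: open_borel.
by apply: gc; exact: interval_open.
Qed.

Section approximation.
Variable nu : probability T R.

Definition sdiff (B B' : set T) : set T := (B `\` B') `|` (B' `\` B).

Definition approximable (B : set T) := forall e : R, 0 < e ->
  exists M (B' : set (config N)), window_set M B' /\ pr nu (sdiff B B') <= e.

Lemma measurable_sdiff B B' : measurable B -> measurable B' ->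
  measurable (sdiff B B').
Proof. by move=> h h'; apply: measurableU; apply: measurableD. Qed.

Lemma pr_subadd (B B' : set T) : measurable B -> measurable B' ->
  pr nu (B `|` B') <= pr nu B + pr nu B'.
Proof.
move=> mB mB'; rewrite /pr -fineD ?fin_num_measure //; apply: fine_le.
- by rewrite fin_num_measure //; exact: measurableU.
- by rewrite fin_numD !fin_num_measure.
- exact: measureU2.
Qed.

Lemma approximable_window M (B : set T) : window_set M B -> approximable B.
Proof.
move=> hB e e0; exists M, B; split => //.
by rewrite /sdiff setDv setU0 /pr measure0 ltW.
Qed.

Lemma approximableC (B : set T) : approximable B -> approximable (~` B).
Proof.
move=> h e /h[M [B' [wB' hB']]]; exists M, (~` B'); split; first exact: window_setC.
rewrite (_ : sdiff _ _ = sdiff B B') // /sdiff.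
by apply/seteqP; split=> x; rewrite /= !notK; case: (pselect (B x)); case: (pselect (B' x)); tauto.
Qed.

Lemma approximableU (B1 B2 : set T) : measurable B1 -> measurable B2 ->
  approximable B1 -> approximable B2 -> approximable (B1 `|` B2).
Proof.
move=> m1 m2 h1 h2 e e0; have e2 : 0 < e / 2 by rewrite divr_gt0.
have [M1 [C1 [w1 d1]]] := h1 _ e2; have [M2 [C2 [w2 d2]]] := h2 _ e2.
have mC1 := measurable_window w1; have mC2 := measurable_window w2.
exists (maxn M1 M2), (C1 `|` C2); split.
  apply: window_setU; first by apply: window_set_le w1; exact: leq_maxl.
  by apply: window_set_le w2; exact: leq_maxr.
apply: (@le_trans _ _ (pr nu (sdiff B1 C1 `|` sdiff B2 C2))).
  apply: le_pr.
  - by apply: measurable_sdiff; exact: measurableU.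
  - by apply: measurableU; exact: measurable_sdiff.
  - by rewrite /sdiff => x /=; tauto.
apply: (le_trans (pr_subadd _ _)); [exact: measurable_sdiff|exact: measurable_sdiff|].
by rewrite [leRHS](splitr e) lerD.
Qed.

Lemma approximable_bigcup (F : nat -> set T) : (forall n, measurable (F n)) ->
  (forall n m, (n <= m)%N -> F n `<=` F m) -> (forall n, approximable (F n)) ->
  approximable (\bigcup_n F n).
Proof.
move=> mF ndF aF e e0; have e2 : 0 < e / 2 by rewrite divr_gt0.
have mU : measurable (\bigcup_n F n) by exact: bigcupT_measurable.
have cv : nu \o F @ \oo --> nu (\bigcup_n F n).
  apply: nondecreasing_cvg_mu => //.
  by move=> n m nm; apply/subsetPset; exact: ndF.
have [n hn] : exists n, pr nu (\bigcup_n F n) - e / 2 <= pr nu (F n).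
  have cv' : (fine \o (nu \o F)) @ \oo --> pr nu (\bigcup_n F n).
    by apply: fine_cvg; rewrite /pr fineK // fin_num_measure.
  have /cvgrPdist_le /(_ _ e2) [n _ /(_ n (leqnn n)) /=] := cv'.
  by rewrite ler_norml => h; exists n; rewrite /pr /= in h *; lra.
have [M [C [wC hC]]] := aF n _ e2; have mC := measurable_window wC.
exists M, C; split => //.
apply: (@le_trans _ _ (pr nu ((\bigcup_n F n `\` F n) `|` sdiff (F n) C))).
  apply: le_pr.
  - exact: measurable_sdiff.
  - by apply: measurableU; [exact: measurableD|exact: measurable_sdiff].
  - move=> x [[Fx Cx]|[Cx nFx]].
      by have [Fnx|Fnx] := pselect (F n x); [right; left|left].
    by right; right; split=> // Fnx; apply: nFx; exists n.
apply: (le_trans (pr_subadd _ _)); [exact: measurableD|exact: measurable_sdiff|].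
have h1 : pr nu (\bigcup_n F n) = pr nu (F n) + pr nu (\bigcup_n F n `\` F n).
  rewrite -prU ?setDUK //; [by move=> x Fx; exists n|exact: measurableD|exact: setDIK].
lra.
Qed.

(** An open set is the increasing union over [n] of the window sets made of the
    points whose window [-n, n] is already contained in it. *)
Lemma open_approximable (U : set (config N)) : open U -> approximable U.
Proof.
move=> oU; pose F n : set T := [set x | forall y, agree n x y -> U y].
have FU : U = \bigcup_n F n.
  apply/seteqP; split=> [x Ux|x [n _]]; last by apply.
  have [M hM] : exists M, forall y, agree M x y -> U y.
    by apply: nbhs_config; move: oU; rewrite openE => /(_ _ Ux).
  by exists M.
have wF n : window_set n (F n).
  by move=> x y xy Fx z yz; apply: Fx => i iM; rewrite xy // yz.
rewrite FU; apply: approximable_bigcup.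
- by move=> n; exact: measurable_window (wF n).
- by move=> n m nm x Fx y xy; apply: Fx; exact: agree_le xy.
- by move=> n; exact: approximable_window (wF n).
Qed.

(** The approximable Borel sets form a sigma-algebra that contains the open
    sets. *)
Lemma measurable_approximable (B : set T) : measurable B -> approximable B.
Proof.
suff : (@measurable _ T) `<=` [set B | measurable B /\ approximable B].
  by move=> h /h[].
apply: smallest_sub; last first.
  by move=> U oU; split; [exact: open_borel|exact: open_approximable].
split => /=.
- by split=> //; apply: (@approximable_window 0%N).
- move=> C [mC aC]; rewrite setTD; split; [exact: measurableC|exact: approximableC].
- move=> F hF; split; first by apply: bigcupT_measurable => n; case: (hF n).
  pose G n : set T := \big[setU/set0]_(i < n.+1) F i.
  have mG n : measurable (G n) by apply: bigsetU_measurable => i _; case: (hF i).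
  have -> : \bigcup_n F n = \bigcup_n G n by rewrite /G bigcup_bigsetU_bigcup.
  apply: approximable_bigcup => //.
    by move=> n m nm; apply: subset_bigsetU; rewrite ltnS.
  elim=> [|n IH]; first by rewrite /G big_ord1; exact: (hF 0%N).2.
  have -> : G n.+1 = G n `|` F n.+1 by rewrite /G big_ord_recr.
  by apply: approximableU => //; [exact: (hF n.+1).1|exact: (hF n.+1).2].
Qed.

End approximation.
End borel.

(** * Metric entropy and the entropy of words *)

Lemma ln_prodr (R : realType) (I : Type) (s : seq I) (F : I -> R) :
  (forall i, 0 < F i) -> ln (\prod_(i <- s) F i) = \sum_(i <- s) ln (F i).
Proof.
move=> F0; elim: s => [|i s IH]; first by rewrite !big_nil ln1.
by rewrite !big_cons lnM ?posrE ?IH // prodr_gt0.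
Qed.

Section shift_entropy.
Variables (R : realType) (N : nat).
Notation A := 'I_N.+1.
Notation T := (borel_config N).
Variable nu : probability T R.
Notation f := (tshift 1 : T -> T).
Hypothesis nu_inv : forall B : set T, measurable B -> nu (f @^-1` B) = nu B.
Implicit Types (x y : config N) (M n : nat).

Lemma iter_tshift s (x : T) : iter s f x = tshift s%:Z x.
Proof.
elim: s => [|s IH]; apply/funext => i; first by rewrite /tshift addr0.
by rewrite iterS IH /tshift; congr x; lia.
Qed.

Lemma val_word_at j L x : tval (word_at j L x) = wordc j L x.
Proof.
apply: (@eq_from_nth _ ord0); rewrite !size_tuple ?size_wordc // => i iL.
by rewrite nth_wordc // -[i]/(val (Ordinal iL)) -tnth_nth tnth_mktuple.
Qed.

Lemma word_atP j L x (t : L.-tuple A) : word_at j L x = t <-> wordc j L x = t.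
Proof. by rewrite -val_word_at; split=> [->|/val_inj]. Qed.

Lemma finite_meas_word j L : finite_meas (word_at j L : T -> L.-tuple A).
Proof.
move=> t; rewrite (_ : _ @^-1` _ = [set x | wordc j L x = t]).
  exact: measurable_wordc.
by apply/seteqP; split=> x /word_atP.
Qed.

Lemma pr_wordc j L (w : seq A) :
  pr nu [set x : T | wordc j L x = w] = pr nu [set x : T | wordc 0 L x = w].
Proof.
have h s i : pr nu [set x : T | wordc i L x = w] =
             pr nu [set x : T | wordc (i + s%:Z) L x = w].
  rewrite -(pr_iter (measurable_tshift 1) nu_inv s (measurable_wordc i L w)).
  congr pr; apply/funext => x /=; rewrite iter_tshift wordc_tshift //.
case: j => s; first by rewrite (h s 0) add0r.
by rewrite (h s.+1) (_ : Negz s + s.+1%:Z = 0) //; lia.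
Qed.

Lemma shannon_word_at j L : shannon nu (word_at j L : T -> L.-tuple A) =
  shannon nu (word_at 0 L : T -> L.-tuple A).
Proof.
have h i (t : L.-tuple A) : (word_at i L : T -> _) @^-1` [set t] =
    [set x | wordc i L x = t].
  by apply/seteqP; split=> x /word_atP.
by congr (- _); apply: eq_bigr => t _; rewrite !h pr_wordc.
Qed.

Lemma pr_union_le (I : Type) (s : seq I) (F : I -> set T) (e : R) :
  (forall i, measurable (F i)) -> (forall i, pr nu (F i) <= e) ->
  pr nu (\big[setU/set0]_(i <- s) F i) <= (size s)%:R * e.
Proof.
move=> mF h; elim: s => [|i s IH]; first by rewrite big_nil /pr measure0 mul0r.
rewrite big_cons /= -natr1 mulrDl mul1r addrC.
apply: le_trans (pr_subadd nu (mF i) _) (lerD (h i) IH).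
by apply: bigsetU_measurable => j _; exact: mF.
Qed.

(** Each class is approximated by a window set; away from the small errors these
    sets do form a partition, and they tell the class. *)
Lemma approx_partition k (xi : T -> 'I_k) (e : R) : finite_meas xi -> 0 < e ->
  exists M (F : T -> 'I_k), [/\ forall x y, agree M x y -> F x = F y,
    measurable [set x : T | xi x != F x] & pr nu [set x : T | xi x != F x] <= e].
Proof.
move=> mxi e0; have a0 : 'I_k := xi (emb [::]).
have k0 : (0 < k)%N by case: (k) a0 => // -[].
have ek : 0 < e / k%:R by rewrite divr_gt0 // ltr0n.
have H a : exists p : nat * set T, window_set p.1 p.2 /\
    pr nu (sdiff (xi @^-1` [set a]) p.2) <= e / k%:R.
  by have [M [B hB]] := measurable_approximable nu (mxi a) ek; exists (M, B).
have [g hg] := choice H.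
pose M := (\max_(a < k) (g a).1)%N.
have wg a : window_set M (g a).2.
  by apply: window_set_le (hg a).1; exact: (@leq_bigmax _ (fun a => (g a).1)).
have mg a : measurable (g a).2 by exact: measurable_window (hg a).1.
pose F (x : T) := odflt a0 [pick a | `[< (g a).2 x >]].
have FM x y : agree M x y -> F x = F y.
  move=> xy; rewrite /F (eq_pick (Q := fun a => `[< (g a).2 y >])) // => a.
  by apply/asboolP/asboolP => h; apply: wg h => //; exact: agree_sym.
exists M, F; set B := [set x : T | xi x != F x].
pose D a := sdiff (xi @^-1` [set a]) (g a).2.
have mD a : measurable (D a) by apply: measurable_sdiff.
have mF a : measurable ([set x | F x = a] : set T).
  by apply: (@measurable_window _ M) => x y xy /= <-; rewrite (FM _ _ xy).
have mB : measurable B.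
  rewrite (_ : B = \bigcup_(a in [set: 'I_k])
     ((xi @^-1` [set a]) `\` [set x | F x = a])).
    by apply: fin_bigcup_measurable => // a _; apply: measurableD.
  rewrite /B; apply/seteqP; split=> [x /= /eqP h|x [a _ /= [-> h]]]; last first.
    by apply/eqP => h'; apply: h.
  by exists (xi x) => //; split => // /esym.
split => //.
apply: (@le_trans _ _ (pr nu (\big[setU/set0]_(a <- enum 'I_k) D a))); last first.
  apply: le_trans (pr_union_le _ mD (fun a => (hg a).2)) _.
  by rewrite size_enum_ord mulrC divfK // pnatr_eq0 -lt0n.
apply: le_pr => //; first by apply: bigsetU_measurable => a _; exact: mD.
rewrite /B => x /= xF.
rewrite -bigcup_seq /=; apply: contrapT => nD.
have hx a : (g a).2 x <-> xi x = a.
  have : ~ D a x by move=> h; apply: nD; exists a => //=; rewrite mem_enum.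
  rewrite /D /sdiff /=; case: (pselect ((g a).2 x)); case: (pselect (xi x = a)); tauto.
case/eqP: xF; rewrite /F; case: pickP => [a /asboolP /hx //|/(_ (xi x))].
by move/asboolP; rewrite hx.
Qed.

Lemma sum_tuple_prod_le1 n k (kap : 'I_n -> 'I_k -> R) :
  (forall s a, 0 <= kap s a) -> (forall s, \sum_a kap s a <= 1) ->
  \sum_(t : n.-tuple 'I_k) \prod_s kap s (tnth t s) <= 1.
Proof.
move=> k0 k1.
rewrite (reindex (fun g : {ffun 'I_n -> 'I_k} => [tuple g s | s < n])) /=; last first.
  exists (fun t : n.-tuple 'I_k => [ffun s => tnth t s]) => [g _|t _].
    by apply/ffunP => s; rewrite ffunE tnth_mktuple.
  by apply: eq_from_tnth => s; rewrite tnth_mktuple ffunE.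
under eq_bigr do under eq_bigr do rewrite tnth_mktuple.
rewrite -(bigA_distr_bigA (fun s a => kap s a)) /=.
by apply: Num.Theory.prodr_ile1 => s; rewrite k1 sumr_ge0.
Qed.

(** The word read on the window [-M, n + M] tells the itinerary for an
    approximating partition, hence a guess of the true itinerary, wrong at a
    small proportion of the times. The channel of [shannon_channel] outputs the
    guess with probability close to 1 and every other label with a small one. *)
Lemma shannon_itinerary_le k (xi : T -> 'I_k) (e : R) : finite_meas xi -> 0 < e ->
  exists M, forall n, shannon nu (itinerary f xi n) <=
    shannon nu (word_at 0 (n + (2 * M + 1)) : T -> _) + n%:R * e.
Proof.
move=> mxi e0; have a0 : 'I_k := xi (emb [::]).
have k0 : (0 < k)%N by case: (k) a0 => // -[].
have kR : 1 <= k%:R :> R by rewrite ler1n.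
have k0R : 0 < k%:R :> R by rewrite ltr0n.
(* [om] is the weight of the guess: right guesses cost [e / 2], and wrong ones
   cost [q], but their frequency is at most [e / 2 / q] *)
pose om := expR (- (e / 2)); pose eta := 1 - om.
have om1 : om < 1 by rewrite expR_lt1 oppr_lt0 divr_gt0.
have om0 : 0 < om by exact: expR_gt0.
have eta0 : 0 < eta by rewrite subr_gt0.
have ek0 : 0 < eta / k%:R by rewrite divr_gt0.
pose q := - ln (eta / k%:R).
have q0 : 0 < q.
  rewrite oppr_gt0 ln_lt0 // ek0 /= ltr_pdivrMr // mul1r.
  by apply: lt_le_trans kR; rewrite /eta; lra.
have [M [F [FM mBad Bad]]] := approx_partition mxi (divr_gt0 (divr_gt0 e0 (ltr0Sn R 1)) q0).
exists M => n; set L := (n + (2 * M + 1))%N.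
pose X := itinerary f xi n; pose Y : T -> L.-tuple A := word_at (- M%:Z) L.
pose ext (t : L.-tuple A) (s : 'I_n) := tshift (s + M)%N%:Z (emb t).
have extE x s : agree M (ext (Y x) s) (tshift s%:Z x).
  move=> i iM; rewrite /ext /tshift.
  have [p pE] : exists p : nat, i + (s + M)%N%:Z = p%:Z.
    by exists (absz (i + (s + M)%N%:Z)); lia.
  have sn := ltn_ord s.
  rewrite pE /= val_word_at nth_wordc; [congr x; lia|rewrite /L; lia].
pose kap (b a : 'I_k) : R := if a == b then om else eta / k%:R.
have kap0 b a : 0 < kap b a by rewrite /kap; case: ifP.
have kap1 b : \sum_a kap b a <= 1.
  apply: (@le_trans _ _ (\sum_(a < k) ((a == b)%:R * om + eta / k%:R))).
    by apply: ler_sum => a _; rewrite /kap; case: eqP => _; rewrite ?mul1r ?mul0r ?add0r // lerDl ltW.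
  rewrite big_split /= sumr_const card_ord -mulr_suml.
  rewrite (bigD1 b) //= eqxx big1 ?addr0 => [|a /negbTE ->] //.
  by rewrite mul1r -[_ *+ k]mulr_natr divfK ?gt_eqF // /eta; lra.
pose K (t : L.-tuple A) (i : n.-tuple 'I_k) := \prod_s kap (F (ext t s)) (tnth i s).
have mX : finite_meas X.
  exact: (finite_meas_itinerary (measurable_tshift 1) mxi).
have mY : finite_meas Y by exact: finite_meas_word.
have K0 t i : 0 < K t i by apply: prodr_gt0.
have K1 t : \sum_i K t i <= 1.
  apply: (@sum_tuple_prod_le1 n k (fun s => kap (F (ext t s)))) => // s a.
  exact: ltW.
rewrite -(shannon_word_at (- M%:Z)) -/L -/Y.
apply: (le_trans (shannon_channel nu mX mY K0 K1)).
rewrite lerD2l; set Z := (fun x : T => (X x, Y x)).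
have mZ : finite_meas Z by exact: finite_meas_pair.
pose bad (s : 'I_n) (z : n.-tuple 'I_k * L.-tuple A) := tnth z.1 s != F (ext z.2 s).
have lnK z : - ln (K z.2 z.1) <= \sum_s (e / 2 + (bad s z)%:R * q).
  rewrite /K ln_prodr //.
  rewrite -sumrN; apply: ler_sum => s _; rewrite /kap /bad.
  case: eqP => _ /=; first by rewrite mul0r addr0 expRK opprK.
  by rewrite mul1r lerDr ltW // divr_gt0.
apply: (@le_trans _ _ (\sum_z pr nu (Z @^-1` [set z]) *
    \sum_s (e / 2 + (bad s z)%:R * q))).
  by apply: ler_sum => z _; rewrite ler_wpM2l ?pr_ge0.
under eq_bigr do rewrite mulr_sumr.
rewrite exchange_big /= -[n in leRHS]card_ord mulr_natl -sumr_const.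
apply: ler_sum => s _.
under eq_bigr do rewrite mulrDr [X in _ + X]mulrA.
rewrite big_split /= -!mulr_suml (sum_fiber1 nu mZ) mul1r.
rewrite [leRHS](splitr e) lerD2l.
have -> : \sum_z pr nu (Z @^-1` [set z]) * (bad s z)%:R = pr nu [set x | bad s (Z x)].
  rewrite -(sum_fiber nu (bad s) mZ) [RHS]big_mkcond /=; apply: eq_bigr => z _.
  by case: (bad s z); rewrite ?mulr1 ?mulr0.
have -> : [set x | bad s (Z x)] = iter s f @^-1` [set x | xi x != F x].
  apply/funext => x; rewrite /= /bad /= tnth_mktuple (FM _ _ (extE x s)).
  by rewrite iter_tshift.
rewrite (pr_iter (measurable_tshift 1) nu_inv) //.
by rewrite -ler_pdivlMr.
Qed.

(** The Kolmogorov-Sinai theorem, as far as it is needed: metric entropy, a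
    supremum over all finite partitions, is bounded by the entropy of words. *)
Lemma entropy_rate (h : R) : metric_entropy nu f = h%:E -> forall e : R, 0 < e ->
  exists2 C : R, 0 <= C & forall L,
    L%:R * h <= shannon nu (word_at 0 L : T -> L.-tuple A) + (C + L%:R * e).
Proof.
move=> hE e e0; have e2 : 0 < e / 2 by rewrite divr_gt0.
have : ((h - e / 2)%:E < metric_entropy nu f)%E by rewrite hE lte_fin; lra.
move=> /ereal_sup_gt[_ [k [xi [mxi ->]]]].
rewrite lte_fin => hxi.
have [M hM] := shannon_itinerary_le mxi e2.
set m := (2 * M + 1)%N in hM.
exists (m%:R * `|h|); first by rewrite mulr_ge0.
move=> L; have hh : h <= `|h| := ler_norm h.
have sh0 l : 0 <= shannon nu (word_at 0 l : T -> l.-tuple A).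
  by apply: shannon_ge0; exact: finite_meas_word.
case: (leqP m L) => mL; last first.
  have : L%:R * h <= m%:R * `|h|.
    apply: (@le_trans _ _ (L%:R * `|h|)); first by rewrite ler_wpM2l.
    by rewrite ler_wpM2r // ler_nat ltnW.
  have : 0 <= L%:R * e by rewrite mulr_ge0 // ltW.
  have := sh0 L; lra.
have h1 := hM (L - m)%N; rewrite subnK // in h1.
have h2 := partition_entropy_le (measurable_tshift 1) nu_inv mxi (L - m).
have n0 : 0 <= (L - m)%:R :> R by [].
have h3 := ler_wpM2l n0 (ltW hxi).
have LE : L%:R = (L - m)%:R + m%:R :> R by rewrite -natrD subnK.
have h4 : m%:R * h <= m%:R * `|h| by rewrite ler_wpM2l.
have h5 : 0 <= m%:R * e by rewrite mulr_ge0 // ltW.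
rewrite LE; lra.
Qed.

End shift_entropy.

(** * The expansion of one and the shift space *)

Section beta.
Variables (R : realType) (beta : R).
Hypothesis beta_gt1 : 1 < beta.
Notation N := (top_digit beta).
Notation A := 'I_N.+1.
Notation Sg := (Sigma_beta beta).
Implicit Types (x : config N) (w : seq A).

Definition cdig (i : nat) : nat := absz (cbeta beta i).
Notation good := (good cdig).

Lemma beta_gt0 : 0 < beta.
Proof. exact: lt_trans ltr01 beta_gt1. Qed.

Lemma rbeta_itv i : 0 < rbeta beta i /\ rbeta beta i <= 1.
Proof.
case: i => [|i] /=; first by split.
set t := beta * _; have h1 := ceilB1_lt t.
have h2 : t <= (Num.ceil t)%:~R by rewrite -ceil_le_int.
rewrite intrB in h1 *; lra.
Qed.

Lemma cbetaE i : cbeta beta i = (cdig i)%:Z.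
Proof.
rewrite /cdig /cbeta; have [r0 _] := rbeta_itv i.
have : 0 < Num.ceil (beta * rbeta beta i).
  by rewrite ceil_gt0 mulr_gt0 // beta_gt0.
by rewrite gtz0_ge1 => h; rewrite gez0_abs // subr_ge0.
Qed.

Lemma ceil_beta_gt1 : 1 < Num.ceil beta.
Proof. by rewrite ceil_gt_int. Qed.

Lemma top_digitE : (N%:Z = Num.ceil beta - 1)%R.
Proof. have := ceil_beta_gt1; rewrite /top_digit; lia. Qed.

Lemma cdig0 : cdig 0 = N.
Proof. by apply/eqP; rewrite -eqz_nat -cbetaE /cbeta /= mulr1 top_digitE. Qed.

Lemma cdig_le i : (cdig i <= N)%N.
Proof.
rewrite -lez_nat -cbetaE top_digitE /cbeta lerD2r; apply: le_ceil.
by rewrite ger_pMr ?beta_gt0 // (rbeta_itv i).2.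
Qed.

Lemma rbetaS i : rbeta beta i.+1 = beta * rbeta beta i - (cdig i)%:R.
Proof. by rewrite /= -[_ - 1]/(cbeta beta i) cbetaE. Qed.

(** If all digits vanished from some index on, the remainders would grow
    geometrically, whereas they are at most 1. *)
Lemma cdig_nz i : exists j, (0 < cdig (i + j))%N.
Proof.
apply: contrapT => h.
have h0 j : cdig (i + j) = 0%N.
  by apply/eqP; rewrite -leqn0 leqNgt; apply/negP => hj; apply: h; exists j.
have hr j : rbeta beta (i + j) = beta ^+ j * rbeta beta i.
  elim: j => [|j IH]; first by rewrite addn0 expr0 mul1r.
  by rewrite addnS rbetaS h0 subr0 IH exprS mulrA.
have [r0 r1] := rbeta_itv i.
have b1 := beta_gt1; pose a := beta - 1; have a0 : 0 < a by rewrite /a; lra.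
have bern j : 1 + j%:R * a <= beta ^+ j.
  elim: j => [|j IH]; first by rewrite mul0r addr0.
  have : 0 <= j%:R * a * a by rewrite !mulr_ge0 // ltW.
  have := ler_wpM2l (ltW (lt_trans ltr01 beta_gt1)) IH.
  rewrite exprS -natr1 /a; lra.
pose j := (Num.trunc ((rbeta beta i)^-1 / a)).+1.
have hj : (rbeta beta i)^-1 / a < j%:R by exact: truncnS_gt.
have := (rbeta_itv (i + j)).2; rewrite hr leNgt => /negP; apply.
rewrite -ltr_pdivrMr // div1r; apply: lt_le_trans (bern j).
by move: hj; rewrite ltr_pdivrMr //; lra.
Qed.

Lemma expansion_cdig : expansion N cdig.
Proof.
split; [|exact: cdig_le|exact: cdig_nz].
by rewrite cdig0 -ltz_nat top_digitE; have := ceil_beta_gt1; lra.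
Qed.

(** The digits that follow a remainder depend on it monotonically, and all the
    remainders are at most the initial one. *)
Lemma wle_cword_tail i n j : (rbeta beta i <= rbeta beta j) ->
  wle cdig (cword N cdig i n) j.
Proof.
elim: n i j => //= n IH i j rij; rewrite inordK ?ltnS ?cdig_le //.
have cij : (cdig i <= cdig j)%N.
  rewrite -lez_nat -!cbetaE /cbeta lerD2r; apply: le_ceil.
  by rewrite ler_pM2l ?beta_gt0.
move: cij; rewrite leq_eqVlt => /orP[/eqP cij|->//]; rewrite cij eqxx /= orbC.
by rewrite IH // !rbetaS cij lerD2r ler_pM2l ?beta_gt0.
Qed.

Lemma good_cword i n : good (cword N cdig i n).
Proof.
elim: n i => //= n IH i; rewrite IH andbT.
by apply: (@wle_cword_tail i n.+1 0); rewrite (rbeta_itv i).2.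
Qed.

Lemma wle_iotaP (y : nat -> A) j n :
  wle cdig [seq y i | i <- iota j n] j <->
  ((forall i, (j <= i < j + n)%N -> y i = cdig i :> nat) \/
   exists i, [/\ (j <= i < j + n)%N, (y i < cdig i)%N &
     forall i', (j <= i' < i)%N -> y i' = cdig i' :> nat]).
Proof.
elim: n j => [|n IH] j /=; first by split=> // _; left => i; lia.
split=> [/orP[h|/andP[/eqP h /IH[h1|[i [h1 h2 h3]]]]]|].
- by right; exists j; split => //; [lia|move=> i'; lia].
- left => i hi; case: (eqVneq i j) => [->//|ij]; apply: h1; lia.
- right; exists i; split=> //; first by lia.
  move=> i' hi'; case: (eqVneq i' j) => [->//|ij]; apply: h3; lia.
- case=> [h|[i [h1 h2 h3]]].
    apply/orP; right; rewrite h ?eqxx /=; last by lia.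
    by apply/IH; left => i hi; apply: h; lia.
  case: (eqVneq i j) => [ij|ij]; first by apply/orP; left; rewrite -ij.
  apply/orP; right; rewrite h3 ?eqxx /=; last by lia.
  apply/IH; right; exists i; split => //; first by lia.
  by move=> i' hi'; apply: h3; lia.
Qed.

Lemma lex_leP (y : nat -> letter N) :
  lex_le (fun i => digit (y i)) (cbeta beta) <->
  forall n, wle cdig [seq (y i : A) | i <- iota 0 n] 0.
Proof.
split=> [[h|[i [h1 h2]]] n|h].
- apply/wle_iotaP; left => i _; have := h i; rewrite cbetaE => -[->] //.
- have e1 i' : (i' < i)%N -> y i' = cdig i' :> nat by move=> /h1; rewrite cbetaE => -[->].
  apply/wle_iotaP; case: (ltnP i n) => ni.
    right; exists i; split; [by lia| |by move=> i' hi'; apply: e1; lia].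
    by move: h2; rewrite cbetaE ltz_nat.
  by left => i' hi'; apply: e1; lia.
have [h0|h0] := pselect (forall i, y i = cdig i :> nat).
  by left => i; rewrite cbetaE /digit h0.
right; have [i0 hi0] : exists i, y i != cdig i :> nat.
  apply: contrapT => h1; apply: h0 => i; apply/eqP; apply: contrapT => h2.
  by apply: h1; exists i; apply/negP.
have [i hi mini] := ex_minnP (ex_intro (fun i => y i != cdig i :> nat) i0 hi0).
have e1 i' : (i' < i)%N -> y i' = cdig i' :> nat.
  by move=> ii; apply/eqP; apply: contraLR ii => /mini; rewrite -leqNgt.
exists i; split; first by move=> i' /e1 e; rewrite cbetaE /digit e.
rewrite cbetaE ltz_nat; have /wle_iotaP[h1|[i1 [h1 h2 h3]]] := h i.+1.
  by case/eqP: hi; apply: h1; lia.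
case: (ltngtP i1 i) => [ii|ii|<- //]; last by lia.
by have := e1 _ ii; lia.
Qed.

Lemma SigmaP x : Sg x <-> forall k n, good (wordc k n x).
Proof.
have E (k : int) n : wordc k n x = [seq (x (k + i%:Z) : A) | i <- iota 0 n] by [].
split=> [h k n|h k j].
  elim: n k => // n IH k.
  have /lex_leP/(_ n.+1) := h k 0%N.
  rewrite (eq_map (g := fun i => x (k + i%:Z))); last by move=> i; rewrite add0n.
  rewrite -E => hw.
  have e : wordc k n.+1 x = (x k : A) :: wordc (k + 1) n x.
    by rewrite -[n.+1]/(1 + n)%N wordc_cat /wordc /= addr0.
  by move: hw; rewrite e /= => ->; exact: IH.
apply/lex_leP => n.
have := h (k + j%:Z) n; case: n => // n; rewrite E /= => /andP[+ _].
by congr (wle _ (_ :: _) _); [congr (x _); lia | apply: eq_map => i; congr (x _); lia].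
Qed.

Lemma Sigma_tshift j x : Sg x -> Sg (tshift j x).
Proof. by move=> /SigmaP h; apply/SigmaP => k n; rewrite wordc_tshift. Qed.

Lemma wordc_emb_zeros w (a b : nat) :
  wordc (- a%:Z) (a + (size w + b)) (emb w) = nseq a ord0 ++ w ++ nseq b ord0.
Proof.
rewrite wordc_cat wordc_cat addNr wordc_emb add0r; congr (_ ++ (_ ++ _)).
  apply: (@eq_from_nth _ ord0); rewrite size_wordc ?size_nseq // => i ia.
  rewrite nth_wordc // nth_nseq if_same /emb.
  by case E : (- a%:Z + i%:Z) => [k|//]; lia.
apply: (@eq_from_nth _ ord0); rewrite size_wordc ?size_nseq // => i ia.
by rewrite nth_wordc // nth_nseq if_same -PoszD /= nth_default // leq_addr.
Qed.

Lemma Sigma_emb w : good w -> Sg (emb w).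
Proof.
have c0 := c0_gt0 expansion_cdig.
move=> gw; apply/SigmaP => k n; pose a := absz k; pose b := (absz k + n)%N.
have : good (wordc (- a%:Z) (a + (size w + b)) (emb w)).
  rewrite wordc_emb_zeros; apply: free_good_cat; first exact: free_zeros.
  exact: good_cat_zeros.
pose q := absz (k + a%:Z).
have -> : (a + (size w + b) = q + (n + (a + (size w + b) - q - n)))%N.
  by rewrite /q /b /a; lia.
rewrite wordc_cat => /good_cat[_]; rewrite wordc_cat => /good_cat[+ _].
by rewrite (_ : - a%:Z + q%:Z = k) // /q /a; lia.
Qed.

Lemma languageP m (t : m.-tuple (letter N)) :
  language Sg m t <-> good (t : m.-tuple A).
Proof.
split=> [[x [k [/SigmaP h ->]]]|gt].
  by rewrite val_word_at.
exists (emb (t : m.-tuple A)), 0; split; first exact: Sigma_emb.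
by apply/esym/word_atP; rewrite -[X in wordc _ X _](size_tuple t) wordc_emb.
Qed.

Lemma measurable_Sigma : measurable (Sg : set (borel_config N)).
Proof.
rewrite -[Sg]setCK; apply: measurableC; apply: open_borel.
rewrite openE => x /= nx.
have [k [n ng]] : exists k n, ~ good (wordc k n x).
  apply: contrapT => h; apply: nx; apply/SigmaP => k n; apply: contrapT => h'.
  by apply: h; exists k, n.
apply: filterS (nbhs_agree (absz k + n) x) => y xy /= /SigmaP/(_ k n).
rewrite (_ : wordc k n y = wordc k n x) //.
by apply/eq_wordc => i ik; rewrite xy //; lia.
Qed.

(** The default value of [zbeta] is harmless: as the expansion does not end with
    zeros, some run length qualifies. *)
Lemma zbeta_spec l : (forall j, (j < zbeta beta l)%N -> cdig (l + j) = 0%N) /\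
  (0 < cdig (l + zbeta beta l))%N.
Proof.
rewrite /zbeta; case: eqP => [->|_]; first by split => //; exact: c0_gt0 expansion_cdig.
set P := [set p | _].
have : exists p, P p.
  have [j hj] := cdig_nz l.
  have [p hp minp] := ex_minnP (ex_intro (fun j => (0 < cdig (l + j))%N) j hj).
  exists p; split; last by rewrite cbetaE ltz_nat.
  move=> i ip; rewrite cbetaE; apply/eqP; rewrite eqz_nat -leqn0 leqNgt.
  by apply: contraL ip => /minp; rewrite -leqNgt.
move=> /(xgetPex 0%N)[h1 h2]; split; last by move: h2; rewrite cbetaE ltz_nat.
by move=> j /h1; rewrite cbetaE => -[].
Qed.

Lemma zbeta_le_zbar l n : (l <= n)%N -> (zbeta beta l <= zbar beta n)%N.
Proof.
by move=> ln; exact: (@leq_bigmax _ (fun i : 'I_n.+1 => zbeta beta i) (Ordinal (ln : (l < n.+1)%N))).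
Qed.

(** A suffix of [w] that is still a prefix of the expansion meets a nonzero
    digit before the added zeros are exhausted. *)
Lemma free_cat_zeros w g : good w -> (zbar beta (size w) < g)%N ->
  free cdig (w ++ nseq g ord0).
Proof.
have c0 := c0_gt0 expansion_cdig.
move=> gw hg; suff h : forall s, (size s <= size w)%N -> good s ->
    free cdig (s ++ nseq g (ord0 : A)) by exact: h.
elim=> [|a s IH] sw; first by move=> _; exact: free_zeros.
move=> /= /andP[hs gs]; rewrite free_cons IH ?(ltnW sw) // andbT.
rewrite -cat_cons; apply: wlt_cat_eq => //; rewrite add0n.
have [_ hz] := zbeta_spec (size (a :: s)).
have zg : (zbeta beta (size (a :: s)) < g)%N.
  by apply: leq_ltn_trans hg; exact: zbeta_le_zbar.
rewrite -(subnKC zg) nseqD; apply: wlt_cat; exact: wlt_zeros.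
Qed.

End beta.

(** * The variational inequality for block weights *)

Section expectation.
Variables (R : realType) (N : nat).
Notation A := 'I_N.+1.
Notation T := (borel_config N).
Variable nu : probability T R.
Notation f := (tshift 1 : T -> T).
Hypothesis nu_inv : forall B : set T, measurable B -> nu (f @^-1` B) = nu B.
Implicit Types (x y : config N) (w a : seq A) (M n m k L : nat).

Definition wmass w : R := pr nu [set x : T | wordc 0 (size w) x = w].

Lemma wmass_ge0 w : 0 <= wmass w.
Proof. exact: pr_ge0. Qed.

Lemma wmass_tuple L (t : L.-tuple A) :
  pr nu ((word_at 0 L : T -> L.-tuple A) @^-1` [set t]) = wmass t.
Proof.
rewrite /wmass size_tuple; congr pr.
by apply/seteqP; split=> x /word_atP.
Qed.

Lemma shannon_wordE L : shannon nu (word_at 0 L : T -> L.-tuple A) =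
  - sumw L (fun w => wmass w * ln (wmass w)).
Proof.
rewrite sumw_tuple /shannon; congr (- _); apply: eq_bigr => t _.
by rewrite wmass_tuple.
Qed.

(** By stationarity, a block of a longer word has the law of the words of its
    length, wherever it is. *)
Lemma sum_wmass_block j m k (F : seq A -> R) :
  sumw (j + (m + k)) (fun w => wmass w * F (take m (drop j w))) =
  sumw m (fun a => wmass a * F a).
Proof.
set L := (j + (m + k))%N.
pose g (t : L.-tuple A) := [tuple nth ord0 t (j + i) | i < m].
have gE (t : L.-tuple A) : tval (g t) = take m (drop j t).
  apply: (@eq_from_nth _ ord0).
    by rewrite size_tuple size_takel // size_drop size_tuple /L; lia.
  move=> i; rewrite size_tuple => im; rewrite nth_take // nth_drop.
  by rewrite -[i]/(val (Ordinal im)) -tnth_nth tnth_mktuple.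
rewrite sumw_tuple.
rewrite (eq_bigr (fun t : L.-tuple A =>
  pr nu ((word_at 0 L : T -> L.-tuple A) @^-1` [set t]) * F (g t))); last first.
  by move=> t _; rewrite wmass_tuple gE.
rewrite (sum_fiber_comp nu g (fun t => F (tval t)) (@finite_meas_word N 0 L)).
rewrite sumw_tuple; apply: eq_bigr => t _; congr (_ * _).
rewrite /wmass size_tuple -(pr_wordc nu_inv j%:Z); congr pr.
apply/funext => x; rewrite /= /g; apply/propext; split=> [<-|h].
  apply: (@eq_from_nth _ ord0); rewrite size_wordc ?size_tuple // => i im.
  rewrite nth_wordc // -[i]/(val (Ordinal im)) -tnth_nth tnth_mktuple.
  by rewrite val_word_at nth_wordc ?add0r ?PoszD //; rewrite /L /=; lia.
apply: eq_from_tnth => i; rewrite tnth_mktuple (tnth_nth ord0) -h.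
by rewrite nth_wordc // val_word_at nth_wordc ?add0r ?PoszD //; rewrite /L; have := ltn_ord i; lia.
Qed.

Lemma sum_wmass L : sumw L wmass = 1.
Proof.
rewrite sumw_tuple -(sum_fiber1 nu (@finite_meas_word N 0 L)).
by apply: eq_bigr => t _; rewrite wmass_tuple.
Qed.

Lemma sum_wmass_ln_block_prod (th : seq A -> R) m k : (forall a, 0 < th a) ->
  sumw (k * m) (fun w => wmass w * ln (block_prod th m k w)) =
  k%:R * sumw m (fun a => wmass a * ln (th a)).
Proof.
move=> th0; have bp0 k' w : 0 < block_prod th m k' w.
  by elim: k' w => //= k' IH w; rewrite mulr_gt0.
have lnE k' w : ln (block_prod th m k' w) =
    \sum_(i < k') ln (th (take m (drop (i * m) w))).
  elim: k' w => [|k' IH] w; first by rewrite big_ord0 /= ln1.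
  rewrite /= lnM ?posrE // big_ord_recl mul0n drop0 IH; congr (_ + _).
  by apply: eq_bigr => i _; rewrite drop_drop -mulSnr.
rewrite (eq_sumw (G := fun w => \sum_(i < k) wmass w * ln (th (take m (drop (i * m) w)))));
  last by move=> w _; rewrite lnE mulr_sumr.
rewrite -sumw_sum (eq_bigr (fun _ => sumw m (fun a => wmass a * ln (th a)))).
  by rewrite sumr_const card_ord mulr_natl.
move=> i _; have e : (k * m = i * m + (m + (k - i.+1) * m))%N.
  by rewrite addnA -mulSnr -mulnDl subnKC.
by rewrite e (sum_wmass_block (i * m) m ((k - i.+1) * m) (fun a => ln (th a))).
Qed.

End expectation.

Section variational.
Variables (R : realType) (N : nat).
Notation A := 'I_N.+1.
Notation T := (borel_config N).
Variables (c : nat -> nat) (phi : config N -> R) (p h I : R).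
Hypothesis Hc : expansion N c.
Hypothesis Hp : forall e : R, 0 < e -> exists2 C : R, 0 <= C &
  forall n, `|ln (Zw c phi n) - n%:R * p| <= C + n%:R * e.
Variable nu : probability T R.
Notation f := (tshift 1 : T -> T).
Hypothesis nu_inv : forall B : set T, measurable B -> nu (f @^-1` B) = nu B.
Hypothesis nu_supp : forall w : seq A, 0 < wmass nu w -> good c w.
Hypothesis Hh : forall e : R, 0 < e -> exists2 C : R, 0 <= C & forall L,
  L%:R * h <= shannon nu (word_at 0 L : T -> L.-tuple A) + (C + L%:R * e).
Hypothesis HI : forall e : R, 0 < e -> exists2 C : R, 0 <= C & forall L,
  L%:R * I <= sumw L (fun w => wmass nu w * Sw phi w) + (C + L%:R * e).
Hypothesis phI : p = h + I.

(** Gibbs' inequality for the weights [exp (S w)] times the product of [th] over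
    the [k] blocks of [w]. The contributions of entropy, energy and pressure
    cancel up to an error linear in the length with arbitrarily small slope,
    since [p = h + I]; what remains is divided by [k], which tends to
    infinity. *)
Lemma block_variational m (th : seq A -> R) (lam : R) :
  (forall a, 0 < th a) -> 0 < lam ->
  (forall k, sumw (k * m) (fun w => (good c w)%:R *
     (block_prod th m k w * expR (Sw phi w))) <= lam ^+ k * Zw c phi (k * m)) ->
  sumw m (fun a => wmass nu a * ln (th a)) <= ln lam.
Proof.
move=> th0 lam0 hV; set U := sumw m _.
have bp0 k' w : 0 < block_prod th m k' w.
  by elim: k' w => //= k' IH w; rewrite mulr_gt0.
have key k : shannon nu (word_at 0 (k * m) : T -> _) +
    sumw (k * m) (fun w => wmass nu w * Sw phi w) + k%:R * U <=
    k%:R * ln lam + ln (Zw c phi (k * m)).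
  set L := (k * m)%N.
  pose q w : R := block_prod th m k w * expR (Sw phi w).
  pose V := sumw L (fun w => (good c w)%:R * q w).
  have q0 w : 0 < q w by rewrite mulr_gt0 ?expR_gt0.
  have V0 : 0 < V.
    apply: (lt_le_trans (q0 (nseq L ord0))).
    have := @sumw_ge_term R N L (fun w => (good c w)%:R * q w) (nseq L ord0) (size_nseq _ _) _.
    rewrite good_zeros ?(c0_gt0 Hc) // mul1r; apply => v _.
    by rewrite mulr_ge0 // ltW.
  have hVk : V <= lam ^+ k * Zw c phi L by exact: hV.
  have g : - sumw L (fun w => wmass nu w * ln (wmass nu w)) <=
      - sumw L (fun w => wmass nu w * ln ((good c w)%:R * q w / V)).
    rewrite !sumw_tuple; apply: (@gibbs_inequality R _ (fun t : L.-tuple A => wmass nu t)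
      (fun t : L.-tuple A => (good c t)%:R * q t / V)).
    - by move=> t; exact: wmass_ge0.
    - by move=> t; rewrite divr_ge0 ?(ltW V0) // mulr_ge0 // ltW.
    - rewrite -(sumw_tuple L (fun w => wmass nu w)) -mulr_suml.
      rewrite -(sumw_tuple L (fun w => (good c w)%:R * q w)) -/V divff ?gt_eqF //.
      by rewrite (sum_wmass nu).
    - by move=> t /nu_supp ->; rewrite mul1r divr_gt0.
  have e2 : sumw L (fun w => wmass nu w * ln ((good c w)%:R * q w / V)) =
      k%:R * U + sumw L (fun w => wmass nu w * Sw phi w) - ln V.
    rewrite /U -(sum_wmass_ln_block_prod nu_inv m k th0) sumwD.
    rewrite -[ln V]mulr1 -{2}(sum_wmass nu L) -mulNr sumwMl sumwD.
    apply: eq_sumw => w _.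
    have [->|w0] := eqVneq (wmass nu w) 0; first by rewrite !(mul0r, mulr0) !addr0.
    have wp : 0 < wmass nu w by rewrite lt_neqAle eq_sym w0 wmass_ge0.
    rewrite (nu_supp wp) mul1r ln_div ?posrE // /q lnM ?posrE ?expR_gt0 // expRK.
    by ring.
  rewrite shannon_wordE; rewrite e2 in g.
  have : ln V <= k%:R * ln lam + ln (Zw c phi L).
    rewrite mulr_natl -lnXn // -lnM ?posrE ?exprn_gt0 ?(Zw_gt0 phi Hc) //.
    by rewrite ler_ln ?posrE // mulr_gt0 ?exprn_gt0 ?(Zw_gt0 phi Hc).
  lra.
apply/ler_addgt0Pr => e e0.
(* three errors [m e'] per block must not exceed [e / 2], and [m] may be 0 *)
pose e' := e / (6 * (m%:R + 1)).
have m0 : 0 <= m%:R :> R by [].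
have e'0 : 0 < e' by rewrite divr_gt0 // mulr_gt0 //; lra.
have [C1 C10 h1] := Hh e'0; have [C2 C20 h2] := HI e'0.
have [C3 C30 h3] := Hp e'0.
pose C := C1 + C2 + C3.
pose k := (Num.trunc (C / (e / 2))).+1.
have e2 : 0 < e / 2 by rewrite divr_gt0.
have kC : C <= k%:R * (e / 2).
  by rewrite -ler_pdivrMr //; apply: ltW; exact: truncnS_gt.
have k0 : 0 < k%:R :> R by rewrite ltr0n.
have me : m%:R * e' <= e / 6.
  rewrite /e' mulrA ler_pdivrMr; last by rewrite mulr_gt0 //; lra.
  by rewrite [m%:R * e]mulrC; lra.
have := key k; have := h1 (k * m)%N; have := h2 (k * m)%N; have := h3 (k * m)%N.
rewrite ler_norml phI !natrM => /andP[_ H3] H2 H1 K.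
have H4 := ler_wpM2l (ltW k0) me.
rewrite -(ler_pM2l k0).
move: H1 H2 H3 H4 K kC; rewrite /C; set x1 := shannon _ _; set x2 := sumw _ _; set x3 := ln (Zw _ _ _).
lra.
Qed.

End variational.

(** * Bounded total oscillations *)

Section oscillations.
Variables (R : realType) (N : nat).
Implicit Types (x y : config N) (g : config N -> R).

Lemma osc_ge0 g i : (0 <= osc g i)%E.
Proof.
by apply: ereal_sup_ubound; exists point, point; split => //; rewrite subrr normr0.
Qed.

Lemma sum_osc_le g (s : seq int) : uniq s ->
  (\sum_(i <- s) osc g i <= total_osc g)%E.
Proof.
move=> us; apply: ereal_sup_ubound; exists [set` s] => /=.
  by split; [exact: finite_seq|].
by rewrite -fsbig_seq.
Qed.

Lemma bounded_oscP g : continuous g -> (total_osc g < +oo)%E ->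
  exists d D, bounded_osc g d D.
Proof.
move=> gc tfin.
have osc_fin i : osc g i \is a fin_num.
  rewrite fin_real // (lt_le_trans _ (osc_ge0 g i)) ?ltNy0 //=.
  apply: le_lt_trans tfin; have := sum_osc_le g (isT : uniq [:: i]).
  by rewrite big_seq1.
have t0 : (0 <= total_osc g)%E.
  by have := sum_osc_le g (isT : uniq [::]); rewrite big_nil.
have tf : total_osc g \is a fin_num by rewrite ge0_fin_numE.
pose d i := fine (osc g i); pose D := fine (total_osc g).
have dE s : (\sum_(i <- s) osc g i)%E = (\sum_(i <- s) d i)%:E.
  by rewrite -sumEFin; apply: eq_bigr => i _; rewrite fineK.
have dsum s : uniq s -> \sum_(i <- s) d i <= D.
  by move=> /(sum_osc_le g); rewrite dE -[total_osc g]fineK // lee_fin.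
exists d, D; split.
- by move=> i; apply: fine_ge0; exact: osc_ge0.
- move=> i x y xy; rewrite -lee_fin fineK //.
  by apply: ereal_sup_ubound; exists x, y.
- exact: dsum.
- move=> e e0; have [_ [A [finA _] <-]] := ub_ereal_sup_adherent e0 tf.
  rewrite fsbig_finite //=; set s0 : seq int := finmap.enum_fset (fset_set A).
  have us0 : uniq s0 by exact: finmap.fset_uniq.
  rewrite dE => h0; have h : D - e < \sum_(i <- s0) d i by rewrite -lte_fin EFinB /D fineK.
  pose M := (\max_(i <- s0) absz i)%N; exists M => s us sM.
  have : \sum_(i <- s0 ++ s) d i <= D.
    apply: dsum; rewrite cat_uniq us0 us andbT /=; apply/hasPn => i /sM; apply: contraTN.
    by rewrite -leqNgt => is0; exact: (@leq_bigmax_seq _ s0 xpredT absz).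
  rewrite big_cat /=; lra.
- move=> x e e0; have /cvgrPdist_le /(_ e e0) /nbhs_config[M hM] := gc x.
  by exists M => y xy; apply: hM.
Qed.

End oscillations.

(** * The pressure *)

Section pressure_limit.
Variables (R : realType) (beta : R).
Hypothesis beta_gt1 : 1 < beta.
Notation N := (top_digit beta).
Notation A := 'I_N.+1.
Notation Sg := (Sigma_beta beta).
Variables (phi g : config N -> R) (d : int -> R) (D p : R).
Hypothesis H : bounded_osc g d D.
Hypothesis g_phi : forall x, Sg x -> g x = phi x.
Hypothesis Hp : forall e : R, 0 < e -> exists2 C : R, 0 <= C &
  forall n, `|ln (Zw (cdig beta) g n) - n%:R * p| <= C + n%:R * e.
Variable E : nat -> set (config N).
Hypothesis E_transversal : word_transversal Sg E.

Lemma birk_shifted n (x : config N) : Sg x ->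
  \sum_(j < 2 * n + 1) phi (tshift (j%:Z - n%:Z) x) =
  birk g (2 * n + 1) (tshift (- n%:Z) x).
Proof.
move=> Sx; apply: eq_bigr => j _; rewrite -g_phi; last exact: Sigma_tshift.
by congr g; apply/funext => i; rewrite /tshift; congr x; lia.
Qed.

(** The sum over the transversal is a sum over admissible words, each weighted
    with the energy read in its representative; by [birk_local] the choice of the
    representative is immaterial. *)
Lemma pressureE : pressure E phi = p.
Proof.
have c0 := c0_gt0 (expansion_cdig beta_gt1).
apply/cvg_lim => //.
apply: (@cvg_of_rate R _ (fun n => 2 * n + 1)%N); first by lia.
move=> e e0; have e2 : 0 < e / 2 by rewrite divr_gt0.
have [C1 C10 h1] := Hp e2; have [C2 C20 h2] := birk_local H e2.
exists (C1 + C2); first exact: addr_ge0.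
move=> n; set L := (2 * n + 1)%N.
have [ES fbij] := E_transversal n.
have gbij := bijpinv_bij (fun=> point) fbij; set h := (X in set_bij _ _ X) in gbij.
pose F x := expR (\sum_(j < L) phi (tshift (j%:Z - n%:Z) x)).
have langE : language Sg L = [set` (fun t : L.-tuple (letter N) => good (cdig beta) (t : L.-tuple A))].
  by apply/seteqP; split=> t /languageP; exact.
have sumE : \sum_(x \in E n) F x =
    \sum_(t : L.-tuple (letter N) | good (cdig beta) (t : L.-tuple A)) F (h t).
  rewrite (reindex_fsbig h _ _ _ gbij) langE -(@bigfs _ _ _ _ (index_enum _)) //.
    exact: index_enum_uniq.
  by move=> t _; rewrite mem_index_enum.
have Eh (t : L.-tuple (letter N)) : good (cdig beta) (t : L.-tuple A) ->
    Sg (h t) /\ wordc 0 L (tshift (- n%:Z) (h t)) = t.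
  move=> gt; have lt : language Sg L t by rewrite langE.
  have Et : E n (h t) by case: gbij => hh _ _; exact: hh.
  split; first exact: ES.
  rewrite wordc_tshift add0r.
  have e1 : word_at (- n%:Z) L (h t) = t.
    by rewrite /h pinvK // inE; case: fbij => _ _ surj; have [x Ex <-] := surj _ lt; exists x.
  by move/word_atP: e1.
have Fb (t : L.-tuple (letter N)) : good (cdig beta) (t : L.-tuple A) ->
    F (h t) <= expR (Sw g (t : L.-tuple A)) * expR (C2 + L%:R * (e / 2)) /\
    expR (Sw g (t : L.-tuple A)) <= F (h t) * expR (C2 + L%:R * (e / 2)).
  move=> /Eh[Sh wh]; rewrite /F birk_shifted // -!expRD !ler_expR.
  have we : wordc 0 L (emb (t : L.-tuple A)) = t.
    by rewrite -{1}(size_tuple t) wordc_emb.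
  have := h2 L _ _ (etrans wh (esym we)); have := h2 L _ _ (etrans we (esym wh)).
  rewrite /Sw size_tuple; lra.
have ZE : Zw (cdig beta) g L =
    \sum_(t : L.-tuple (letter N) | good (cdig beta) (t : L.-tuple A)) expR (Sw g (t : L.-tuple A)).
  rewrite /Zw sumw_tuple [RHS]big_mkcond /=; apply: eq_bigr => t _.
  by case: (good _ _); rewrite ?mul1r ?mul0r.
have Z0 := Zw_gt0 g (expansion_cdig beta_gt1) L.
set V := \sum_(x \in E n) _; have VE : V = \sum_(x \in E n) F x by [].
have V1 : V <= Zw (cdig beta) g L * expR (C2 + L%:R * (e / 2)).
  by rewrite VE sumE ZE mulr_suml; apply: ler_sum => t /Fb[].
have V2 : Zw (cdig beta) g L <= V * expR (C2 + L%:R * (e / 2)).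
  by rewrite VE sumE ZE mulr_suml; apply: ler_sum => t /Fb[].
have V0 : 0 < V.
  by have := lt_le_trans Z0 V2; rewrite pmulr_lgt0 // expR_gt0.
have l1 : ln V <= ln (Zw (cdig beta) g L) + (C2 + L%:R * (e / 2)).
  rewrite -[X in _ + X]expRK -lnM ?posrE ?expR_gt0 //.
  by rewrite ler_ln ?posrE // mulr_gt0 ?expR_gt0.
have l2 : ln (Zw (cdig beta) g L) <= ln V + (C2 + L%:R * (e / 2)).
  rewrite -[X in _ + X]expRK -lnM ?posrE ?expR_gt0 //.
  by rewrite ler_ln ?posrE // mulr_gt0 ?expR_gt0.
have := h1 L; rewrite !ler_norml; lra.
Qed.

End pressure_limit.

(** * Integrals of Birkhoff sums *)

Section bounded_measurable.
Variables (R : realType) (d : measure_display) (T : measurableType d).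
Variable nu : probability T R.

Definition bounded_meas (g : T -> R) :=
  measurable_fun setT g /\ exists B, forall x, `|g x| <= B.

Lemma bounded_meas_integrable (g : T -> R) : bounded_meas g ->
  nu.-integrable setT (EFin \o g).
Proof.
move=> [mg [B gB]]; apply: measurable_bounded_integrable => //.
  by rewrite ltey_eq fin_num_measure.
exists B; split; first exact: num_real.
by move=> M BM x _; exact: le_trans (gB x) (ltW BM).
Qed.

Lemma bounded_meas_sum (I : Type) (s : seq I) (F : I -> T -> R) :
  (forall i, bounded_meas (F i)) -> bounded_meas (fun x => \sum_(i <- s) F i x).
Proof.
move=> h; split; first by apply: measurable_sum => i; case: (h i).
elim: s => [|i s [B hB]]; first by exists 0 => x; rewrite big_nil normr0.
have [_ [B' hB']] := h i; exists (B' + B) => x; rewrite big_cons.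
by rewrite (le_trans (ler_normD _ _)) // lerD.
Qed.

Lemma mean_sum (I : Type) (s : seq I) (F : I -> T -> R) :
  (forall i, bounded_meas (F i)) ->
  \int[nu]_x (\sum_(i <- s) F i x) = \sum_(i <- s) \int[nu]_x (F i x).
Proof.
move=> h; elim: s => [|i s IH].
  rewrite big_nil (_ : (fun x => _) = fun=> 0); last by apply/funext => x; rewrite big_nil.
  by rewrite Rintegral_cst // mul0r.
rewrite big_cons -IH -RintegralD //; [|exact: bounded_meas_integrable|].
  by apply: eq_Rintegral => x _; rewrite big_cons.
by apply: bounded_meas_integrable; exact: bounded_meas_sum.
Qed.

Lemma mean_invariant (f : T -> T) (g : T -> R) : measurable_fun setT f ->
  (forall B : set T, measurable B -> nu (f @^-1` B) = nu B) ->
  bounded_meas g -> \int[nu]_x g (f x) = \int[nu]_x g x.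
Proof.
move=> mf nu_inv bg; have [mg [B hB]] := bg.
have mEg : measurable_fun setT (EFin \o g) by exact/measurable_EFinP.
rewrite /Rintegral; congr fine.
rewrite -[LHS]/(\int[nu]_(x in f @^-1` setT) ((EFin \o g) \o f) x)%E.
rewrite -(integral_pushforward mf) //.
  by apply: eq_measure_integral => C mC _; exact: nu_inv.
rewrite preimage_setT; apply: (@bounded_meas_integrable (g \o f)).
split; last by exists B => x; exact: hB.
exact: measurableT_comp.
Qed.

End bounded_measurable.

Section integrals.
Variables (R : realType) (N : nat).
Notation A := 'I_N.+1.
Notation T := (borel_config N).
Variable nu : probability T R.
Notation f := (tshift 1 : T -> T).
Hypothesis nu_inv : forall B : set T, measurable B -> nu (f @^-1` B) = nu B.
Variables (phi : config N -> R) (d : int -> R) (D : R).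
Hypothesis H : bounded_osc phi d D.
Hypothesis phi_cont : continuous phi.

Lemma bounded_meas_birk_term j : bounded_meas (fun x : T => phi (tshift j x)).
Proof.
split.
  by apply: (measurableT_comp (measurable_continuous phi_cont)); exact: measurable_tshift.
exists (`|phi point| + D) => x.
rewrite -[phi (tshift j x)](subrK (phi point)) addrC.
by rewrite (le_trans (ler_normD _ _)) // lerD2l (phi_bound H).
Qed.

Lemma mean_birk_term (j : nat) :
  \int[nu]_x phi (tshift j%:Z x) = \int[nu]_x phi x.
Proof.
elim: j => [|j IH].
  by apply: eq_Rintegral => x _; congr phi; apply/funext => i; rewrite /tshift addr0.
rewrite -IH -(mean_invariant (measurable_tshift 1) nu_inv (bounded_meas_birk_term j%:Z)).
apply: eq_Rintegral => x _; congr phi; apply/funext => i; rewrite /tshift.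
by congr x; lia.
Qed.

(** By invariance the integral is the mean of the Birkhoff averages, and these
    depend on the word read only, up to the usual error. *)
Lemma mean_le_words (e : R) : 0 < e -> exists2 C : R, 0 <= C & forall L,
  L%:R * (\int[nu]_x phi x) <=
  sumw L (fun w => wmass nu w * Sw phi w) + (C + L%:R * e).
Proof.
move=> e0; have [C C0 hC] := birk_local H e0; exists C => // L.
pose B (t : L.-tuple A) : set T := (word_at 0 L : T -> _) @^-1` [set t].
have mB t : measurable (B t) by exact: finite_meas_word.
pose v (t : L.-tuple A) : R := Sw phi t + (C + L%:R * e).
have bB t : bounded_meas (fun x : T => v t * \1_(B t) x).
  split; first by apply: measurable_funM => //; exact: measurable_indic.
  exists `|v t| => x; rewrite normrM ler_piMr // indicE.
  by case: (x \in _); rewrite ?normr1 ?normr0.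
have -> : L%:R * (\int[nu]_x phi x) = \int[nu]_x (birk phi L x).
  rewrite /birk (mean_sum nu (index_enum _) (fun j => bounded_meas_birk_term (nat_of_ord j)%:Z)).
  rewrite (eq_bigr (fun _ => \int[nu]_x phi x)); last by move=> j _; exact: mean_birk_term.
  by rewrite sumr_const card_ord mulr_natl.
apply: (@le_trans _ _ (\int[nu]_x (\sum_(t : L.-tuple A) v t * \1_(B t) x))).
  apply: le_Rintegral => //.
  - apply: bounded_meas_integrable; rewrite /birk.
    by apply: bounded_meas_sum => j; exact: bounded_meas_birk_term.
  - by apply: bounded_meas_integrable; exact: bounded_meas_sum.
  - move=> x _; rewrite (bigD1 (word_at 0 L x)) //= big1 ?addr0 => [|t tx].
      rewrite indicE mem_set // mulr1 /v -lerBlDl /Sw size_tuple.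
      by apply: hC; rewrite val_word_at -{2}(size_wordc 0 L x) wordc_emb.
    by rewrite indicE memNset ?mulr0 // => h; case/eqP: tx.
rewrite (mean_sum nu (index_enum _) bB) sumw_tuple.
have mass t : \int[nu]_x (v t * \1_(B t) x) = wmass nu t * v t.
  rewrite RintegralZl //; last first.
    apply: bounded_meas_integrable; split; first exact: measurable_indic.
    by exists 1 => x; rewrite indicE; case: (x \in _); rewrite ?normr1 ?normr0.
  by rewrite /Rintegral integral_indic // setIT mulrC -wmass_tuple.
rewrite (eq_bigr _ (fun t _ => mass t)) /v.
under eq_bigr do rewrite mulrDr.
rewrite big_split /= -mulr_suml -(sumw_tuple L (fun w => wmass nu w)).
by rewrite (sum_wmass nu) mul1r.
Qed.

End integrals.

(** * Weak Gibbs measures *)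

Lemma limn_esup_gt0 (R : realType) (u : nat -> R) :
  (0 < limn_esup (fun n => (u n)%:E))%E ->
  exists2 a : R, 0 < a & forall n0, exists2 n, (n0 <= n)%N & a <= u n.
Proof.
move=> h; apply: contrapT => nh; move: h; rewrite ltNge => /negP; apply.
apply/lee_addgt0Pr => a a0; rewrite add0e.
have [n0 hn0] : exists n0, forall n, (n0 <= n)%N -> u n <= a.
  apply: contrapT => h; apply: nh; exists a => // n0; apply: contrapT => h2.
  apply: h; exists n0 => n nn; rewrite leNgt; apply/negP => un.
  by apply: h2; exists n => //; exact: ltW.
apply: (@le_trans _ _ (ereal_sup [set (u n)%:E | n in [set n | (n0 <= n)%N]])).
  by apply: ereal_inf_lbound; exists [set n | (n0 <= n)%N] => //; exists n0.
by apply: ge_ereal_sup => _ [n /= nn <-]; rewrite lee_fin hn0.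
Qed.

Section gibbs.
Variables (R : realType) (beta : R).
Hypothesis beta_gt1 : 1 < beta.
Notation N := (top_digit beta).
Notation A := 'I_N.+1.
Notation T := (borel_config N).
Notation Sg := (Sigma_beta beta).
Notation c := (cdig beta).
Notation f := (tshift 1 : T -> T).
Variable nu : probability T R.
Hypothesis nu_on : invariant_on Sg nu.
Implicit Types (x : config N) (w : seq A).

Let nu_inv : forall B : set T, measurable B -> nu (f @^-1` B) = nu B.
Proof. exact: nu_on.2. Qed.

Let Hc := expansion_cdig beta_gt1.

Lemma pr_Sigma_inter (B : set T) : measurable B ->
  pr nu (Sg `&` B) = pr nu B.
Proof.
move=> mB; apply: pr_full_inter => //; first exact: measurable_Sigma.
by rewrite /pr nu_on.1.
Qed.

Lemma cylinderE x m :
  cylinder Sg x m = (Sg : set T) `&` [set y : T | wordc 0 m y = wordc 0 m x].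
Proof.
apply/seteqP; split=> y [Sy]; rewrite /= => h; split => //.
  by move/word_atP: h; rewrite val_word_at.
by apply/word_atP; rewrite val_word_at.
Qed.

Lemma nu_cylinder x m : nu (cylinder Sg x m) = (wmass nu (wordc 0 m x))%:E.
Proof.
have mW := measurable_wordc (N := N) 0 m (wordc 0 m x).
have mC : measurable (cylinder Sg x m : set T).
  by rewrite cylinderE; apply: measurableI => //; exact: measurable_Sigma.
rewrite /wmass size_wordc -(pr_Sigma_inter mW) -cylinderE /pr fineK //.
exact: fin_num_measure.
Qed.

Lemma wmass_good w : 0 < wmass nu w -> good c w.
Proof.
move=> w0; apply: contrapT => nw; move: w0.
rewrite /wmass -(pr_Sigma_inter (measurable_wordc 0 (size w) w)).
rewrite (_ : _ `&` _ = set0) ?/pr ?measure0 ?ltxx //.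
rewrite -subset0 => x [/(SigmaP beta_gt1) h /= e]; apply: nw; rewrite -e; exact: h.
Qed.

(** A cylinder of mass zero makes the supremum infinite, so the condition can be
    stated with real logarithms of positive masses. *)
Lemma weak_GibbsP (psi : config N -> R) : weak_Gibbs Sg psi nu <->
  forall e : R, 0 < e -> exists Nd : nat, forall m x, (Nd <= m)%N -> (0 < m)%N ->
    Sg x -> 0 < wmass nu (wordc 0 m x) /\
    `|ln (wmass nu (wordc 0 m x)) - birk psi m x| <= m%:R * e.
Proof.
split=> [[_ h] e e0|h].
  have [Nd hN] := h e e0; exists Nd => m x Nm m0 Sx.
  have m0R : 0 < m%:R :> R by rewrite ltr0n.
  have := hN m Nm; set S := ereal_sup _ => hS.
  have : (`|(m%:R^-1)%:E * lne (nu (cylinder Sg x m)) -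
     (m%:R^-1 * \sum_(l < m) psi (tshift l%:Z x))%:E| <= e%:E)%E.
    by apply: le_trans hS; apply: ereal_sup_ubound; exists x.
  rewrite nu_cylinder; set q := wmass nu _.
  have q0 : 0 <= q by exact: wmass_ge0.
  have [->|qn0] := eqVneq q 0.
    by rewrite le0_lneNy // mulrNy gtr0_sg ?invr_gt0 // mul1e.
  have qp : 0 < q by rewrite lt_neqAle eq_sym qn0 q0.
  rewrite lne_EFin // -EFinM -EFinB /= lee_fin => h1; split => //.
  move: h1; rewrite -mulrBr normrM gtr0_norm ?invr_gt0 //.
  by rewrite mulrC ler_pdivrMr // mulrC.
split=> // e e0; have [Nd hN] := h e e0; exists Nd.+1 => m Nm.
apply: ge_ereal_sup => _ [x Sx <-].
have m0 : (0 < m)%N by exact: leq_trans Nm.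
have m0R : 0 < m%:R :> R by rewrite ltr0n.
have [q0 hq] := hN m x (ltnW Nm) m0 Sx.
rewrite nu_cylinder lne_EFin // -EFinM -EFinB /= lee_fin -mulrBr normrM.
by rewrite gtr0_norm ?invr_gt0 // mulrC ler_pdivrMr // mulrC.
Qed.

End gibbs.

(** * The two parts of the theorem *)

Section parts.
Variables (R : realType) (beta : R).
Hypothesis beta_gt1 : 1 < beta.
Notation N := (top_digit beta).
Notation A := 'I_N.+1.
Notation T := (borel_config N).
Notation Sg := (Sigma_beta beta).
Notation c := (cdig beta).
Notation f := (tshift 1 : T -> T).
Variables (phi g : config N -> R) (d : int -> R) (D p : R).
Hypothesis H : bounded_osc g d D.
Hypothesis g_phi : forall x, Sg x -> g x = phi x.
Hypothesis Hp : forall e : R, 0 < e -> exists2 C : R, 0 <= C &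
  forall n, `|ln (Zw c g n) - n%:R * p| <= C + n%:R * e.
Variable nu : probability T R.
Hypothesis nu_on : invariant_on Sg nu.
Implicit Types (x : config N) (w : seq A).
Notation zeros n := (nseq n (ord0 : A)).
Notation phi0 := (g (emb [::])).
Notation psi := (fun x => phi x - p).
Notation cpre := (cword N c 0).

Let Hc : expansion N c := expansion_cdig beta_gt1.

Lemma birk_psi m x : Sg x -> birk psi m x = birk g m x - m%:R * p.
Proof.
move=> Sx; rewrite /birk sumrB sumr_const card_ord mulr_natl; congr (_ - _).
by apply: eq_bigr => j _; rewrite g_phi //; exact: Sigma_tshift.
Qed.

(** The energy gap for the words of zeros. *)
Lemma zero_below_pressure : phi0 < p.
Proof.
have [kap kap0 [C C0 hC]] := energy_gap Hc H.
have k2 : 0 < kap / 2 by rewrite divr_gt0.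
have [C' C'0 hC'] := Hp k2.
rewrite ltNge; apply/negP => pphi.
pose n := (Num.trunc ((C + C') / (kap / 2))).+1.
have hn : C + C' < n%:R * (kap / 2) by rewrite -ltr_pdivrMr // truncnS_gt.
have := hC (zeros n) (good_zeros _ (c0_gt0 Hc) n); have := hC' n.
rewrite size_nseq Sw_zeros ler_norml.
have n0 : 0 <= n%:R :> R by [].
have := ler_wpM2l n0 pphi; lra.
Qed.

Lemma wle_catr w v i : wle c (w ++ v) i -> w = cword N c i (size w) ->
  wle c v (i + size w).
Proof.
elim: w i => [|a w IH] i /=; first by rewrite addn0.
move=> h [aE wE]; have ai : nat_of_ord a = c i.
  by rewrite aE inordK // ltnS; exact: (c_leN Hc).
by move: h; rewrite ai ltnn eqxx /= addnS -addSn => /IH; apply.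
Qed.

Lemma wle_zeros v i : (forall j, (j < size v)%N -> c (i + j) = 0%N) ->
  wle c v i -> v = zeros (size v).
Proof.
elim: v i => //= a v IH i h.
have ci : c i = 0%N by rewrite -(h 0%N) ?addn0.
rewrite ci ltn0 /= => /andP[/eqP a0 hv].
have -> : a = ord0 by apply: val_inj.
by rewrite {1}(IH i.+1) // => j jv; rewrite addSnnS; apply: h.
Qed.

(** A prefix of the expansion that is followed by zeros forces those zeros, so
    its cylinder does not shrink while the zeros are read; but each of them
    lowers the Birkhoff sum of [psi] by about [p - phi 0]. *)
Lemma not_weak_Gibbs :
  (0 < limn_esup (fun n : nat => ((zbar beta n)%:R / n%:R : R)%:E))%E ->
  ~ weak_Gibbs Sg psi nu.
Proof.
move=> /limn_esup_gt0[a a0 ha] /(weak_GibbsP beta_gt1 nu_on) hG.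
have kap0 : 0 < p - phi0 by rewrite subr_gt0 zero_below_pressure.
set kap := p - phi0 in kap0.
(* With [z >= a l], the two Gibbs estimates and [birk_local] together give
   [z kap <= (2 l + 2 z) e + C <= z (2 / a + 2) e + C]. *)
pose e := kap / (2 * (2 / a + 2)).
have a2 : 0 < 2 / a by rewrite divr_gt0.
have e0 : 0 < e by rewrite divr_gt0 // mulr_gt0 //; lra.
have [Nd hN] := hG e e0; have [C C0 hC] := birk_local H e0.
pose B := Num.max (zbar beta Nd)%:R (2 * C / kap).
have [n nB an] := ha (Num.trunc (B / a)).+2.
have n0 : 0 < n%:R :> R by rewrite ltr0n; exact: leq_trans nB.
have nB' : B < n%:R * a.
  rewrite -ltr_pdivrMr //; apply: lt_le_trans (truncnS_gt _) _.
  by rewrite ler_nat ltnW.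
have {an} an : n%:R * a <= (zbar beta n)%:R by rewrite mulrC -ler_pdivlMr.
have [l l_le_n zE] : exists2 l, (l <= n)%N & zbar beta n = zbeta beta l.
  have [|i hi] := @bigop.eq_bigmax _ (fun i : 'I_n.+1 => zbeta beta i); first by rewrite card_ord.
  by exists i; [rewrite -ltnS|rewrite /zbar hi].
set z := zbeta beta l in zE.
have zB : B < z%:R by rewrite -zE; exact: lt_le_trans nB' an.
have NdL : (Nd < l)%N.
  rewrite ltnNge; apply/negP => lN.
  have : z%:R <= (zbar beta Nd)%:R :> R by rewrite ler_nat; exact: zbeta_le_zbar.
  by rewrite leNgt (le_lt_trans _ zB) // le_max lexx.
have l0 : (0 < l)%N by exact: leq_ltn_trans NdL.
have [hz _] := zbeta_spec beta_gt1 l; rewrite -/z in hz.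
pose w := cpre (l + z); pose x := emb w.
have gw : good c w by exact: good_cword.
have Sx : Sg x by exact: Sigma_emb.
have xw : wordc 0 (l + z) x = w by rewrite -{1}(size_cword N c 0 (l + z)) wordc_emb.
have wE : w = cpre l ++ zeros z.
  rewrite /w cword_cat add0n; congr (_ ++ _).
  rewrite -[in RHS](size_cword N c l z).
  apply: (@wle_zeros _ l) => [j|]; first by rewrite size_cword; exact: hz.
  exact: wle_cword_tail.
have xl : wordc 0 l x = cpre l.
  move: xw; rewrite wordc_cat wE => /eqP.
  by rewrite eqseq_cat ?size_wordc ?size_cword // => /andP[/eqP].
have eqm : wmass nu (wordc 0 l x) = wmass nu (wordc 0 (l + z) x).
  apply: EFin_inj; rewrite -!(nu_cylinder beta_gt1 nu_on) //; congr (nu _).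
  rewrite !cylinderE; apply/seteqP; split=> y [Sy /= hy]; split => //=; last first.
    move: hy; rewrite !wordc_cat => /eqP.
    by rewrite eqseq_cat ?size_wordc // => /andP[/eqP].
  have /(SigmaP beta_gt1) /(_ 0 (l + z)%N) := Sy.
  rewrite wordc_cat hy xl xw wE; set v := wordc _ z y => gv.
  have sv : size v = z by rewrite size_wordc.
  congr (_ ++ _); rewrite -[in RHS]sv; apply: (@wle_zeros _ l).
    by move=> j; rewrite sv; exact: hz.
  have : wle c (cpre l ++ v) 0 by move: gv; case: (_ ++ _) => //= ? ? /andP[].
  by move=> /wle_catr; rewrite size_cword add0n; exact.
have [_ h1] := hN l x (ltnW NdL) l0 Sx.
have [_ h2] := hN (l + z)%N x (leq_trans (ltnW NdL) (leq_addr _ _))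
  (leq_trans l0 (leq_addr _ _)) Sx.
rewrite -eqm in h2.
move: h1 h2; rewrite !birk_psi // birk_cat !natrD.
have hz1 : wordc 0 z (tshift l%:Z x) = wordc 0 z (emb (zeros z)).
  rewrite wordc_tshift -{2}(size_nseq z (ord0 : A)) wordc_emb.
  move: xw; rewrite wordc_cat wE => /eqP.
  by rewrite eqseq_cat ?size_wordc ?size_cword // => /andP[_ /eqP].
have := hC z _ _ hz1; have := hC z _ _ (esym hz1).
have := Sw_zeros g z; rewrite /Sw size_nseq => ->.
have lz : l%:R <= z%:R / a.
  by rewrite ler_pdivlMr // -zE; apply: le_trans an; rewrite ler_pM2r // ler_nat.
have eE : z%:R * e * (2 / a + 2) = z%:R * kap / 2.
  by rewrite /e; field; rewrite !gt_eqF //; lra.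
have zC : 2 * C < z%:R * kap.
  rewrite -ltr_pdivrMr //; apply: le_lt_trans zB; by rewrite le_max lexx orbT.
have := ler_wpM2r (ltW e0) lz; rewrite !ler_norml.
have -> : z%:R / a * e = z%:R * e / a by rewrite mulrAC.
move: eE zC; rewrite mulrDr.
have -> : z%:R * e * (2 / a) = 2 * (z%:R * e / a) by ring.
rewrite /kap; set za := z%:R * e / a; lra.
Qed.

Variables (h : R).
Hypothesis h_entropy : metric_entropy nu f = h%:E.
Hypothesis g_cont : continuous g.
Hypothesis h_eq : p = h + \int[nu]_x g x.

Let variational := block_variational Hc Hp nu_on.2 (wmass_good beta_gt1 nu_on)
  (entropy_rate nu_on.2 h_entropy) (mean_le_words nu_on.2 H g_cont) h_eq.

(** The weight [th] is [exp 1] on [w] and 1 elsewhere, so the mean of [ln th] is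
    the mass of [w]. *)
Lemma wmass_upper (e : R) : 0 < e -> exists C : R, forall w, 0 < wmass nu w ->
  ln (wmass nu w) <= Sw g w - (size w)%:R * p + (C + (size w)%:R * e).
Proof.
move=> /(block_upper Hc H Hp)[C C0 hC].
pose t : R := expR 1 - 1.
have t0 : 0 < t by rewrite subr_gt0 -[X in X < _]expR0 ltr_expR.
exists (ln (t * C)) => w w0; set m := size w.
pose Q := C * expR (Sw g w - m%:R * p + m%:R * e).
have Q0 : 0 < Q by rewrite mulr_gt0 ?expR_gt0.
pose th (a : seq A) : R := 1 + t * (a == w)%:R.
have th0 a : 0 < th a by rewrite ltr_wpDr // mulr_ge0 // ltW.
have lam0 : 0 < 1 + t * Q by rewrite addr_gt0 // mulr_gt0.
have hlam k : sumw (k * m) (fun v => (good c v)%:R *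
    (block_prod th m k v * expR (Sw g v))) <= (1 + t * Q) ^+ k * Zw c g (k * m).
  apply: sum_block_prod_le => [a||j k' G G0]; [exact: ltW|exact: ltW|].
  rewrite (block_sumD c g j m k' (fun a => (a == w)%:R) (fun _ => 1) G t).
  rewrite [leRHS]mulrDl mul1r lerD2l -mulrA ler_wpM2l ?(ltW t0) //.
  exact: hC.
have := variational th0 lam0 hlam.
rewrite (eq_sumw (G := fun a => (a == w)%:R * wmass nu a)); last first.
  move=> a _; rewrite /th; case: eqP => _; last by rewrite mulr0 addr0 ln1 mulr0 mul0r.
  by rewrite mulr1 /t addrC subrK expRK mulr1 mul1r.
rewrite sumw_pick // => h1.
have h2 : wmass nu w <= t * Q.
  apply: (le_trans h1); apply: le_ln1Dx.
  by apply: lt_trans (mulr_gt0 t0 Q0); rewrite oppr_lt0.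
have : ln (wmass nu w) <= ln (t * Q) by rewrite ler_ln ?posrE ?(mulr_gt0 t0 Q0).
rewrite /Q mulrA lnM ?posrE ?mulr_gt0 ?expR_gt0 // expRK; lra.
Qed.

(** The weight [th] is [exp (-1)] on [w] and 1 elsewhere. *)
Lemma wmass_lower (e : R) : 0 < e -> exists C : R, forall w, free c w ->
  0 < wmass nu w /\
  Sw g w - (size w)%:R * p - (C + (size w)%:R * e) <= ln (wmass nu w).
Proof.
move=> e0; have [C C0 hC] := block_lower Hc H Hp e0.
have [C' C'0 hC'] := Hp e0.
pose s : R := 1 - expR (-1).
have s1 : expR (-1) < 1 :> R by rewrite expR_lt1 oppr_lt0.
have s0 : 0 < s by rewrite subr_gt0.
have e10 : 0 < expR (-1) :> R by exact: expR_gt0.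
(* the summand [expR C'] ensures that [Q >= 1], whence [1 - s / Q > 0] *)
pose K := C + expR C'; have K0 : 0 < K by rewrite addr_gt0 ?expR_gt0.
exists (ln K - ln s) => w fw; set m := size w.
pose E := m%:R * p - Sw g w + m%:R * e.
pose Q := K * expR E.
have Q1 : 1 <= Q.
  have : Sw g w <= m%:R * p + (C' + m%:R * e).
    have h1 : Sw g w <= ln (Zw c g m).
      rewrite -[Sw g w]expRK ler_ln ?posrE ?expR_gt0 ?(Zw_gt0 g Hc) //.
      by apply: Zw_ge => //; exact: free_good.
    by have := hC' m; rewrite ler_norml; lra.
  move=> hS; apply: (@le_trans _ _ (expR C' * expR E)); last first.
    by rewrite ler_wpM2r ?expR_ge0 // lerDr ltW.
  by rewrite -expRD -expR0 ler_expR /E; lra.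
have Q0 : 0 < Q by exact: lt_le_trans Q1.
pose th (a : seq A) : R := 1 + - s * (a == w)%:R.
have th0 a : 0 < th a.
  by rewrite /th /s; case: eqP => _; rewrite ?mulr1 ?mulr0; lra.
have sQ : s / Q <= s by rewrite ler_pdivrMr // ler_peMr // ltW.
have lam0 : 0 < 1 - s / Q by rewrite /s in sQ *; lra.
have hlam k : sumw (k * m) (fun v => (good c v)%:R *
    (block_prod th m k v * expR (Sw g v))) <= (1 - s / Q) ^+ k * Zw c g (k * m).
  apply: sum_block_prod_le => [a||j k' G G0]; [exact: ltW|exact: ltW|].
  rewrite (block_sumD c g j m k' (fun a => (a == w)%:R) (fun _ => 1) G (- s)).
  rewrite [leRHS]mulrBl mul1r mulNr lerD2l lerN2 -mulrA ler_wpM2l ?(ltW s0) //.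
  rewrite mulrC ler_pdivrMr // mulrC.
  apply: (le_trans (hC j m k' w G erefl fw G0)).
  rewrite ler_wpM2r ?block_sum_ge0 // /Q ler_wpM2r ?expR_ge0 // lerDl expR_ge0 //.
have := variational th0 lam0 hlam.
rewrite (eq_sumw (G := fun a => (a == w)%:R * (- wmass nu a))); last first.
  move=> a _; rewrite /th; case: eqP => _; last by rewrite mulr0 addr0 ln1 mulr0 mul0r.
  rewrite mulr1 mul1r (_ : 1 - s = expR (-1)); last by rewrite /s opprB addrC subrK.
  by rewrite expRK mulrN1.
rewrite sumw_pick // => h1.
have h2 : s / Q <= wmass nu w.
  rewrite -lerN2; apply: (le_trans h1); apply: le_ln1Dx.
  by rewrite /s in sQ *; lra.
have sQ0 : 0 < s / Q by rewrite divr_gt0.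
have w0 := lt_le_trans sQ0 h2; split => //.
have : ln (s / Q) <= ln (wmass nu w) by rewrite ler_ln ?posrE.
rewrite ln_div ?posrE // /Q lnM ?posrE ?expR_gt0 // expRK /E; lra.
Qed.

(** The mass of [w] is at least that of [w] followed by enough zeros to make it
    free; the hypothesis makes these zeros few, so that they hardly change the
    energy. *)
Lemma is_weak_Gibbs :
  ((zbar beta n)%:R / n%:R : R) @[n --> \oo] --> (0 : R) ->
  weak_Gibbs Sg psi nu.
Proof.
move=> hz; apply/(weak_GibbsP beta_gt1 nu_on) => e e0.
pose e1 := e / 16; have e10 : 0 < e1 by rewrite divr_gt0.
pose B := `|p| + `|phi0| + 2 * e1.
have B0 : 0 < B by rewrite ltr_wpDl ?addr_ge0 // mulr_gt0.
have [C1 h1] := wmass_upper e10; have [C2 h2] := wmass_lower e10.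
have [C3 C30 h3] := Sw_cat H e10; have [C4 C40 h4] := birk_local H e10.
have eB : 0 < e1 / B by rewrite divr_gt0.
have [n0 hn0] : exists n0, forall n, (n0 <= n)%N -> (zbar beta n)%:R <= n%:R * (e1 / B).
  have /cvgrPdist_le /(_ _ eB) [n0 _ hn] := hz; exists n0.+1 => n nn.
  have nR : 0 < n%:R :> R by rewrite ltr0n (leq_trans _ nn).
  have := hn n (ltnW nn); rewrite /= sub0r normrN ger0_norm ?divr_ge0 //.
  by rewrite ler_pdivrMr // mulrC.
pose C := `|C1| + `|C2| + C3 + C4 + B.
have C0 : 0 <= C by rewrite !addr_ge0 // mulr_ge0 // ltW.
have e2 : 0 < e / 2 by rewrite divr_gt0.
exists (maxn n0 (Num.trunc (C / (e / 2))).+1) => m x.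
rewrite geq_max => /andP[nm mC] m0 Sx.
have Ce : C <= m%:R * (e / 2).
  rewrite -ler_pdivrMr //; apply: ltW; apply: lt_le_trans (truncnS_gt _) _.
  by rewrite ler_nat.
set w := wordc 0 m x; have sw : size w = m by exact: size_wordc.
have gw : good c w by exact: (SigmaP beta_gt1 x).1.
have xw : wordc 0 m x = wordc 0 m (emb w) by rewrite -{2}sw wordc_emb.
have b1 := h4 m _ _ xw; have b2 := h4 m _ _ (esym xw).
have SwE : Sw g w = birk g m (emb w) by rewrite /Sw sw.
pose gz := (zbar beta m).+1.
have fw : free c (w ++ zeros gz) by apply: free_cat_zeros => //; rewrite sw.
have [w0 l1] := h2 _ fw.
have sub : wmass nu (w ++ zeros gz) <= wmass nu w.
  apply: le_pr; [exact: measurable_wordc|exact: measurable_wordc|].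
  move=> y /=; rewrite size_cat wordc_cat => /eqP.
  by rewrite eqseq_cat ?size_wordc // => /andP[/eqP].
have wp : 0 < wmass nu w by exact: lt_le_trans sub.
split => //; rewrite birk_psi //.
have l2 : ln (wmass nu (w ++ zeros gz)) <= ln (wmass nu w) by rewrite ler_ln ?posrE.
have u1 := h1 w wp.
have := h3 w (zeros gz); rewrite Sw_zeros.
rewrite !size_cat size_nseq sw in l1 u1 *.
rewrite !natrD in l1 *; rewrite !ler_norml => /andP[h5 h6].
have zm : gz%:R * B <= m%:R * e1 + B.
  rewrite /gz -natr1 mulrDl mul1r lerD2r -ler_pdivlMr // -mulrA.
  exact: hn0.
have gz0 : 0 <= gz%:R :> R by [].
have n1 : - phi0 <= `|phi0| by rewrite -normrN ler_norm.
have n2 : p <= `|p| by exact: ler_norm.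
have n3 := ler_wpM2l gz0 n1; have n4 := ler_wpM2l gz0 n2.
have n5 : C1 <= `|C1| := ler_norm _; have n6 : C2 <= `|C2| := ler_norm _.
have n7 : 0 <= `|C1| by []. have n8 : 0 <= `|C2| by [].
rewrite /B !mulrDr in zm; rewrite /C /B in Ce.
have eE : m%:R * e = 16 * (m%:R * e1) by rewrite /e1; field.
have me0 : 0 <= m%:R * e1 by rewrite mulr_ge0 // ltW.
have eE2 : m%:R * (e / 2) = 8 * (m%:R * e1) by rewrite /e1; field.
rewrite eE2 in Ce; rewrite eE.
rewrite SwE in u1 l1 h5 h6.
have ge0 : 0 <= gz%:R * e1 by rewrite mulr_ge0 // ltW.
move: B0 zm; rewrite /B => B0 zm.
apply/andP; split; lra.
Qed.

End parts.

(** * Equilibrium measures *)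

Lemma integral_on_full (R : realType) (d : measure_display) (T : measurableType d)
    (nu : probability T R) (S : set T) (phi g : T -> R) :
  measurable S -> nu S = 1%E -> bounded_meas g -> (forall x, S x -> g x = phi x) ->
  (\int[nu]_(x in S) (phi x)%:E = (\int[nu]_x g x)%:E)%E.
Proof.
move=> mS S1 bg gphi; have ig := bounded_meas_integrable nu bg.
rewrite (eq_integral (EFin \o g)); last by move=> x /[!inE] Sx; rewrite /= gphi.
have N0 : nu (~` S) = 0%E.
  have := pr_setC nu mS; rewrite /pr S1 subrr => e0.
  by rewrite -[LHS]fineK ?e0 // fin_num_measure //; exact: measurableC.
rewrite /Rintegral fineK; last exact: integrable_fin_num.
rewrite [RHS](negligible_integral _ _ _ N0) //; last exact: measurableC.
by rewrite setTD setCK.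
Qed.

Theorem theorem2p1 (R : realType) (beta : R)
    (beta_gt1 : 1 < beta) (beta_nat : beta \isn't a Num.nat)
    (E : nat -> set (config (top_digit beta)))
    (E_transversal : word_transversal (Sigma_beta beta) E)
    (phi : config (top_digit beta) -> R)
    (phi_cont : {within Sigma_beta beta, continuous phi})
    (phi_osc : (total_osc_on (Sigma_beta beta) phi < +oo)%E)
    (nu : probability (borel_config (top_digit beta)) R) :
  (equilibrium_measure (Sigma_beta beta) E phi nu ->
   ((zbar beta n)%:R / n%:R : R) @[n --> \oo] --> (0 : R) ->
   weak_Gibbs (Sigma_beta beta) (fun x => phi x - pressure E phi) nu)
  /\
  (equilibrium_measure (Sigma_beta beta) E phi nu ->
   (0 < limn_esup (fun n : nat => ((zbar beta n)%:R / n%:R : R)%:E))%E ->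
   ~ weak_Gibbs (Sigma_beta beta) (fun x => phi x - pressure E phi) nu).
Proof.
have [_ [g [g_cont g_phi] <-] g_fin] := ereal_inf_lt phi_osc.
have [d [D H]] := bounded_oscP g_cont g_fin.
have Hc := expansion_cdig beta_gt1.
have [p Hp] := Zw_growth Hc H.
rewrite (pressureE beta_gt1 H g_phi Hp E_transversal).
split=> -[nu_on eq_nu] hz; last exact: (not_weak_Gibbs beta_gt1 H g_phi Hp nu_on hz).
have bg : bounded_meas (g : borel_config (top_digit beta) -> R).
  have := bounded_meas_birk_term H g_cont 0.
  by congr bounded_meas; apply/funext => x; congr g; apply/funext => i; rewrite /tshift addr0.
move: eq_nu; rewrite (pressureE beta_gt1 H g_phi Hp E_transversal).
rewrite (integral_on_full (measurable_Sigma beta_gt1) nu_on.1 bg g_phi).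
set I := \int[nu]_x g x => eq_nu.
have hE : metric_entropy nu (tshift 1) = (p - I)%:E.
  by rewrite EFinB eq_nu addeK.
apply: (is_weak_Gibbs beta_gt1 H g_phi Hp nu_on hE g_cont _ hz).
by rewrite subrK.
Qed.
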